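(* Let $G=(V,E)$ be a directed graph with non-negative integer edge weights, $|V|=n$, $|E|=m$. There is a randomized PRAM algorithm that preprocesses $G$ using $\tilde{O}(n^3)$ work and $\tilde{O}(1)$ parallel time and constructs a distance sensitivity oracle of size $\tilde{O}(n^2)$ words which, with high probability in $n$, answers every query $d(x,y,e)$ (for $x,y\in V$, $e\in E$) correctly using $O(1)$ work on a single processor.
   Context: PRAM model: synchronous processors sharing a memory (CREW variant); costs are measured by work (total number of operations) and parallel time/span (longest chain of dependent operations). $\tilde{O}$ hides factors polylogarithmic in $n$. For $x,y\in V$ and $e\in E$, $d(x,y,e)$ denotes the shortest-path distance from $x$ to $y$ in the graph $G$ with edge $e$ removed. A distance sensitivity oracle (DSO) is a data structure built by preprocessing $G$ that answers queries $d(x,y,e)$ for any $x,y\in V$, $e\in E$; its size is the number of words stored after preprocessing. ''With high probability in $n$'' means with probability at least $1-1/n^c$ for a constant $c$. *)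

(* Defs.v *)
(* [boolp] is used only for the boolean reflection [`[< _ >]]
   of the event whose probability is measured. *)
From mathcomp Require Import all_boot all_order all_algebra.
From mathcomp Require Import boolp.

Set Implicit Arguments.
Unset Strict Implicit.
Unset Printing Implicit Defensive.

Import Order.TTheory GRing.Theory Num.Theory.

(** * Randomized CREW PRAM with [w]-bit words *)

(* [d], [a], [b], [r] below are indices of private registers.  A program mentions
   finitely many registers and cannot address them indirectly, so a processor
   has O(1) words of private storage. *)

Variant binop := OpAdd | OpSub | OpMul | OpDiv | OpMod | OpLt | OpEq.

Variant instr :=
| Const of nat & nat            (* d := constant *)
| Op of binop & nat & nat & nat (* d := a op b *)
| Read of nat & nat             (* d := memory[a] *)
| Write of nat & nat            (* memory[a] := b *)
| Rand of nat.                  (* d := fresh uniformly random word *)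

Inductive cmd (A : Type) : Type :=
| Do of A
| Cond of nat & seq (cmd A) & seq (cmd A) (* first branch iff r <> 0 *)
| Loop of nat & seq (cmd A).              (* repeat while r <> 0 *)

Arguments Do {A}.
Arguments Cond {A}.
Arguments Loop {A}.

(* A PRAM program is run by a control processor which, besides ordinary
   instructions, can execute "for 0 <= i < r pardo s".  The number of processors
   is thus computed by the program itself, so that programs are uniform. *)
Variant action :=
| Step of instr
| Pardo of nat & seq (cmd instr).

Notation ram_prog := (seq (cmd instr)).
Notation pram_prog := (seq (cmd action)).

Notation memory := (nat -> nat).
Notation registers := (nat -> nat).

Definition upd (f : nat -> nat) (a v : nat) : nat -> nat :=
  fun b => if b == a then v else f b.

Record proc (A : Type) := Proc { regs : registers; todo : seq (cmd A) }.

Definition halted_proc (A : Type) (P : proc A) : bool := nilp (todo P).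

(* The primitive due for execution, if any, and the processor after control
   has moved on; evaluating a branching condition is an operation of its own. *)
Definition fetch (A : Type) (P : proc A) : option A * proc A :=
  let R := regs P in
  match todo P with
  | [::] => (None, P)
  | Do a :: k => (Some a, Proc R k)
  | Cond r s1 s2 :: k => (None, Proc R ((if R r == 0 then s2 else s1) ++ k))
  | Loop r s :: k => (None, Proc R (if R r == 0 then k else s ++ Loop r s :: k))
  end.

(* [OpSub] is truncated at 0, and division by 0 follows [divn] and [modn]. *)
Definition eval_op (o : binop) (x y : nat) : nat :=
  match o with
  | OpAdd => x + y
  | OpSub => x - y
  | OpMul => x * y
  | OpDiv => x %/ y
  | OpMod => x %% y
  | OpLt => x < y
  | OpEq => x == y
  end.

(* New registers, and the pair (address, value) written to memory, if any. *)
Definition exec_instr (w : nat) (M : memory) (coin : nat) (i : instr)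
    (R : registers) : registers * option (nat * nat) :=
  match i with
  | Const d v => (upd R d (v %% 2 ^ w), None)
  | Op o d a b => (upd R d (eval_op o (R a) (R b) %% 2 ^ w), None)
  | Read d a => (upd R d (M (R a)), None)
  | Write a b => (R, Some (R a, R b))
  | Rand d => (upd R d coin, None)
  end.

Definition proc_step (w : nat) (M : memory) (coin : nat) (P : proc instr) :
    proc instr * option (nat * nat) :=
  let: (oi, P') := fetch P in
  if oi is Some i then
    let: (R, wr) := exec_instr w M coin i (regs P) in (Proc R (todo P'), wr)
  else (P', None).

Definition commit (writes : seq (nat * nat)) (M : memory) : memory :=
  foldr (fun (wr : nat * nat) (M' : memory) => upd M' wr.1 wr.2)
    M writes.

(* One synchronous step of processors 0, ..., p-1: all reads see the memory before
   the step, and two simultaneous writes to the same cell are a fault (exclusive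
   write), while concurrent reads are allowed. *)
Definition team_step (w : nat) (M : memory) (coins : nat -> nat) (p : nat)
    (ps : nat -> proc instr) : option (memory * (nat -> proc instr)) :=
  let out i := proc_step w M (coins i) (ps i) in
  let writes := pmap (fun i => (out i).2) (iota 0 p) in
  if uniq (unzip1 writes) then Some (commit writes M, fun i => (out i).1)
  else None.

Record config := Config {
  time : nat;
  work : nat;
  shared : memory;
  control : proc action;
  nproc : nat;
  procs : nat -> proc instr
}.

Definition nactive (c : config) : nat :=
  count (fun i => ~~ halted_proc (procs c i)) (iota 0 (nproc c)).

Definition halted (c : config) : bool :=
  halted_proc (control c) && (nactive c == 0).

(* The control processor waits until the processors that it has launched have
   halted.  [coins t i] is the random word available at time [t] to processor [i],
   the control processor using the index 0 while it runs alone.  Launching [p]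
   processors takes one time step and costs one operation per processor, plus one;
   processor [i] starts with its number [i] in register 0 and with copies of the
   other control registers. *)
Definition step (w : nat) (coins : nat -> nat -> nat) (c : config) :
    option config :=
  let: Config t wk M H p ps := c in
  if 0 < nactive c then
    if team_step w M (coins t) p ps is Some (M', ps')
    then Some (Config t.+1 (wk + nactive c) M' H p ps')
    else None
  else
    match fetch H with
    | (None, H') => Some (Config t.+1 wk.+1 M H' p ps)
    | (Some (Step i), H') =>
        let: (R, wr) := exec_instr w M (coins t 0) i (regs H) in
        Some (Config t.+1 wk.+1 (commit (if wr is Some x then [:: x] else [::]) M)
                (Proc R (todo H')) p ps)
    | (Some (Pardo r s), H') =>
        let R := regs H in
        Some (Config t.+1 (wk + (R r).+1) M H' (R r)
                (fun i => Proc (upd R 0 i) s))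
    end.

Inductive runs (w : nat) (coins : nat -> nat -> nat) : config -> config -> Prop :=
| runs_halted c : halted c -> runs w coins c c
| runs_step c c' c'' :
    ~~ halted c -> step w coins c = Some c' -> runs w coins c' c'' ->
    runs w coins c c''.

Definition idle (A : Type) : proc A := Proc (fun=> 0) [::].

Definition pram_start (prog : pram_prog) (M : memory) : config :=
  Config 0 0 M (Proc (fun=> 0) prog) 0 (fun=> idle instr).

Definition pram_run (w : nat) (coins : nat -> nat -> nat) (prog : pram_prog)
    (M M' : memory) (t wk : nat) : Prop :=
  exists c, [/\ runs w coins (pram_start prog M) c,
                shared c = M', time c = t & work c = wk].

(* A deterministic single-processor run on arguments [args], placed in registers
   0, 1, ...; the result is read from register 0. *)
Definition ram_start (prog : ram_prog) (M : memory) (args : seq nat) : config :=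
  Config 0 0 M (idle action) 1 (fun=> Proc (nth 0 args) prog).

Definition ram_run (w : nat) (prog : ram_prog) (M : memory) (args : seq nat)
    (result wk : nat) : Prop :=
  exists c, [/\ runs w (fun _ _ => 0) (ram_start prog M args) c,
                regs (procs c 0) 0 = result & work c = wk].

(** * Uniform random words *)

(* Time steps below [T] and processor numbers below [P] have independent uniform
   words; a run of at most [T] steps and [P] operations uses no other coin. *)
Definition coin_space (T P w : nat) : finType :=
  {ffun 'I_T * 'I_P -> 'I_(2 ^ w)}.

Definition coins_of (T P w : nat) (omega : coin_space T P w) (t i : nat) : nat :=
  match insub t, insub i with
  | Some t', Some i' => nat_of_ord (omega (t', i'))
  | _, _ => 0
  end.

Definition Pr (Omega : finType) (A : Omega -> Prop) : rat :=
  (#|[set omega | `[< A omega >]]|%:R / #|Omega|%:R)%R.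

(** * Distances in weighted directed graphs *)

Definition edge_rel (n : nat) (E : {set 'I_n * 'I_n}) : rel 'I_n :=
  fun u v => (u, v) \in E.

Definition walk_weight (n : nat) (wt : 'I_n * 'I_n -> nat) (x : 'I_n)
    (p : seq 'I_n) : nat :=
  sumn (pairmap (fun u v => wt (u, v)) x p).

(* Walks may repeat vertices; with non-negative weights this does not change the
   minimum.  [None] is the infinite distance. *)
Definition is_dist (n : nat) (E : {set 'I_n * 'I_n}) (wt : 'I_n * 'I_n -> nat)
    (x y : 'I_n) (d : option nat) : Prop :=
  match d with
  | Some l =>
      (exists p, [/\ path (edge_rel E) x p, last x p = y
                   & walk_weight wt x p = l]) /\
      (forall p, path (edge_rel E) x p -> last x p = y ->
                 l <= walk_weight wt x p)
  | None => forall p, path (edge_rel E) x p -> last x p <> y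
  end.

(** * Words and asymptotics *)

(* A natural number or infinity as one machine word. *)
Definition encode (d : option nat) : nat := if d is Some l then l.+1 else 0.

(* [n], followed by the weighted adjacency matrix in row-major order. *)
Definition graph_mem (n : nat) (E : {set 'I_n * 'I_n}) (wt : 'I_n * 'I_n -> nat) :
    memory :=
  nth 0 (n :: [seq encode (if (u, v) \in E then Some (wt (u, v)) else None)
              | u <- enum 'I_n, v <- enum 'I_n]).

(* Only the first [s] words of [M] are kept. *)
Definition truncate_mem (s : nat) (M : memory) : memory :=
  fun a => if a < s then M a else 0.

(* Logarithmic factor that does not vanish at [n = 1]. *)
Definition lg (n : nat) : nat := (trunc_log 2 n).+1.

(* Main.v *)
(* The algorithm is deterministic.  Pad the vertices to N = 2^L and let dv x y v be
   the distance from x to y with v excluded as an intermediate vertex.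

   Preprocessing.  All dv x y v are computed by divide and conquer over the blocks of
   the binary representation of v: descending from a block to one of its halves
   admits the vertices of the other half as intermediates, which takes L + 1 min-plus
   relaxations restricted to that half.  Each level costs N^3 operations up to
   logarithmic factors, minima being taken by a butterfly reduction.

   Vertex failures.  Call u critical for (x, y) if dv x y u > d x y.  Critical vertices
   take over the role of the vertices of a canonical shortest path in the oracle of
   Demetrescu, Thorup, Chowdhury and Ramachandran, without any tie-breaking: they are
   linearly ordered, and those of (x, y) before u are the critical vertices of (x, u).
   With rank x y one more than their number, let x' be 2^i critical vertices before u
   and y' be 2^j after u, where i and j are the binary logarithms of rank x u and
   rank u y.  A shortest walk avoiding u can be assumed to visit x', to visit y', or to
   avoid all critical vertices with the same i and j as u; hence dv x y u is the minimum
   of d x x' + dv x' y u, dv x y' u + d y' y, and the maximum of dv x y b over the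
   class of u.  All of these fit in O(N^2 log^2 N) tabulated values.

   Edge failures.  If e = (u, v), a walk avoiding e either avoids u or leaves u for the
   last time by another edge.  So d(x, y, e) is the minimum of dv x y u and
   d x u + d(u, y, e), and d(u, y, e) is determined by the best and the second best
   first edge from u to y. *)

Require Import Defs.
From mathcomp Require Import all_boot all_order all_algebra.
From mathcomp Require Import boolp.
From mathcomp Require Import zify.

Set Implicit Arguments.
Unset Strict Implicit.
Unset Printing Implicit Defensive.

(** * Straight-line expressions *)

(** The word size shapes the proof as much as the graph theory does. A bound [X] on all named
    registers and memory cells is maintained throughout; every expression stays below a fixed power
    of [X], which [2 ^ w] exceeds, so that no arithmetic wraps around. Teams of processors evaluate
    straight-line expressions, selection being done by arithmetic; they stay in lockstep, and each
    processor writes to a cell of its own, so that no write conflict arises. No random word is ever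
    drawn: the final memory is the same for all coins, and the probability of success is 1. Ties
    between shortest walks, usually removed by perturbing the weights, do no harm because being
    critical is a strict inequality between two distances and involves no choice of a walk. Weights
    equal to 0 are covered too, as only lengths of walks are compared. The cubic family of values
    [dv] is too large to be kept. A query therefore has to recognise critical vertices from
    distances and ranks alone, and landmarks at powers of two leave only logarithmically many
    distances to keep for each pair. *)

Inductive expr : Type :=
| Var of nat
| Cst of nat
| Bin of binop & expr & expr
| Get of expr.

Fixpoint eval (e : expr) (rho : registers) (M : memory) : nat :=
  match e with
  | Var r => rho r
  | Cst v => v
  | Bin o a b => eval_op o (eval a rho M) (eval b rho M)
  | Get a => M (eval a rho M)
  end.

(* Leaves the value in register [d], using only registers [>= d] as scratch. *)
Fixpoint compile (d : nat) (e : expr) : seq instr :=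
  match e with
  | Var r => [:: Const d 0; Op OpAdd d r d]
  | Cst v => [:: Const d v]
  | Bin o a b => compile d a ++ compile d.+1 b ++ [:: Op o d d d.+1]
  | Get a => compile d a ++ [:: Read d d]
  end.

(** Registers below [nreg] hold named variables; those from [nreg] on are scratch for compiled code,
    which is why [agree] ignores them. *)
Definition nreg : nat := 16.

(** There is no instruction that copies a register; adding a zero takes its place. *)
Definition assign (r : nat) (e : expr) : seq instr :=
  compile nreg e ++ [:: Const nreg.+1 0; Op OpAdd r nreg nreg.+1].

(* If all named registers and all memory cells are at most [X >= 2], then every
   intermediate value of [e] is at most [X ^ degree e]. *)
Fixpoint degree (e : expr) : nat :=
  match e with
  | Var _ => 1
  | Cst v => v
  | Bin OpAdd a b => (maxn (degree a) (degree b)).+1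
  | Bin OpMul a b => degree a + degree b
  | Bin (OpSub | OpDiv | OpMod) a _ => degree a
  | Bin (OpLt | OpEq) _ _ => 0
  | Get _ => 1
  end.

(** A bound for all expressions below, checked by computation. It enters the word size through the
    exponent [kappa] of the theorem. *)
Definition maxdeg : nat := 40.

Fixpoint fits (e : expr) : bool :=
  (degree e <= maxdeg) &&
  match e with
  | Var r => r < nreg
  | Cst _ => true
  | Bin _ a b => fits a && fits b
  | Get a => fits a
  end.

Definition agree (R rho : registers) : Prop := forall r, r < nreg -> R r = rho r.

Definition bounded (X : nat) (rho : registers) (M : memory) : Prop :=
  (forall r, r < nreg -> rho r <= X) /\ (forall a, M a <= X).

Definition run_instrs (w : nat) (M : memory) (l : seq instr) (R : registers) :
    registers :=
  foldl (fun R i => (exec_instr w M 0 i R).1) R l.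

Definition silent (i : instr) : bool :=
  match i with Write _ _ | Rand _ => false | _ => true end.

Lemma run_instrs_cat w M l1 l2 R :
  run_instrs w M (l1 ++ l2) R = run_instrs w M l2 (run_instrs w M l1 R).
Proof. by rewrite /run_instrs foldl_cat. Qed.

Lemma compile_silent d e : all silent (compile d e).
Proof.
elim: e d => [r|v|o a IHa b IHb|a IHa] d //=; rewrite !all_cat ?IHa ?IHb //.
Qed.

Lemma assign_silent r e : all silent (assign r e).
Proof. by rewrite /assign all_cat compile_silent. Qed.

Lemma upd_same f a v : upd f a v a = v.
Proof. by rewrite /upd eqxx. Qed.

Lemma upd_other f a v b : b != a -> upd f a v b = f b.
Proof. by rewrite /upd => /negPf->. Qed.

Section Words.

Variables (w X : nat).
Hypotheses (X_gt1 : 1 < X) (fitX : X ^ maxdeg < 2 ^ w).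

Lemma degree_fits e : fits e -> degree e <= maxdeg.
Proof. by case: e => [r|v|o a b|a] //= /andP[]. Qed.

Lemma eval_le_degree e rho M :
  bounded X rho M -> fits e -> eval e rho M <= X ^ degree e.
Proof.
move=> [bR bM]; have X0 : 0 < X by lia.
have XP m : 0 < X ^ m by rewrite expn_gt0 X0.
elim: e => [r|v|o a IHa b IHb|a IHa].
- by move=> /= /bR.
- by move=> _ /=; apply: ltnW; apply: ltn_expl.
- move=> /= /and3P[_ /IHa{}IHa /IHb{}IHb].
  case: o => /=.
  + rewrite expnS.
    have := leq_pexp2l X0 (leq_maxl (degree a) (degree b)).
    have := leq_pexp2l X0 (leq_maxr (degree a) (degree b)).
    by nia.
  + by apply: leq_trans IHa; apply: leq_subr.
  + by rewrite expnD; apply: leq_mul.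
  + by apply: leq_trans IHa; apply: leq_div.
  + by apply: leq_trans IHa; apply: leq_mod.
  + by rewrite expn0; case: (_ < _).
  + by rewrite expn0; case: (_ == _).
- by move=> _ /=; apply: bM.
Qed.

Lemma eval_lt_word e rho M :
  bounded X rho M -> fits e -> eval e rho M < 2 ^ w.
Proof.
move=> bd fe; apply: leq_ltn_trans (eval_le_degree bd fe) _.
by apply: leq_ltn_trans fitX; rewrite leq_exp2l ?degree_fits.
Qed.

(** Instructions compute modulo [2 ^ w], but the degree bound rules out any reduction. The second
    clause protects the left operand in register [d] while the right one is computed from [d.+1]
    on. *)
Lemma compile_correct e d rho M R :
  bounded X rho M -> fits e -> nreg <= d -> agree R rho ->
  let R' := run_instrs w M (compile d e) R in
  R' d = eval e rho M /\ (forall r, r < d -> R' r = R r).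
Proof.
move=> bd; elim: e d R => [r|v|o a IHa b IHb|a IHa] d R fe Kd ag.
- have := eval_lt_word bd fe; move: fe => /= rK small.
  split=> [|r' r'd]; last by rewrite !upd_other // ltn_eqF.
  rewrite upd_same upd_other ?upd_same; last by rewrite ltn_eqF //; lia.
  by rewrite mod0n addn0 ag // modn_small.
- have := eval_lt_word bd fe => /= small.
  split=> [|r' r'd]; last by rewrite !upd_other // ltn_eqF.
  by rewrite upd_same modn_small.
- have small := eval_lt_word bd fe.
  move: fe => /= /and3P[_ fa fb]; rewrite !run_instrs_cat.
  set R1 := run_instrs w M (compile d a) R.
  have [R1d R1o] := IHa d R fa Kd ag.
  have ag1 : agree R1 rho.
    by move=> r rK; rewrite [R1 r]R1o ?ag //; apply: leq_trans Kd.
  have [] := IHb d.+1 R1 fb _ ag1; first by lia.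
  set R2 := run_instrs w M _ R1 => R2d R2o.
  split=> [|r rd] /=.
    by rewrite upd_same R2d [R2 d]R2o // /R1 R1d modn_small.
  by rewrite upd_other ?ltn_eqF // R2o ?/R1 ?R1o //; lia.
- move: fe => /= fa; rewrite run_instrs_cat.
  have [R1d R1o] := IHa d R fa Kd ag.
  split=> [|r rd] /=; first by rewrite upd_same R1d.
  by rewrite upd_other ?ltn_eqF // R1o.
Qed.

Lemma assign_correct r e rho M R :
  bounded X rho M -> fits e -> agree R rho -> r < nreg ->
  agree (run_instrs w M (assign r e) R) (upd rho r (eval e rho M)).
Proof.
move=> bd fe ag rK r' r'K; rewrite /assign run_instrs_cat.
have := compile_correct bd fe (leqnn _) ag.
move: (run_instrs w M (compile nreg e) R) => R1 /= [R1d R1o].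
case: (eqVneq r' r) => [->|ne]; last by rewrite !upd_other ?R1o ?ag //; lia.
rewrite !upd_same upd_other ?R1d ?mod0n ?addn0 ?modn_small //.
exact: eval_lt_word bd fe.
Qed.

End Words.

(** * Runs of the machine *)

(** [runs] only ends in halted configurations, so reaching [c'] is expressed by its effect on
    completed runs. *)
Definition leads (w : nat) (coins : nat -> nat -> nat) (c c' : config) : Prop :=
  forall cf, runs w coins c' cf -> runs w coins c cf.

Lemma leads_trans w coins c1 c2 c3 :
  leads w coins c1 c2 -> leads w coins c2 c3 -> leads w coins c1 c3.
Proof. by move=> h1 h2 cf /h2/h1. Qed.

Lemma leads_step w coins c c' :
  ~~ halted c -> step w coins c = Some c' -> leads w coins c c'.
Proof. by move=> nh st cf; apply: runs_step nh st. Qed.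

(** One common remaining code for all processors: without branching they never diverge. *)
Definition team (A : Type) (R : nat -> registers) (k : seq (cmd A)) :
  nat -> proc A := fun i => Proc (R i) k.

Lemma nactive_team t wk M H p R i k :
  nactive (Config t wk M H p (team R (i :: k))) = p.
Proof.
rewrite /nactive /= (eq_count (a2 := predT)) ?count_predT ?size_iota //.
Qed.

Lemma exec_silent w M coin i R :
  silent i -> exec_instr w M coin i R = ((exec_instr w M 0 i R).1, None).
Proof. by case: i. Qed.

Lemma leads_silent w coins M H p l k R t wk :
  0 < p -> all silent l ->
  leads w coins (Config t wk M H p (team R (map Do l ++ k)))
    (Config (t + size l) (wk + size l * p) M H p
       (team (fun i => run_instrs w M l (R i)) k)).
Proof.
move=> p_gt0; elim: l R t wk => [|i l IHl] R t wk /=.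
  by move=> _; rewrite mul0n !addn0.
move=> /andP[si sl]; apply: leads_trans; last first.
  have := IHl (fun j => run_instrs w M [:: i] (R j)) t.+1 (wk + p) sl.
  by rewrite addSnnS -addnA -mulSn; apply.
apply: leads_step; first by rewrite /halted nactive_team eqn0Ngt p_gt0 andbF.
rewrite /step nactive_team p_gt0 /team_step.
have E j : proc_step w M (coins t j) (team R (map Do (i :: l) ++ k) j) =
    (Proc (run_instrs w M [:: i] (R j)) (map Do l ++ k), None).
  by rewrite /team /proc_step /= exec_silent.
have -> s : pmap (fun j =>
    (proc_step w M (coins t j) (team R (map Do (i :: l) ++ k) j)).2) s = [::].
  by elim: s => //= j s; rewrite E.
by congr (Some (Config _ _ _ _ _ _)); apply: funext => j; rewrite E.
Qed.

Lemma commit_get wr M a v :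
  uniq (unzip1 wr) -> (a, v) \in wr -> commit wr M a = v.
Proof.
elim: wr => [|[b u] wr IHwr] //= /andP[bwr uwr].
rewrite inE => /orP[/eqP[<- <-]|avwr]; first by rewrite upd_same.
rewrite upd_other ?IHwr //; apply: contra bwr => /eqP<-.
by apply/mapP; exists (a, v).
Qed.

Lemma commit_out wr M a : a \notin unzip1 wr -> commit wr M a = M a.
Proof.
elim: wr => [|[b u] wr IHwr] //=; rewrite inE negb_or => /andP[ab awr].
by rewrite upd_other ?IHwr.
Qed.

Definition overwrite (M : memory) (b p : nat) (f : nat -> nat) : memory :=
  fun a => if (b <= a) && (a < b + p) then f (a - b) else M a.

Lemma commit_overwrite M b p f :
  commit [seq (b + i, f i) | i <- iota 0 p] M = overwrite M b p f.
Proof.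
have u1 : unzip1 [seq (b + i, f i) | i <- iota 0 p] = iota b p.
  by rewrite -[in RHS](addn0 b) iotaDl /unzip1 -map_comp.
apply: funext => a; rewrite /overwrite; case: ifPn => ab; last first.
  by rewrite commit_out // u1 mem_iota.
rewrite (@commit_get _ _ _ (f (a - b))) //; first by rewrite u1 iota_uniq.
apply/mapP; exists (a - b); last by congr pair; lia.
by rewrite mem_iota; lia.
Qed.

(** The addresses [b + i] are distinct, so the exclusive-write test of [team_step] succeeds. *)
Lemma leads_write w coins M H p R t wk ra rv b f :
  0 < p -> (forall i, i < p -> R i ra = b + i) ->
  (forall i, i < p -> R i rv = f i) ->
  leads w coins (Config t wk M H p (team R [:: Do (Write ra rv)]))
    (Config t.+1 (wk + p) (overwrite M b p f) H p (team R [::])).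
Proof.
move=> p_gt0 Ra Rv; apply: leads_step.
  by rewrite /halted nactive_team eqn0Ngt p_gt0 andbF.
rewrite /step nactive_team p_gt0 /team_step.
rewrite [pmap _ _](_ : _ = [seq (b + i, f i) | i <- iota 0 p]); last first.
  have : {in iota 0 p, forall i, i < p} by move=> i; rewrite mem_iota.
  elim: (iota 0 p) => //= i s IHs ip.
  rewrite /oapp /= Ra ?Rv ?IHs ?ip ?mem_head // => j js.
  by apply: ip; rewrite inE js orbT.
rewrite /unzip1 -map_comp (eq_map (g := addn b)) // -iotaDl iota_uniq.
by rewrite commit_overwrite.
Qed.

(** A halted team remains in the configuration; the control processor may act once it is quiet. *)
Definition quiet (p : nat) (ps : nat -> proc instr) : bool :=
  count (fun i => ~~ halted_proc (ps i)) (iota 0 p) == 0.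

Lemma leads_control w coins M l R k p ps t wk :
  quiet p ps -> all silent l ->
  leads w coins
    (Config t wk M (Proc R ([seq Do (Step i) | i <- l] ++ k)) p ps)
    (Config (t + size l) (wk + size l) M (Proc (run_instrs w M l R) k) p ps).
Proof.
move=> q0; elim: l R t wk => [|i l IHl] R t wk /=; first by rewrite !addn0; move=> _ cf.
move=> /andP[si sl]; apply: leads_trans; last first.
  have := IHl (run_instrs w M [:: i] R) t.+1 wk.+1 sl.
  by rewrite !addSnnS; apply.
apply: leads_step; first by rewrite /halted.
by rewrite /step /nactive [nproc _]/= [procs _]/= (eqP q0) /= exec_silent.
Qed.

Lemma leads_pardo w coins M R r s k p ps t wk :
  quiet p ps ->
  leads w coins (Config t wk M (Proc R (Do (Pardo r s) :: k)) p ps)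
    (Config t.+1 (wk + (R r).+1) M (Proc R k) (R r)
       (team (fun i => upd R 0 i) s)).
Proof.
move=> q0; apply: leads_step; first by rewrite /halted.
by rewrite /step /nactive [nproc _]/= [procs _]/= (eqP q0).
Qed.

Lemma leads_loop w coins M R r s k p ps t wk :
  quiet p ps ->
  leads w coins (Config t wk M (Proc R (Loop r s :: k)) p ps)
    (Config t.+1 wk.+1 M
       (Proc R (if R r == 0 then k else s ++ Loop r s :: k)) p ps).
Proof.
move=> q0; apply: leads_step; first by rewrite /halted.
by rewrite /step /nactive [nproc _]/= [procs _]/= (eqP q0).
Qed.

Lemma quiet_team p (R : nat -> registers) : quiet p (team R [::]).
Proof. by rewrite /quiet; elim: (iota 0 p). Qed.

(** * Total correctness of control programs *)

Definition set_reg (r : nat) (e : expr) : pram_prog :=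
  [seq Do (Step i) | i <- assign r e].

Definition map_code (b : nat) (e : expr) : seq instr :=
  compile nreg (Bin OpAdd (Var b) (Var 0)) ++ compile nreg.+1 e.

(* In [e], register 0 holds the processor number. *)
Definition par_map (b c : nat) (e : expr) : pram_prog :=
  [:: Do (Pardo c [seq Do i | i <- rcons (map_code b e) (Write nreg nreg.+1)])].

Lemma map_code_silent b e : all silent (map_code b e).
Proof. by rewrite /map_code all_cat !compile_silent. Qed.

Section WP.

Variables (w X B : nat).

(* [prog] terminates within [t] steps, in each of which at most [B + 1]
   operations are executed. *)
Variant wp (prog : pram_prog) (t : nat) (Q : registers -> memory -> Prop)
    (rho : registers) (M : memory) : Prop := Wp of
  forall R, agree R rho -> exists R' rho' M' t',
    [/\ t' <= t, agree R' rho', bounded X rho' M' & Q rho' M'] /\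
    forall coins T0 W0 k p ps, quiet p ps -> exists p' ps' W',
      [/\ quiet p' ps', W' <= W0 + t' * B.+1 &
        leads w coins (Config T0 W0 M (Proc R (prog ++ k)) p ps)
          (Config (T0 + t') W' M' (Proc R' k) p' ps')].

Lemma wp_weaken prog t1 t2 (Q1 Q2 : registers -> memory -> Prop) rho M :
  wp prog t1 Q1 rho M -> t1 <= t2 ->
  (forall rho' M', bounded X rho' M' -> Q1 rho' M' -> Q2 rho' M') ->
  wp prog t2 Q2 rho M.
Proof.
move=> [H] t12 Q12; split=> R ag.
have [R' [rho' [M' [t' [[t't ag' bd' q] run]]]]] := H R ag.
exists R', rho', M', t'; split=> //; split=> //; last exact: Q12.
exact: leq_trans t12.
Qed.

Lemma wp_cat prog1 prog2 t1 t2 (Q : registers -> memory -> Prop) rho M :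
  wp prog1 t1 (wp prog2 t2 Q) rho M -> wp (prog1 ++ prog2) (t1 + t2) Q rho M.
Proof.
move=> [H]; split=> R ag.
have [R1 [rho1 [M1 [s1 [[st1 ag1 bd1 [H2]] run1]]]]] := H R ag.
have [R2 [rho2 [M2 [s2 [[st2 ag2 bd2 q] run2]]]]] := H2 R1 ag1.
exists R2, rho2, M2, (s1 + s2); split; first by split; rewrite ?leq_add.
move=> coins T0 W0 k p ps q0.
have [p1 [ps1 [W1 [q1 W1le L1]]]] := run1 coins T0 W0 (prog2 ++ k) p ps q0.
have [p2 [ps2 [W2 [q2 W2le L2]]]] := run2 coins (T0 + s1) W1 k p1 ps1 q1.
exists p2, ps2, W2; split=> //; first by lia.
by rewrite -catA addnA; apply: leads_trans L1 L2.
Qed.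

(** The invariant is indexed by the number of completed iterations, of which there are exactly [m].
    Each test of [r] costs a step, including the last one, which fails. *)
Lemma wp_loop r body t m (I : nat -> registers -> memory -> Prop)
    (Q : registers -> memory -> Prop) rho M :
  r < nreg -> bounded X rho M -> I 0 rho M ->
  (forall j rho M, j < m -> bounded X rho M -> I j rho M ->
     rho r != 0 /\ wp body t (I j.+1) rho M) ->
  (forall rho M, bounded X rho M -> I m rho M -> rho r = 0 /\ Q rho M) ->
  wp [:: Loop r body] (m * t.+1).+1 Q rho M.
Proof.
move=> rK bd I0 Hbody Hend.
have [j def_m] : exists j, m = j + 0 by exists m; rewrite addn0.
have [i def_i] : exists i, i + m = m by exists 0.
suff: forall d i rho M, i + d = m -> bounded X rho M -> I i rho M ->
    wp [:: Loop r body] (d * t.+1).+1 Q rho M by move/(_ m 0); apply.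
elim=> [|d IHd] {i def_i} {}i {I0 bd}rho' M' idm bd Ii; split=> R ag.
  move: Ii; rewrite -[i]addn0 idm => Im; have [r0 q] := Hend _ _ bd Im.
  exists R, rho', M', 1; split=> // coins T0 W0 k p ps q0.
  exists p, ps, W0.+1; split=> //; first by lia.
  have := @leads_loop w coins M' R r body k p ps T0 W0 q0.
  by rewrite (ag _ rK) r0 addn1.
have im : i < m by lia.
have [rn0 [H]] := Hbody i rho' M' im bd Ii.
have [R1 [rho1 [M1 [s1 [[st1 ag1 bd1 I1] run1]]]]] := H R ag.
have idm' : i.+1 + d = m by lia.
have [{}H] := IHd i.+1 rho1 M1 idm' bd1 I1.
have [R2 [rho2 [M2 [s2 [[st2 ag2 bd2 q] run2]]]]] := H R1 ag1.
exists R2, rho2, M2, (s1 + s2).+1; split; first by split=> //; lia.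
move=> coins T0 W0 k p ps q0.
have L := @leads_loop w coins M' R r body k p ps T0 W0 q0.
rewrite (ag _ rK) (negPf rn0) in L.
have [p1 [ps1 [W1 [q1 W1le L1]]]] :=
  run1 coins T0.+1 W0.+1 (Loop r body :: k) p ps q0.
have [p2 [ps2 [W2 [q2 W2le L2]]]] := run2 coins (T0.+1 + s1) W1 k p1 ps1 q1.
exists p2, ps2, W2; split=> //; first by lia.
apply: leads_trans L _; apply: leads_trans L1 _.
by rewrite addnS -addSn addnA.
Qed.

(** The final memory is quantified before [coins]; this is where determinism becomes visible. *)
Lemma pram_run_wp prog t (Q : registers -> memory -> Prop) M :
  wp prog t Q (fun=> 0) M ->
  exists rho M', [/\ bounded X rho M', Q rho M' & forall coins, exists t' wk,
    [/\ pram_run w coins prog M M' t' wk, t' <= t & wk <= t * B.+1]].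
Proof.
move=> [H].
have [|R [rho [M' [t' [[t't _ bd q] run]]]]] := H (fun=> 0); first by [].
exists rho, M'; split=> // coins.
have [p [ps [W [q0 Wle L]]]] := run coins 0 0 [::] 0 (fun=> idle instr) erefl.
exists t', W; split=> //; last by apply: leq_trans Wle _; rewrite add0n leq_mul2r t't orbT.
exists (Config t' W M' (Proc R [::]) p ps); split=> //.
rewrite cats0 in L; apply: L; apply: runs_halted.
by rewrite /halted /= /nactive.
Qed.

Hypotheses (X_gt1 : 1 < X) (fitX : X ^ maxdeg < 2 ^ w).

Lemma wp_set r e (Q : registers -> memory -> Prop) rho M :
  bounded X rho M -> fits e -> r < nreg -> eval e rho M <= X ->
  Q (upd rho r (eval e rho M)) M -> wp (set_reg r e) (size (assign r e)) Q rho M.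
Proof.
move=> bd fe rK vX q; split=> R ag.
exists (run_instrs w M (assign r e) R), (upd rho r (eval e rho M)), M.
exists (size (assign r e)); split.
  split=> //; first by apply: (assign_correct X_gt1 fitX).
  by case: bd => bR bM; split=> // r' r'K; rewrite /upd; case: eqP => // _; apply: bR.
move=> coins T0 W0 k p ps q0.
exists p, ps, (W0 + size (assign r e)); split=> //; first by nia.
by apply: leads_control => //; apply: assign_silent.
Qed.

(** The two steps beyond the compiled code are the launch and the common write. Register [b] cannot
    be 0, where a processor finds its own number. *)
Lemma wp_map b c e (Q : registers -> memory -> Prop) rho M f :
  bounded X rho M -> fits e -> 0 < b < nreg -> c < nreg -> 0 < rho c <= B ->
  (forall i, i < rho c -> eval e (upd rho 0 i) M = f i /\ f i <= X) ->
  Q rho (overwrite M (rho b) (rho c) f) ->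
  wp (par_map b c e) (size (map_code b e)).+2 Q rho M.
Proof.
move=> bd fe /andP[b_gt0 bK] cK /andP[c_gt0 cB] ef q; split=> R ag.
exists R, rho, (overwrite M (rho b) (rho c) f), (size (map_code b e)).+2.
case: (bd) => bR bM; split.
  split=> //; split=> // a; rewrite /overwrite; case: ifPn => // ha.
  by apply: (ef _ _).2; lia.
move=> coins T0 W0 k p ps q0.
have := leads_pardo (w := w) (coins := coins) (M := M) (R := R) (r := c)
  (s := [seq Do i | i <- rcons (map_code b e) (Write nreg nreg.+1)]) (k := k)
  (t := T0) (wk := W0) q0.
rewrite /par_map cat1s -(ag _ cK).
move=> L; exists (R c), (team (fun i => run_instrs w M (map_code b e) (upd R 0 i)) [::]).
exists (W0 + (R c).+1 + size (map_code b e) * R c + R c).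
have RB : R c <= B by rewrite ag.
split; first exact: quiet_team.
  by have := leq_mul (leqnn (size (map_code b e))) RB; nia.
have Rc_gt0 : 0 < R c by rewrite ag.
apply: leads_trans L _; rewrite map_rcons -cats1.
apply: leads_trans.
  by apply: leads_silent Rc_gt0 (map_code_silent b e).
have bdi i : i < R c -> bounded X (upd rho 0 i) M.
  move=> iR; split=> // r rK; rewrite /upd; case: eqP => // _; last exact: bR.
  by apply: leq_trans (bR c cK); rewrite -ag //; apply: ltnW.
have agi i : agree (upd R 0 i) (upd rho 0 i).
  by move=> r rK; rewrite /upd; case: eqP => // _; apply: ag.
have cor i (iR : i < R c) :
    let R' := run_instrs w M (map_code b e) (upd R 0 i) in
    R' nreg = rho b + i /\ R' nreg.+1 = f i.
  have fa : fits (Bin OpAdd (Var b) (Var 0)) by rewrite /= bK.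
  have [] := compile_correct X_gt1 fitX (bdi i iR) fa (leqnn _) (agi i).
  rewrite /map_code run_instrs_cat; move: (run_instrs _ _ _ _) => R1 R1d R1o.
  have ag1 : agree R1 (upd rho 0 i) by move=> r rK; rewrite R1o ?agi.
  have [] := compile_correct X_gt1 fitX (bdi i iR) fe (leqnSn _) ag1.
  move=> R2d R2o; split; last by rewrite R2d (ef i _).1 -?ag.
  by rewrite R2o // R1d /= upd_same upd_other // -lt0n.
have := @leads_write w coins M (Proc R k) (R c)
  (fun i => run_instrs w M (map_code b e) (upd R 0 i))
  (T0.+1 + size (map_code b e)) (W0 + (R c).+1 + size (map_code b e) * R c)
  nreg nreg.+1 (rho b) f Rc_gt0 (fun i iR => (cor i iR).1) (fun i iR => (cor i iR).2).
by rewrite !addSn !addnS.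
Qed.

Lemma ram_run_assign e args M :
  bounded X (nth 0 args) M -> fits e ->
  ram_run w [seq Do i | i <- assign 0 e] M args (eval e (nth 0 args) M)
    (size (assign 0 e)).
Proof.
move=> bd fe.
have cor := assign_correct X_gt1 fitX bd fe (R := nth 0 args) _ (isT : 0 < nreg).
exists (Config (size (assign 0 e)) (size (assign 0 e)) M (idle action) 1
  (team (fun=> run_instrs w M (assign 0 e) (nth 0 args)) [::])); split=> //=.
  have := @leads_silent w (fun _ _ => 0) M (idle action) 1 (assign 0 e) [::]
    (fun=> nth 0 args) 0 0 isT (assign_silent _ _).
  rewrite cats0 !add0n muln1; apply; apply: runs_halted.
  by [].
by rewrite (cor _ 0 isT) // upd_same.
Qed.

End WP.

(** * Extended natural numbers, [None] being infinity *)

Definition oadd (a b : option nat) : option nat :=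
  if a is Some x then (if b is Some y then Some (x + y) else None) else None.

Definition ole (a b : option nat) : bool :=
  if b is Some y then (if a is Some x then x <= y else false) else true.

Definition omin a b := if ole a b then a else b.
Definition omax a b := if ole a b then b else a.

Arguments oadd !a !b /.
Arguments ole : simpl nomatch.

Lemma ole_refl a : ole a a.
Proof. by case: a => /=. Qed.

Lemma ole_trans b a c : ole a b -> ole b c -> ole a c.
Proof. case: a b c => [x|] [y|] [z|] //=; lia. Qed.

Lemma ole_anti a b : ole a b -> ole b a -> a = b.
Proof. by case: a b => [x|] [y|] //= h1 h2; congr Some; lia. Qed.

Lemma ole_total a b : ole a b || ole b a.
Proof. by case: a b => [x|] [y|] //=; lia. Qed.

Lemma ole_add a b c d : ole a b -> ole c d -> ole (oadd a c) (oadd b d).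
Proof. case: a b c d => [x|] [y|] [z|] [t|] //=; lia. Qed.

Lemma oaddA : associative oadd.
Proof. by move=> [x|] [y|] [z|] //=; rewrite addnA. Qed.

Lemma oaddC : commutative oadd.
Proof. by move=> [x|] [y|] //=; rewrite addnC. Qed.

Lemma oadd0 a : oadd a (Some 0) = a.
Proof. by case: a => //= x; rewrite addn0. Qed.

Lemma add0o a : oadd (Some 0) a = a.
Proof. by case: a. Qed.

Lemma ole_addr a b : ole a (oadd a b).
Proof. case: a b => [x|] [y|] //=; lia. Qed.

Lemma ole_addl a b : ole a (oadd b a).
Proof. by rewrite oaddC ole_addr. Qed.

Lemma omin_lel a b : ole (omin a b) a.
Proof.
by rewrite /omin; have := ole_total a b; case E: (ole a b); rewrite ?ole_refl.
Qed.

Lemma omin_ler a b : ole (omin a b) b.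
Proof.
by rewrite /omin; have := ole_total a b; case E: (ole a b); rewrite ?ole_refl.
Qed.

Lemma omax_gel a b : ole a (omax a b).
Proof.
by rewrite /omax; have := ole_total a b; case E: (ole a b); rewrite ?ole_refl.
Qed.

Lemma omax_ger a b : ole b (omax a b).
Proof.
by rewrite /omax; have := ole_total a b; case E: (ole a b); rewrite ?ole_refl.
Qed.

(** * Walks *)

Section Walks.

Variable W : nat -> nat -> option nat.

Fixpoint wlen (x : nat) (q : seq nat) : option nat :=
  if q is y :: q' then oadd (W x y) (wlen y q') else Some 0.

Lemma wlen_cat x p q : wlen x (p ++ q) = oadd (wlen x p) (wlen (last x p) q).
Proof.
by elim: p x => [|y p IHp] x /=; [rewrite add0o | rewrite IHp oaddA].
Qed.

Lemma wlen_split x q1 b q2 y :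
  wlen x (rcons (q1 ++ b :: q2) y) =
    oadd (wlen x (rcons q1 b)) (wlen b (rcons q2 y)).
Proof.
by rewrite -cats1 -catA cat_cons cats1 -cat_rcons wlen_cat last_rcons.
Qed.

Lemma wlen_le x q l m :
  (forall u v e, W u v = Some e -> e <= m) -> wlen x q = Some l -> l <= size q * m.
Proof.
move=> Wm; elim: q x l => [|y q IHq] x l /=; first by case=> <-.
case Exy: (W x y) => [e|] //=; case Eyq: (wlen y q) => [l'|] //= [<-].
by rewrite mulSn leq_add ?(Wm _ _ _ Exy) ?(IHq _ _ Eyq).
Qed.

(** The closed walk between two occurrences of a vertex can be cut out without increasing the
    length. *)
Lemma wlen_shorten x q y :
  exists q', [/\ uniq q', subseq q' q &
    ole (wlen x (rcons q' y)) (wlen x (rcons q y))].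
Proof.
have [n] := ubnP (size q); elim: n q => // n IHn q; rewrite ltnS => qn.
have [uq|] := boolP (uniq q); first by exists q; split=> //; apply: ole_refl.
have : forall s : seq nat, ~~ uniq s ->
    exists s1 b s2 s3, s = s1 ++ b :: s2 ++ b :: s3.
  elim=> // a s IHs /=; rewrite negb_and negbK.
  case/orP=> [/splitPr[s2 s3]|/IHs[s1 [b [s2 [s3 ->]]]]].
    by exists [::], a, s2, s3.
  by exists (a :: s1), b, s2, s3.
move=> /[apply] -[s1 [b [s2 [s3 def_q]]]].
have [|q' [uq' sq' leq']] := IHn (s1 ++ b :: s3).
  by move: qn; rewrite def_q !size_cat /= size_cat /=; lia.
exists q'; split=> //.
  apply: subseq_trans sq' _; rewrite def_q cat_subseq //=.
  by rewrite eqxx -cat_rcons suffix_subseq.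
apply: ole_trans leq' _;
rewrite def_q (wlen_split _ _ _ s3) (wlen_split _ _ _ (_ ++ _)) wlen_split.
exact: ole_add (ole_refl _) (ole_addl _ _).
Qed.

(** [q] lists intermediate vertices only, so [S] leaves the endpoints free. Walks have at least one
    edge here; loops of weight 0 will stand for the empty walk. *)
Definition ismin (S : seq nat -> Prop) (x y : nat) (d : option nat) : Prop :=
  (forall q, S q -> ole d (wlen x (rcons q y))) /\
  (forall l, d = Some l -> exists q, S q /\ wlen x (rcons q y) = Some l).

Lemma ismin_ext (S1 S2 : seq nat -> Prop) x y d :
  (forall q, S1 q <-> S2 q) -> ismin S1 x y d -> ismin S2 x y d.
Proof.
move=> S12 [le ex]; split=> [q /S12/le //|l /ex[q [/S12 Sq E]]].
by exists q.
Qed.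

Lemma ismin_le S1 S2 x y d1 d2 :
  ismin S1 x y d1 -> ismin S2 x y d2 ->
  (forall q, S2 q -> exists q', S1 q' /\
     ole (wlen x (rcons q' y)) (wlen x (rcons q y))) ->
  ole d1 d2.
Proof.
case=> le1 _ [_ ex2] S21; case E2: d2 => [l|] //.
have [q [Sq Eq]] := ex2 l E2; have [q' [Sq' leq']] := S21 q Sq.
by rewrite -Eq; apply: ole_trans (le1 _ Sq') leq'.
Qed.

Lemma ismin_unique S x y d1 d2 : ismin S x y d1 -> ismin S x y d2 -> d1 = d2.
Proof.
move=> m1 m2; apply: ole_anti; [apply: ismin_le m1 m2 _|apply: ismin_le m2 m1 _];
by move=> q Sq; exists q; split=> //; apply: ole_refl.
Qed.

Lemma split_count (a : pred nat) k q :
  k < count a q -> exists q1 b q2, [/\ q = q1 ++ b :: q2, a b & count a q1 = k].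
Proof.
elim: q k => [|c q IHq] k //=.
case ac: (a c) => /=; last first.
  move=> /IHq[q1 [b [q2 [-> ab <-]]]]; exists (c :: q1), b, q2.
  by rewrite /= ac.
case: k => [|k]; first by exists [::], c, q.
rewrite add1n ltnS => /IHq[q1 [b [q2 [-> ab <-]]]]; exists (c :: q1), b, q2.
by rewrite /= ac.
Qed.

(** * Doubling the number of visits to a set of vertices *)

Section Doubling.

Variables (N : nat) (P B : pred nat).
Hypothesis B_lt : forall b, B b -> b < N.

Definition fewB (i : nat) (q : seq nat) : Prop :=
  all (predU P B) q /\ count B q < 2 ^ i.

(** A walk with at least [2 ^ i] visits to [B] is split at visit number [2 ^ i]: exactly [2 ^ i - 1]
    visits come before it and fewer than [2 ^ i] after it. *)
Lemma ismin_double i (D : nat -> nat -> option nat) x y m :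
  (forall x y, x < N -> y < N -> ismin (fewB i) x y (D x y)) ->
  x < N -> y < N ->
  (forall b, B b -> ole m (oadd (D x b) (D b y))) ->
  (m = None \/ exists2 b, B b & m = oadd (D x b) (D b y)) ->
  ismin (fewB i.+1) x y (omin (D x y) m).
Proof.
move=> HD xN yN m_le m_ex; split=> [q [allq cq]|l].
  have [c_lt|c_ge] := ltnP (count B q) (2 ^ i).
    exact: ole_trans (omin_lel _ _) ((HD x y xN yN).1 q (conj allq c_lt)).
  have [|q1 [b [q2 [def_q Bb c1]]]] := @split_count B (2 ^ i).-1 q.
    by rewrite prednK ?expn_gt0.
  move: allq cq; rewrite def_q all_cat count_cat /= Bb c1 => /and3P[all1 _ all2].
  rewrite expnS => c2; have pos : 0 < 2 ^ i by rewrite expn_gt0.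
  rewrite wlen_split; apply: ole_trans (omin_ler _ _) _.
  apply: ole_trans (m_le b Bb) _; apply: ole_add.
    by apply: (HD _ _ xN (B_lt Bb)).1; split=> //; lia.
  by apply: (HD _ _ (B_lt Bb) yN).1; split=> //; lia.
rewrite /omin; case: ifP => _ E.
  have [q [[allq cq] Eq]] := (HD x y xN yN).2 l E.
  by exists q; split=> //; split=> //; rewrite expnS; lia.
case: m_ex => [|[b Bb]]; first by rewrite E.
rewrite E; case E1: (D x b) => [l1|] //; case E2: (D b y) => [l2|] // [->].
have [q1 [[all1 c1] Eq1]] := (HD x b xN (B_lt Bb)).2 l1 E1.
have [q2 [[all2 c2] Eq2]] := (HD b y (B_lt Bb) yN).2 l2 E2.
exists (q1 ++ b :: q2); rewrite wlen_split Eq1 Eq2; split=> //.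
split; first by rewrite all_cat /= all1 all2 Bb orbT.
by rewrite count_cat /= Bb expnS; lia.
Qed.

Lemma ismin_few0 x y d :
  (forall b, P b -> ~~ B b) ->
  ismin (fewB 0) x y d <-> ismin (all P) x y d.
Proof.
move=> PB; have E q : fewB 0 q <-> all P q.
  rewrite /fewB expn0 ltnS leqn0; split.
    move=> [allq]; rewrite -leqn0 leqNgt -has_count => /hasPn nB.
    apply/allP => b bq; have /orP[//|Bb] := allP allq b bq.
    by case/negP: (nB b bq).
  move=> allq; split; first by apply: sub_all allq => b /= ->.
  rewrite -leqn0 leqNgt -has_count; apply/hasPn => b /(allP allq); exact: PB.
by split; apply: ismin_ext => q; rewrite E.
Qed.

(** A shortened walk visits at most [N] distinct intermediate vertices, so the ration is void once
    [N < 2 ^ i]. With [N = 2 ^ L] this costs [L.+1] rounds. *)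
Lemma ismin_fewN i x y d :
  (forall b, P b -> b < N) -> N < 2 ^ i ->
  ismin (fewB i) x y d <-> ismin (all (predU P B)) x y d.
Proof.
move=> PN Ni; have short q : all (predU P B) q -> exists q', fewB i q' /\
    ole (wlen x (rcons q' y)) (wlen x (rcons q y)).
  move=> allq; have [q' [uq' sq' leq']] := wlen_shorten x q y.
  have allq' : all (predU P B) q'.
    by apply/allP => b /(mem_subseq sq')/(allP allq).
  exists q'; do !split=> //; apply: leq_ltn_trans (count_size _ _) _.
  apply: leq_ltn_trans Ni; rewrite -(size_iota 0 N).
  apply: uniq_leq_size => // b /(allP allq') /orP[/PN|/B_lt];
  by rewrite mem_iota.
split=> -[le ex]; split.
- by move=> q /short[q' [/le le' leq']]; apply: ole_trans leq'.
- by move=> l /ex[q [[allq _] Eq]]; exists q.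
- by move=> q [allq _]; apply: le.
move=> l E; have [q [allq Eq]] := ex l E; have [q' [fq' leq']] := short q allq.
have := le q' fq'.1; rewrite E; rewrite Eq in leq' => ge'.
by exists q'; split=> //; apply: ole_anti.
Qed.

Lemma ismin_few_le i x y l m :
  (forall b, P b -> b < N) -> (forall u v e, W u v = Some e -> e <= m) ->
  ismin (fewB i) x y (Some l) -> l <= N.+1 * m.
Proof.
move=> PN Wm [le ex]; have [q [[allq cq] Eq]] := ex l erefl.
have [q' [uq' sq' leq']] := wlen_shorten x q y.
have allq' : all (predU P B) q'.
  by apply/allP => b /(mem_subseq sq')/(allP allq).
have := le q'; case E: (wlen x (rcons q' y)) leq' => [l'|]; last by rewrite Eq.
move=> _ /(_ _) /= l_le.
have {}l_le : l <= l'.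
  by apply: l_le; split=> //; apply: leq_ltn_trans cq; apply: leq_count_subseq.
apply: leq_trans l_le _; apply: leq_trans (wlen_le Wm E) _.
rewrite size_rcons leq_mul2r ltnS orbC -{1}(size_iota 0 N) uniq_leq_size //.
by move=> b /(allP allq') /orP[/PN|/B_lt]; rewrite mem_iota.
Qed.

End Doubling.

End Walks.

(** * Distances avoiding a vertex *)

(** The interface through which critical vertices are studied without mentioning walks. It is stable
    under reversal of all edges, so facts about prefixes transfer to suffixes. In [ad_avtri] the
    vertex [y] becomes intermediate, hence [y != v]. *)
Record avoid_dist (N : nat) (d : nat -> nat -> option nat)
    (dv : nat -> nat -> nat -> option nat) : Prop := AvoidDist {
  ad_tri x y z : x < N -> y < N -> z < N -> ole (d x z) (oadd (d x y) (d y z));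
  ad_avtri x y z v : x < N -> y < N -> z < N -> v < N -> y != v ->
    ole (dv x z v) (oadd (dv x y v) (dv y z v));
  ad_le x y v : x < N -> y < N -> v < N -> ole (d x y) (dv x y v);
  ad_split x y v : x < N -> y < N -> v < N ->
    ole (dv x y v) (d x y) \/ ole (oadd (d x v) (d v y)) (d x y);
  ad_avsplit x y v b : x < N -> y < N -> v < N -> b < N -> b != v ->
    ole (dv x y b) (dv x y v) \/ ole (oadd (dv x b v) (dv b y v)) (dv x y v);
  ad_src x y : x < N -> y < N -> dv x y x = d x y;
  ad_dst x y : x < N -> y < N -> dv x y y = d x y;
  ad_self x v : x < N -> v < N -> dv x x v = Some 0
}.

Lemma avoid_dist_rev N d dv :
  avoid_dist N d dv -> avoid_dist N (fun x y => d y x) (fun x y v => dv y x v).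
Proof.
case=> h1 h2 h3 h4 h5 h6 h7 h8; split=> *; rewrite 1?oaddC; auto.
Qed.

Section Critical.

Variables (N : nat) (d : nat -> nat -> option nat)
  (dv : nat -> nat -> nat -> option nat).
Hypothesis D : avoid_dist N d dv.

Ltac oarith :=
  repeat match goal with
  | H : context [d ?a ?b] |- _ => destruct (d a b) in *
  | |- context [d ?a ?b] => destruct (d a b) in *
  | H : context [dv ?a ?b ?c] |- _ => destruct (dv a b c) in *
  | |- context [dv ?a ?b ?c] => destruct (dv a b c) in *
  end; unfold oadd, ole in *; simpl in *; try done; try congruence;
  repeat match goal with
  | H : Some _ = Some _ |- _ => injection H as ?; clear H
  end; try lia.

(* All shortest walks from [x] to [y] pass through [c]. *)
Definition crit (x y c : nat) : bool := ~~ ole (dv x y c) (d x y).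

(** Counting [y] but not [x] makes [rank] additive at critical vertices, like a position along a
    path. *)
Definition rank (x y : nat) : nat :=
  if x == y then 0 else (count (crit x y) (iota 0 N)).+1.

Lemma dist_self x : x < N -> d x x = Some 0.
Proof. by move=> xN; rewrite -(ad_src D) // (ad_self D). Qed.

Lemma crit_neq x y c : x < N -> y < N -> c < N -> crit x y c ->
  [/\ c != x, c != y & x != y].
Proof.
move=> xN yN cN; rewrite /crit => C; split; apply: contra C => /eqP E; subst.
- by rewrite (ad_src D) ?ole_refl.
- by rewrite (ad_dst D) ?ole_refl.
- by rewrite (ad_self D) // dist_self.
Qed.

Lemma crit_dist x y c : x < N -> y < N -> c < N -> crit x y c ->
  d x y = oadd (d x c) (d c y).
Proof.
move=> xN yN cN; rewrite /crit => C; apply: ole_anti; first exact: (ad_tri D).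
by case: (ad_split D xN yN cN) C => // ->.
Qed.

Lemma crit_fin x y c : crit x y c -> exists l, d x y = Some l.
Proof. by rewrite /crit; case: (d x y) => [l|]; [exists l | case: (dv x y c)]. Qed.

Lemma crit_part x y u c : x < N -> y < N -> u < N -> c < N ->
  d x y = oadd (d x u) (d u y) -> crit x y c -> c != u -> crit x u c \/ crit u y c.
Proof.
move=> xN yN uN cN E C cu; apply/orP; apply: contraLR C.
rewrite negb_or /crit !negbK => /andP[h1 h2].
apply: ole_trans (ad_avtri D xN uN yN cN _) _; first by rewrite eq_sym.
by rewrite E; apply: ole_add.
Qed.

(** A shortest walk from [x] to [u] without inner visits to [u] must pass [b]; cancelling the finite
    [d b u] leaves a shortest walk to [b] that avoids [u]. *)
Lemma crit_prefix_avoid x u b : x < N -> u < N -> b < N -> crit x u b ->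
  dv x b u = d x b.
Proof.
move=> xN uN bN C; have [bx bu xu] := crit_neq xN uN bN C.
have E := crit_dist xN uN bN C; have [l El] := crit_fin C.
apply: ole_anti; last exact: (ad_le D).
have [|] := ad_avsplit D xN uN uN bN bu; rewrite !(ad_dst D) // => h.
  by rewrite /crit h in C.
by clear C; oarith.
Qed.

(** A shortest walk from [x] to [y] missing [c] would still pass [u], and its part up to [u] would
    contradict that [c] is critical there. *)
Lemma crit_sub_prefix x y u c : x < N -> y < N -> u < N -> c < N ->
  crit x y u -> crit x u c -> crit x y c.
Proof.
move=> xN yN uN cN Cu Cc; have [cx cu xu] := crit_neq xN uN cN Cc.
have E := crit_dist xN yN uN Cu; have [l El] := crit_fin Cu.
rewrite /crit in Cu Cc *; apply/negP => h.
have := ad_le D uN yN cN.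
have uc : u != c by rewrite eq_sym.
have [|] := ad_avsplit D xN yN cN uN uc.
  by move=> h'; rewrite (ole_trans h' h) in Cu.
by move=> h1 h2; oarith.
Qed.

End Critical.

(** * The linear order of critical vertices and their ranks *)

Lemma rank_rev N d dv x y : rank N d dv x y =
  rank N (fun x y => d y x) (fun x y v => dv y x v) y x.
Proof. by rewrite /rank eq_sym. Qed.

Section CriticalOrder.

Variables (N : nat) (d : nat -> nat -> option nat)
  (dv : nat -> nat -> nat -> option nat).
Hypothesis D : avoid_dist N d dv.
Local Notation D' := (avoid_dist_rev D).
Local Notation crit := (crit d dv).
Local Notation rank := (rank N d dv).

Lemma crit_suffix_avoid u y b : u < N -> y < N -> b < N -> crit u y b ->
  dv b y u = d b y.
Proof. by move=> uN yN bN; apply: (crit_prefix_avoid D' yN uN bN). Qed.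

Lemma crit_sub_suffix x y u c : x < N -> y < N -> u < N -> c < N ->
  crit x y u -> crit u y c -> crit x y c.
Proof. by move=> xN yN uN cN; apply: (crit_sub_prefix D' yN xN uN cN). Qed.

(** If [c] occurred on both sides of [u], shortest walks to [c] and from [c] that avoid [u] would
    combine into a shortest walk from [x] to [y] avoiding [u]. *)
Lemma crit_disjoint x y u c : x < N -> y < N -> u < N -> c < N ->
  crit x y u -> crit x u c -> ~~ crit u y c.
Proof.
move=> xN yN uN cN Cu Cxu; apply/negP => Cuy.
have [_ cu _] := crit_neq D xN uN cN Cxu.
have Cc := crit_sub_prefix D xN yN uN cN Cu Cxu.
have := ad_avtri D xN cN yN uN cu.
rewrite (crit_prefix_avoid D xN uN cN Cxu) (crit_suffix_avoid uN yN cN Cuy).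
by rewrite -(crit_dist D) // => h; rewrite /crit h in Cu.
Qed.

Lemma rank_gt0 x y : x != y -> 0 < rank x y.
Proof. by rewrite /rank => /negPf->. Qed.

Lemma rank_self x : rank x x = 0.
Proof. by rewrite /rank eqxx. Qed.

Lemma count_additive (a b c e : pred nat) s :
  {in s, forall i, a i = b i + c i + e i :> nat} ->
  count a s = count b s + count c s + count e s.
Proof.
elim: s => //= i s IHs H; rewrite H ?mem_head // IHs; first by lia.
by move=> j js; apply: H; rewrite inE js orbT.
Qed.

Lemma count_iota1 u : u < N -> count (pred1 u) (iota 0 N) = 1.
Proof. by move=> uN; rewrite count_uniq_mem ?iota_uniq // mem_iota uN. Qed.

Lemma rank_add x y u : x < N -> y < N -> u < N -> crit x y u ->
  rank x y = rank x u + rank u y.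
Proof.
move=> xN yN uN C; have [ux uy xy] := crit_neq D xN yN uN C.
rewrite /rank (negPf xy) eq_sym (negPf ux) (negPf uy).
rewrite (count_additive (b := crit x u) (c := pred1 u) (e := crit u y)).
  by rewrite count_iota1 //; lia.
move=> c; rewrite mem_iota => /= cN.
case: (eqVneq c u) => [->|cu] /=.
  have -> : crit x u u = false by rewrite /crit (ad_dst D) ?ole_refl.
  have -> : crit u y u = false by rewrite /crit (ad_src D) ?ole_refl.
  by rewrite C.
have [Cxu|nCxu] := boolP (crit x u c).
  by rewrite (negPf (crit_disjoint xN yN uN cN C Cxu)) (crit_sub_prefix D _ _ uN).
have [Cuy|nCuy] := boolP (crit u y c); first by rewrite (crit_sub_suffix _ _ uN).
have [Cc|//] := boolP (crit x y c).
by case: (crit_part D xN yN uN cN (crit_dist D xN yN uN C) Cc cu) => h;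
  [rewrite h in nCxu | rewrite h in nCuy].
Qed.

(** Every critical vertex of [(x, y)] is critical for one of the two parts, and each part adds one
    for its endpoint. Strictness is what lets [onpath] recognise critical vertices by an equation
    between ranks. *)
Lemma rank_subadd x y u : x < N -> y < N -> u < N -> u != x -> u != y ->
  d x y = oadd (d x u) (d u y) -> ~~ crit x y u -> rank x y < rank x u + rank u y.
Proof.
move=> xN yN uN ux uy E nC; rewrite /rank [x == u]eq_sym (negPf ux) (negPf uy).
case: eqP => // _; rewrite addSn addnS !ltnS.
have : {in iota 0 N, forall c, (crit x y c : nat) <= crit x u c + crit u y c}.
  move=> c; rewrite mem_iota => /= cN.
  case: (eqVneq c u) => [->|cu]; first by rewrite (negPf nC).
  have [Cc|//] := boolP (crit x y c).
  by case: (crit_part D xN yN uN cN E Cc cu) => ->; rewrite ?addn1.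
elim: (iota 0 N) => //= i s IHs H.
apply: leq_trans (leq_add (H i (mem_head _ _)) (IHs _)) _; last by lia.
by move=> j js; apply: H; rewrite inE js orbT.
Qed.

(* A test that [u] is [x], [y] or critical for [(x, y)], in terms of tabulated values. *)
Definition onpath (x y u : nat) : bool :=
  [&& d x y != None, d x y == oadd (d x u) (d u y) &
      rank x y == rank x u + rank u y].

Lemma onpathP x y u : x < N -> y < N -> u < N ->
  reflect (d x y <> None /\ [\/ u = x, u = y | crit x y u]) (onpath x y u).
Proof.
move=> xN yN uN; apply: (iffP and3P).
  move=> [/eqP fin /eqP E /eqP Er]; split=> //.
  case: (eqVneq u x) => [->|ux]; first by constructor 1.
  case: (eqVneq u y) => [->|uy]; first by constructor 2.
  constructor 3; case: (boolP (crit x y u)) => // nC.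
  by have := rank_subadd xN yN uN ux uy E nC; rewrite Er ltnn.
move=> [/eqP fin [->|->|C]]; split=> //.
- by rewrite (dist_self D) // add0o.
- by rewrite rank_self add0n.
- by rewrite (dist_self D) // oadd0.
- by rewrite rank_self addn0.
- by rewrite -(crit_dist D).
- by rewrite -rank_add.
Qed.

Lemma crit_order x u b c : x < N -> u < N -> b < N -> c < N ->
  crit x u b -> crit x u c -> c != b -> crit x b c \/ crit b u c.
Proof.
move=> xN uN bN cN Cb Cc cb.
exact: (crit_part D xN uN bN cN (crit_dist D xN uN bN Cb) Cc cb).
Qed.

Lemma rank_inj x u b c : x < N -> u < N -> b < N -> c < N ->
  b = x \/ crit x u b -> c = x \/ crit x u c -> x != u ->
  rank b u = rank c u -> b = c.
Proof.
move=> xN uN bN cN.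
have lt e : e < N -> crit x u e -> rank e u < rank x u.
  move=> eN C; have [ex _ _] := crit_neq D xN uN eN C.
  have := rank_add xN uN eN C; have : 0 < rank x e by rewrite rank_gt0 1?eq_sym.
  by lia.
case=> [->|Cb] [->|Cc] xu // E; first by have := lt c cN Cc; lia.
  by have := lt b bN Cb; lia.
case: (eqVneq c b) => [->//|cb]; exfalso.
have := rank_add xN uN bN Cb; have := rank_add xN uN cN Cc.
have bc : b != c by rewrite eq_sym.
have [C|C] := crit_order xN uN bN cN Cb Cc cb.
  by have := rank_add xN bN cN C; have := rank_gt0 cb; lia.
by have := rank_add bN uN cN C; have := rank_gt0 bc; lia.
Qed.

(** By counting: [x] and the critical vertices are [rank x u] candidates with distinct ranks in an
    interval of just as many values. *)
Lemma rank_exists x u s : x < N -> u < N -> x != u -> 0 < s <= rank x u ->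
  exists c, [/\ c < N, c = x \/ crit x u c & rank c u = s].
Proof.
move=> xN uN xu /andP[s_gt0 s_le].
pose cs := x :: filter (crit x u) (iota 0 N).
have csP c : c \in cs -> c < N /\ (c = x \/ crit x u c).
  rewrite inE mem_filter mem_iota => /orP[/eqP->|/andP[C cN]]; by [|split; auto].
have ucs : uniq cs.
  rewrite /= filter_uniq ?iota_uniq // andbT mem_filter /crit (ad_src D) //.
  by rewrite ole_refl.
have um : uniq [seq rank c u | c <- cs].
  rewrite map_inj_in_uniq // => b c /csP[bN Hb] /csP[cN Hc].
  by move=> E; apply: (rank_inj xN uN bN cN Hb Hc xu E).
have sub : {subset [seq rank c u | c <- cs] <= iota 1 (rank x u)}.
  move=> r /mapP[c /csP[cN Hc] ->]; rewrite mem_iota.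
  case: Hc => [->|C]; first by have := rank_gt0 xu; lia.
  have [cx cu _] := crit_neq D xN uN cN C.
  by have := rank_add xN uN cN C; have := rank_gt0 cu; lia.
have sz : size (iota 1 (rank x u)) <= size [seq rank c u | c <- cs].
  by rewrite size_map size_iota /= size_filter /rank (negPf xu).
have [_ /(_ s)] := uniq_min_size um sub sz.
rewrite mem_iota s_gt0 add1n ltnS s_le => /mapP[c /csP[cN Hc] ->].
by exists c.
Qed.

End CriticalOrder.

(** * Landmarks and walks around a critical vertex *)

Section Detour.

Variables (N : nat) (d : nat -> nat -> option nat)
  (dv : nat -> nat -> nat -> option nat).
Hypothesis D : avoid_dist N d dv.
Local Notation crit := (crit d dv).
Local Notation rank := (rank N d dv).

(** A query restarts from the landmark: that [u] stays critical for [(x', y)] is the reason why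
    [dv x' y u] is tabulated. *)
Lemma landmark_crit x y u x' : x < N -> y < N -> u < N -> x' < N ->
  crit x y u -> x' = x \/ crit x u x' ->
  [/\ crit x' y u, d x x' = dv x x' u & rank x u = rank x x' + rank x' u].
Proof.
move=> xN yN uN x'N C [->|C'].
  by rewrite rank_self (dist_self D) // (ad_self D).
have [x'x x'u _] := crit_neq D xN uN x'N C'.
have E := crit_prefix_avoid D xN uN x'N C'.
split=> //; last exact: (rank_add D).
have Cx' := crit_sub_prefix D xN yN uN x'N C C'.
have ux' : u != x' by rewrite eq_sym.
have [|//] := crit_part D xN yN x'N uN (crit_dist D xN yN x'N Cx') C ux'.
by rewrite /crit E ole_refl.
Qed.

(* A walk avoiding [u] that visits [b], where the landmark [x'] precedes [b] and
   [b] precedes [u], can be rerouted through [x']. *)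
Lemma detour_prefix x y u b x' : x < N -> y < N -> u < N -> b < N -> x' < N ->
  crit x y u -> crit x u b -> x' = x \/ crit x u x' -> rank x x' < rank x b ->
  ole (oadd (d x x') (dv x' y u)) (oadd (dv x b u) (dv b y u)).
Proof.
move=> xN yN uN bN x'N C Cb Hx' lt_r.
have [_ bu _] := crit_neq D xN uN bN Cb.
suff [E1 E2] : d x b = oadd (d x x') (d x' b) /\ dv x' b u = d x' b.
  rewrite (crit_prefix_avoid D xN uN bN Cb) E1 -E2 -oaddA.
  by apply: ole_add (ole_refl _) _; apply: (ad_avtri D).
case: Hx' lt_r => [->|Cx'] lt_r.
  by rewrite (dist_self D) // add0o (crit_prefix_avoid D xN uN bN Cb).
have bx' : b != x' by apply: contraTneq lt_r => ->; rewrite ltnn.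
have Cx'b : crit x' u b.
  have [C'|//] := crit_order D xN uN x'N bN Cx' Cb bx'.
  by have := rank_add D xN x'N bN C'; lia.
split; last exact: (crit_prefix_avoid D).
have x'b : x' != b by rewrite eq_sym.
have [C'|C'] := crit_order D xN uN bN x'N Cb Cx' x'b.
  exact: (crit_dist D).
have := rank_add D bN uN x'N C'; have := rank_add D xN uN x'N Cx'.
by have := rank_add D xN uN bN Cb; lia.
Qed.

End Detour.

Definition flog (r : nat) : nat := trunc_log 2 r.

Lemma flogP r : 0 < r -> 2 ^ flog r <= r < 2 ^ (flog r).+1.
Proof. by move=> r_gt0; apply: trunc_log_bounds. Qed.

Section Formula.

Variables (N : nat) (d : nat -> nat -> option nat)
  (dv : nat -> nat -> nat -> option nat).
Hypothesis D : avoid_dist N d dv.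
Local Notation crit := (crit d dv).
Local Notation rank := (rank N d dv).

Definition same_class (x y : nat) (i j : nat) (b : nat) : bool :=
  [&& crit x y b, flog (rank x b) == i & flog (rank b y) == j].

(* A shortest walk avoiding [u] visits the landmark [x'], or the landmark [y'], or
   no critical vertex in the class of [u]. *)
Lemma avoid_formula x y u x' y' m :
  let i := flog (rank x u) in let j := flog (rank u y) in
  x < N -> y < N -> u < N -> x' < N -> y' < N -> crit x y u ->
  x' = x \/ crit x u x' -> rank x' u = 2 ^ i ->
  y' = y \/ crit u y y' -> rank u y' = 2 ^ j ->
  (forall b, b < N -> same_class x y i j b -> ole (dv x y b) m) ->
  (exists b, [/\ b < N, same_class x y i j b & m = dv x y b]) ->
  dv x y u = omin (oadd (d x x') (dv x' y u)) (omin (oadd (dv x y' u) (d y' y)) m).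
Proof.
move=> i j xN yN uN x'N y'N C Hx' rx' Hy' ry' m_ub [b [bN /and3P[Cb ib jb] def_m]].
have D' := avoid_dist_rev D.
have [ux uy xy] := crit_neq D xN yN uN C.
have [_ Ex' Rx'] := landmark_crit D xN yN uN x'N C Hx'.
have [_ Ey' Ry'] := landmark_crit D' yN xN uN y'N C Hy'.
have {}Ry' : rank u y = rank u y' + rank y' y.
  by rewrite (rank_rev N d dv u y) (rank_rev N d dv u y') (rank_rev N d dv y' y) addnC.
have pos_xu : 0 < rank x u by rewrite rank_gt0 1?eq_sym.
have pos_uy : 0 < rank u y by rewrite rank_gt0.
have x'u : x' != u.
  apply/eqP => E; move/eqP: rx'; rewrite E rank_self eq_sym.
  by rewrite -leqn0 leqNgt expn_gt0.
have y'u : y' != u.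
  apply/eqP => E; move/eqP: ry'; rewrite E rank_self eq_sym.
  by rewrite -leqn0 leqNgt expn_gt0.
have le1 : ole (dv x y u) (oadd (d x x') (dv x' y u)).
  by rewrite Ex'; apply: (ad_avtri D).
have le2 : ole (dv x y u) (oadd (dv x y' u) (d y' y)).
  by rewrite Ey'; apply: (ad_avtri D).
have le3 : ole (dv x y u) m by apply: m_ub => //; rewrite /same_class C !eqxx.
suff ge : ole (omin (oadd (d x x') (dv x' y u))
                 (omin (oadd (dv x y' u) (d y' y)) m)) (dv x y u).
  apply: ole_anti ge; rewrite {1}/omin; case: ifP => // _.
  by rewrite {1}/omin; case: ifP.
case: (eqVneq b u) => [bu|bu].
  apply: ole_trans (omin_ler _ _) _; apply: ole_trans (omin_ler _ _) _.
  by rewrite def_m bu ole_refl.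
(* [b] attains the maximum [m]. A shortest walk avoiding [u] either avoids [b] as well, and then its
   length is at least [m], or visits [b]. *)
have [h|h] := ad_avsplit D xN yN uN bN bu.
  apply: ole_trans (omin_ler _ _) _; apply: ole_trans (omin_ler _ _) _.
  by rewrite def_m.
apply: ole_trans h.
have [bx b_y _] := crit_neq D xN yN bN Cb.
have /andP[xb_ge xb_lt] : 2 ^ i <= rank x b < 2 ^ i.+1.
  by rewrite -(eqP ib) flogP // rank_gt0 1?eq_sym.
have /andP[by_ge by_lt] : 2 ^ j <= rank b y < 2 ^ j.+1.
  by rewrite -(eqP jb) flogP // rank_gt0.
have /andP[xu_ge xu_lt] := flogP pos_xu; have /andP[uy_ge uy_lt] := flogP pos_uy.
rewrite -/i in xu_ge xu_lt; rewrite -/j in uy_ge uy_lt; rewrite !expnS in xu_lt uy_lt.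
(* If [b] precedes [u], then [rank x x' = rank x u - 2 ^ i < 2 ^ i <= rank x b], so the landmark
   comes before [b]. The other case is the same in the reversed graph. *)
have [Cxb|Cby] := crit_part D xN yN uN bN (crit_dist D xN yN uN C) Cb bu.
  apply: ole_trans (omin_lel _ _) _.
  by apply: (detour_prefix D) => //; lia.
apply: ole_trans (omin_ler _ _) _; apply: ole_trans (omin_lel _ _) _.
rewrite oaddC [X in ole _ X]oaddC.
have lt_r : rank y' y < rank b y by lia.
by apply: (detour_prefix D') => //; rewrite -(rank_rev N d dv y' y) -(rank_rev N d dv b y).
Qed.

End Formula.

(** * Distances in a graph *)

Section Graph.

Variables (N : nat) (W : nat -> nat -> option nat).
Hypothesis W_self : forall x, W x x = Some 0.

Definition allow (P : pred nat) (q : seq nat) : Prop := all P q.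

Definition avoid (v : nat) : pred nat := fun b => (b < N) && (b != v).

Variable dv : nat -> nat -> nat -> option nat.
Hypothesis dvP : forall x y v, x < N -> y < N -> v < N ->
  ismin W (allow (avoid v)) x y (dv x y v).

Definition within : pred nat := fun b => b < N.

Lemma avoid_src q x y : allow within q -> exists q', allow (avoid x) q' /\
  ole (wlen W x (rcons q' y)) (wlen W x (rcons q y)).
Proof.
have [n] := ubnP (size q); elim: n q => // n IHn q; rewrite ltnS => qn allq.
have [/splitPr xq|xq] := boolP (x \in q).
  case: xq qn allq => q1 q2; rewrite /allow all_cat size_cat => qn /and3P[_ _ all2].
  have [|q' [allq' leq']] := IHn q2 _ all2; first by move: qn => /=; lia.
  exists q'; split=> //; apply: ole_trans leq' _.
  by rewrite wlen_split ole_addl.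
exists q; split; last exact: ole_refl.
apply/allP => b bq; rewrite /avoid; apply/andP; split; first exact: (allP allq).
by apply: contraNneq xq => <-.
Qed.

Lemma avoid_dst q x y : allow within q -> exists q', allow (avoid y) q' /\
  ole (wlen W x (rcons q' y)) (wlen W x (rcons q y)).
Proof.
have [n] := ubnP (size q); elim: n q => // n IHn q; rewrite ltnS => qn allq.
have [/splitPr yq|yq] := boolP (y \in q).
  case: yq qn allq => q1 q2; rewrite /allow all_cat size_cat => qn /andP[all1 _].
  have [|q' [allq' leq']] := IHn q1 _ all1; first by move: qn => /=; lia.
  exists q'; split=> //; apply: ole_trans leq' _.
  by rewrite wlen_split ole_addr.
exists q; split; last exact: ole_refl.
apply/allP => b bq; rewrite /avoid; apply/andP; split; first exact: (allP allq).
by apply: contraNneq yq => <-.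
Qed.

Lemma sub_avoid v q : allow (avoid v) q -> allow within q.
Proof. by apply: sub_all => b /andP[]. Qed.

Lemma ismin_src x y d : ismin W (allow (avoid x)) x y d ->
  ismin W (allow within) x y d.
Proof.
move=> [le ex]; split=> [q /(avoid_src x y)[q' [aq' leq']]|l /ex[q [aq E]]].
  by apply: ole_trans leq'; apply: le.
by exists q; split=> //; apply: sub_avoid aq.
Qed.

Lemma ismin_dst x y d : ismin W (allow (avoid y)) x y d ->
  ismin W (allow within) x y d.
Proof.
move=> [le ex]; split=> [q /(avoid_dst x y)[q' [aq' leq']]|l /ex[q [aq E]]].
  by apply: ole_trans leq'; apply: le.
by exists q; split=> //; apply: sub_avoid aq.
Qed.

(** Returning to the source never shortens a walk, so the table excluding [x] already contains the
    distances from [x]. *)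
Definition dist (x y : nat) : option nat := dv x y x.

Lemma distP x y : x < N -> y < N -> ismin W (allow within) x y (dist x y).
Proof. by move=> xN yN; apply: ismin_src; apply: dvP. Qed.

Lemma ismin_concat (S1 S2 S : seq nat -> Prop) x y z d1 d2 dd :
  ismin W S1 x y d1 -> ismin W S2 y z d2 -> ismin W S x z dd ->
  (forall q1 q2, S1 q1 -> S2 q2 -> S (q1 ++ y :: q2)) -> ole dd (oadd d1 d2).
Proof.
move=> [_ ex1] [_ ex2] [le _] SS; case E1: d1 => [l1|] //; case E2: d2 => [l2|] //.
have [q1 [S1q Eq1]] := ex1 _ E1; have [q2 [S2q Eq2]] := ex2 _ E2.
by rewrite -Eq1 -Eq2 -wlen_split; apply: le; apply: SS.
Qed.

Lemma avoid_distP : avoid_dist N dist dv.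
Proof.
split.
- move=> x y z xN yN zN; apply: ismin_concat (distP xN yN) (distP yN zN) (distP xN zN) _.
  by move=> q1 q2 a1 a2; rewrite /allow all_cat; apply/and3P.
- move=> x y z v xN yN zN vN yv.
  apply: ismin_concat (dvP xN yN vN) (dvP yN zN vN) (dvP xN zN vN) _.
  move=> q1 q2 a1 a2; rewrite /allow all_cat; apply/and3P; split=> //.
  by rewrite /avoid yN.
- move=> x y v xN yN vN; apply: ismin_le (distP xN yN) (dvP xN yN vN) _.
  by move=> q aq; exists q; split; [apply: sub_avoid aq | apply: ole_refl].
- move=> x y v xN yN vN; case E: (dist x y) => [l|]; last by left.
  have [q [aq Eq]] := (distP xN yN).2 l E; rewrite -Eq.
  have [/splitPr vq|vq] := boolP (v \in q).
    case: vq aq => q1 q2; rewrite /allow all_cat => /and3P[a1 _ a2].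
    by right; rewrite wlen_split; apply: ole_add; apply: (distP _ _).1.
  left; apply: (dvP xN yN vN).1; apply/allP => b bq.
  by apply/andP; split; [apply: (allP aq) | apply: contraNneq vq => <-].
- move=> x y v b xN yN vN bN bv; case E: (dv x y v) => [l|]; last by left.
  have [q [aq Eq]] := (dvP xN yN vN).2 l E; rewrite -Eq.
  have [/splitPr bq|bq] := boolP (b \in q).
    case: bq aq => q1 q2; rewrite /allow all_cat => /and3P[a1 _ a2].
    by right; rewrite wlen_split; apply: ole_add; apply: (dvP _ _ _).1.
  left; apply: (dvP xN yN bN).1; apply/allP => c cq.
  have /andP[cN _] := allP aq c cq; rewrite /avoid cN.
  by apply: contraNneq bq => <-.
- by [].
- move=> x y xN yN; apply: ismin_unique (ismin_dst (dvP xN yN yN)) (distP xN yN).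
- move=> x v xN vN; apply: ole_anti; last by case: (dv x x v).
  by have := (dvP xN xN vN).1 [::] isT; rewrite /= W_self.
Qed.

(** * Removing an edge *)

Definition cut (u v : nat) : nat -> nat -> option nat :=
  fun a b => if (a == u) && (b == v) then None else W a b.

Lemma cut_le u v x q : ole (wlen W x q) (wlen (cut u v) x q).
Proof.
elim: q x => [|y q IHq] x //=; apply: ole_add (IHq y).
by rewrite /cut; case: ifP => // _; apply: ole_refl.
Qed.

Lemma cut_walk_rcons u v x q y : x != u -> u \notin q ->
  wlen (cut u v) x (rcons q y) = wlen W x (rcons q y).
Proof.
elim: q x => [|z q IHq] x /= xu; first by rewrite /cut (negPf xu).
rewrite inE negb_or => /andP[uz uq].
by rewrite IHq 1?eq_sym // /cut (negPf xu).
Qed.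

(* [du] is the distance from [u <> y] to [y] without the edge [(u, v)]: a shortest
   walk does not return to [u] after its first edge. *)
Definition first_cut (u v y : nat) (du : option nat) : Prop :=
  (forall b, b < N -> b != u -> b != v -> ole du (oadd (W u b) (dv b y u))) /\
  (forall l, du = Some l -> exists b,
     [/\ b < N, b != u, b != v & oadd (W u b) (dv b y u) = Some l]).

(** For [u == y] a walk can stop at its first visit to [u] and needs no edge leaving it. For
    [u == x] every walk starts at [u], so [du] is the answer itself. *)
Definition cut_dist (x y u : nat) (du : option nat) : option nat :=
  if u == y then dist x y else if u == x then du
  else omin (dv x y u) (oadd (dist x u) du).

(** [u != v] preserves the loop of weight 0 at [u]; a removed loop of the input graph is treated by
    [cut_dist_loop]. *)
Lemma cut_distP x y u v du : x < N -> y < N -> u < N -> u != v ->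
  (u != y -> first_cut u v y du) -> ismin (cut u v) (allow within) x y (cut_dist x y u du).
Proof.
move=> xN yN uN uv Hdu.
have D := avoid_distP.
have to_u z : z < N -> forall l, dist z u = Some l ->
    (z = u /\ l = 0) \/ exists q, allow within q /\ wlen (cut u v) z (rcons q u) = Some l.
  move=> zN l; case: (eqVneq z u) => [->|zu].
    by rewrite (dist_self D) // => -[<-]; left.
  rewrite -(ad_dst D) // => /((dvP zN uN uN).2 l)[q [aq Eq]]; right; exists q.
  split; first exact: sub_avoid aq.
  rewrite cut_walk_rcons // ?Eq //; apply/negP => /(allP aq).
  by rewrite /avoid eqxx andbF.
have from_u l : u != y -> du = Some l ->
    exists q, allow within q /\ wlen (cut u v) u (rcons q y) = Some l.
  move=> uy /(proj2 (Hdu uy))[b [bN bu bv]].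
  case E1: (W u b) => [l1|] //; case E2: (dv b y u) => [l2|] //= [<-].
  have [q [aq Eq]] := (dvP bN yN uN).2 l2 E2.
  exists (b :: q); split; first by apply/andP; split=> //; apply: sub_avoid aq.
  rewrite /= cut_walk_rcons // ?Eq; first by rewrite /cut eqxx (negPf bv) /= E1.
  by apply/negP => /(allP aq); rewrite /avoid eqxx andbF.
(* A walk returning to [u] is replaced by its part after the return. Otherwise its first edge
   differs from [(u, v)] and the rest avoids [u]. *)
have du_lower q : u != y -> allow within q -> ole du (wlen (cut u v) u (rcons q y)).
  move=> uy; have [du_le _] := Hdu uy.
  have [n] := ubnP (size q); elim: n q => // n IHn q; rewrite ltnS => qn aq.
  have [/splitPr uq|uq] := boolP (u \in q).
    case: uq qn aq => q1 q2; rewrite /allow all_cat size_cat => qn /and3P[_ _ a2].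
    rewrite wlen_split; apply: ole_trans (ole_addl _ _); apply: IHn => //.
    by move: qn => /=; lia.
  case: q qn aq uq => [|b q] _ /= aq uq.
    rewrite oadd0 /cut eqxx; case: eqVneq => //= yv.
    have := du_le y yN _ yv; rewrite eq_sym => /(_ uy).
    by rewrite (ad_self D) // oadd0.
  move: aq uq; rewrite inE negb_or => /andP[bN aq] /andP[ub uq].
  rewrite {1}/cut eqxx; case: eqVneq => //= bv.
  have := du_le b bN _ bv; rewrite eq_sym => /(_ ub) h; apply: ole_trans h _.
  apply: ole_add (ole_refl _) _; rewrite cut_walk_rcons 1?eq_sym //.
  apply: (dvP bN yN uN).1; apply/allP => c cq.
  by apply/andP; split; [apply: (allP aq) | apply: contraNneq uq => <-].
rewrite /cut_dist; case: (eqVneq u y) => [def_y|uy].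
  split=> [q aq|l]; last rewrite -def_y.
    by apply: ole_trans (cut_le u v x _); apply: (distP xN yN).1.
  case/(to_u x xN l) => [[-> ->]|[q [aq Eq]]]; last by exists q.
  by exists [::]; rewrite /= /cut eqxx W_self (negPf uv).
case: (eqVneq u x) => [<-|ux].
  by split=> [q|l]; [apply: du_lower | apply: from_u].
split=> [q aq|l].
  have [/splitPr uq|uq] := boolP (u \in q).
    case: uq aq => q1 q2; rewrite /allow all_cat => /and3P[a1 _ a2].
    apply: ole_trans (omin_ler _ _) _; rewrite wlen_split.
    apply: ole_add; last exact: du_lower.
    by apply: ole_trans (cut_le u v x _); apply: (distP xN uN).1.
  apply: ole_trans (omin_lel _ _) _; rewrite cut_walk_rcons 1?eq_sym //.
  apply: (dvP xN yN uN).1; apply/allP => c cq.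
  by apply/andP; split; [apply: (allP aq) | apply: contraNneq uq => <-].
rewrite /omin; case: ifP => _ E.
  have [q [aq Eq]] := (dvP xN yN uN).2 l E; exists q.
  split; first exact: sub_avoid aq.
  rewrite cut_walk_rcons // 1?eq_sym //; apply/negP => /(allP aq).
  by rewrite /avoid eqxx andbF.
move: E; case E1: (dist x u) => [l1|] //; case E2: du => [l2|] //= [<-].
have [q2 [a2 Eq2]] := from_u l2 uy E2.
have [[xu _]|[q1 [a1 Eq1]]] := to_u x xN l1 E1; first by rewrite xu eqxx in ux.
exists (q1 ++ u :: q2); rewrite wlen_split Eq1 Eq2; split=> //.
by rewrite /allow all_cat; apply/and3P.
Qed.

End Graph.

(** * Expressions on encoded distances *)

Definition eand (a b : expr) : expr := Bin OpMul a b.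
(** Selection without branching, for [c] equal to 0 or 1; both alternatives are evaluated. *)
Definition eif (c a b : expr) : expr :=
  Bin OpAdd (Bin OpMul c a) (Bin OpMul (Bin OpEq c (Cst 0)) b).
Definition epos (a : expr) : expr := Bin OpLt (Cst 0) a.
(** Both codes are shifted by one, so one unit is subtracted; the two tests turn the result into 0,
    the code of infinity, if an argument is infinite. *)
Definition eoadd (a b : expr) : expr :=
  eand (eand (epos a) (epos b)) (Bin OpSub (Bin OpAdd a b) (Cst 1)).
Definition eole (a b : expr) : expr :=
  Bin OpLt (Cst 0) (Bin OpAdd (Bin OpEq b (Cst 0))
    (eand (epos a) (Bin OpLt a (Bin OpAdd b (Cst 1))))).
Definition eomin (a b : expr) : expr := eif (eole a b) a b.
Definition eomax (a b : expr) : expr := eif (eole a b) b a.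
Definition enot (a : expr) : expr := Bin OpEq a (Cst 0).

Definition decode (v : nat) : option nat := if v is l.+1 then Some l else None.

Lemma encodeK : cancel encode decode.
Proof. by case. Qed.

Lemma decodeK : cancel decode encode.
Proof. by case. Qed.

Section EvalMacros.

Variables (rho : registers) (M : memory).
Local Notation ev e := (eval e rho M).

Lemma eval_eif c (b : bool) e1 e2 : ev c = b ->
  ev (eif c e1 e2) = if b then ev e1 else ev e2.
Proof. by rewrite /eif /= => ->; case: b; rewrite ?mul1n ?mul0n ?addn0 ?add0n. Qed.

Lemma eval_eoadd a b u v : ev a = encode u -> ev b = encode v ->
  ev (eoadd a b) = encode (oadd u v).
Proof. by move=> /= -> ->; case: u v => [x|] [y|] //=; lia. Qed.

Lemma eval_eole a b u v : ev a = encode u -> ev b = encode v ->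
  ev (eole a b) = ole u v.
Proof.
move=> /= -> ->; case: u v => [x|] [y|] //=; rewrite addn1 mul1n add0n ltnS ltnS.
by case: (x <= y).
Qed.

Lemma eval_eomin a b u v : ev a = encode u -> ev b = encode v ->
  ev (eomin a b) = encode (omin u v).
Proof.
by move=> ea eb; rewrite (eval_eif _ _ (eval_eole ea eb)) ea eb /omin; case: ifP.
Qed.

Lemma eval_eomax a b u v : ev a = encode u -> ev b = encode v ->
  ev (eomax a b) = encode (omax u v).
Proof.
by move=> ea eb; rewrite (eval_eif _ _ (eval_eole ea eb)) ea eb /omax; case: ifP.
Qed.

End EvalMacros.

(** * Tables *)

(* Control registers: [n]; the power of two [N >= n]; [L + 1] where [N = 2 ^ L];
   [N ^ 2]; the numbers of the first table of [D] and of the workspace [T]; loop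
   variables; and, from [rs] on, scratch registers of [reduce] and [slot_map]. *)
Notation rn := 1 (only parsing).
Notation rN := 2 (only parsing).
Notation rLL := 3 (only parsing).
Notation rNN := 4 (only parsing).
Notation rQ := 5 (only parsing).
Notation rT := 6 (only parsing).
Notation rk := 7 (only parsing).
Notation rit := 8 (only parsing).
Notation ri := 9 (only parsing).
Notation rpw := 10 (only parsing).
Notation rt := 11 (only parsing).
Notation rs := 12 (only parsing).
Notation rc := 13 (only parsing).
Notation rbase := 14 (only parsing).
Notation rcnt := 15 (only parsing).

(* Memory from address [2 * N ^ 2] on is divided into tables of [N ^ 2] cells. *)
Definition slot (N : nat) (M : memory) (j x y : nat) : nat :=
  M (j.+2 * (N * N) + x * N + y).

Definition eslot (j x y : expr) : expr :=
  Get (Bin OpAdd (Bin OpAdd (Bin OpMul (Bin OpAdd j (Cst 2)) (Var rNN))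
                            (Bin OpMul x (Var rN))) y).

Definition eX : expr := Bin OpMod (Bin OpDiv (Var 0) (Var rN)) (Var rN).
Definition eY : expr := Bin OpMod (Var 0) (Var rN).
Definition eP : expr := Bin OpDiv (Var 0) (Var rNN).

(* For all [p < c] and [x, y < N]: table [j + p] at [(x, y)] := e. *)
Definition slot_map (j c e : expr) : pram_prog :=
  set_reg rbase (Bin OpMul (Bin OpAdd j (Cst 2)) (Var rNN)) ++
  (set_reg rcnt (Bin OpMul c (Var rNN)) ++ par_map rbase rcnt e).

(* An arbitrary bound that exceeds the code length of every straight-line block. *)
Definition tm : nat := 2000.

Definition slot_map_ok (j c e : expr) : bool :=
  [&& fits (Bin OpMul (Bin OpAdd j (Cst 2)) (Var rNN)),
      fits (Bin OpMul c (Var rNN)), fits e &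
      size (assign rbase (Bin OpMul (Bin OpAdd j (Cst 2)) (Var rNN))) +
      (size (assign rcnt (Bin OpMul c (Var rNN))) + (size (map_code rbase e)).+2)
        <= tm].

Arguments tm : simpl never.

Definition keep (m : nat) (rho rho' : registers) : Prop :=
  forall r, r < m -> rho' r = rho r.

Lemma keep_trans m rho1 rho2 rho3 :
  keep m rho1 rho2 -> keep m rho2 rho3 -> keep m rho1 rho3.
Proof. by move=> h1 h2 r rm; rewrite h2 ?h1. Qed.

Lemma keep_sub m m' rho rho' : m' <= m -> keep m rho rho' -> keep m' rho rho'.
Proof. by move=> mm' h r rm; apply: h; apply: leq_trans mm'. Qed.

Lemma keep_upd m rho r v : m <= r -> keep m rho (upd rho r v).
Proof. by move=> mr r' r'm; rewrite upd_other //; lia. Qed.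

Lemma cell_lt N x y : x < N -> y < N -> x * N + y < N * N.
Proof. by move=> xN yN; nia. Qed.

Section Local.

Variable N : nat.
Hypothesis N_gt0 : 0 < N.

Local Notation slot := (slot N).

(* Processor [i = p * N ^ 2 + x * N + y], whose registers are those of the
   control processor, in charge of cell [(x, y)] of table [p]. *)
Definition local (rho rho' : registers) (p x y : nat) : Prop :=
  rho' 0 = p * (N * N) + x * N + y /\ forall r, 0 < r < rbase -> rho' r = rho r.

Lemma eval_eX rho rho' M p x y : rho rN = N -> x < N -> y < N ->
  local rho rho' p x y -> eval eX rho' M = x.
Proof.
move=> EN xN yN [E0 E] /=; rewrite E0 E // EN.
by rewrite mulnA -mulnDl divnMDl // (divn_small yN) addn0 modnMDl modn_small.
Qed.

Lemma eval_eY rho rho' M p x y : rho rN = N -> x < N -> y < N ->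
  local rho rho' p x y -> eval eY rho' M = y.
Proof.
move=> EN xN yN [E0 E] /=; rewrite E0 E // EN.
by rewrite mulnA -mulnDl modnMDl modn_small.
Qed.

Lemma eval_eP rho rho' M p x y : rho rNN = N * N -> x < N -> y < N ->
  local rho rho' p x y -> eval eP rho' M = p.
Proof.
move=> EN xN yN [E0 E] /=; rewrite E0 E // EN -addnA divnMDl ?muln_gt0 ?N_gt0 //.
by rewrite divn_small ?addn0 //; nia.
Qed.

Lemma eval_eslot rho M j x y : rho rN = N -> rho rNN = N * N ->
  eval (eslot j x y) rho M = slot M (eval j rho M) (eval x rho M) (eval y rho M).
Proof. by move=> EN ENN /=; rewrite EN ENN addn2. Qed.

Lemma slot_overwrite M J C f j x y : x < N -> y < N ->
  slot (overwrite M (J.+2 * (N * N)) (C * (N * N)) f) j x y =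
    if J <= j < J + C then f ((j - J) * (N * N) + x * N + y) else slot M j x y.
Proof.
move=> xN yN; rewrite /slot /overwrite.
have := cell_lt xN yN.
rewrite -(addnA (j.+2 * _)) -(addnA ((j - J) * _)).
move: (x * N + y) (N * N) => z K zK.
have -> : (J.+2 * K <= j.+2 * K + z) = (J <= j).
  apply/idP/idP => h; last by have := leq_mul h (leqnn K); lia.
  by case: (leqP J j) => // jJ; have := leq_mul jJ (leqnn K); lia.
have -> : (j.+2 * K + z < J.+2 * K + C * K) = (j < J + C).
  apply/idP/idP => h; first last.
    by have := leq_mul h (leqnn K); rewrite mulnDl; lia.
  case: (ltnP j (J + C)) => // jJ.
  by have := leq_mul jJ (leqnn K); rewrite mulnDl; lia.
case: ifP => // /andP[Jj _]; congr f.
by rewrite mulnBl; have := leq_mul Jj (leqnn K); lia.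
Qed.

End Local.

Section Tables.

Variables (w X N : nat).
Hypotheses (X_gt1 : 1 < X) (fitX : X ^ maxdeg < 2 ^ w) (N_gt0 : 0 < N).
Hypothesis N3X : N * (N * N) <= X.

Local Notation B := (N * (N * N)).
Local Notation wp := (wp w X B).
Local Notation slot := (slot N).
Local Notation local := (local N).

(** [C <= N] keeps the number of processors within [N * (N * N)], the bound on the work of a
    step. *)
Lemma wp_slot_map j c e J C f (Q : registers -> memory -> Prop) rho M :
  bounded X rho M -> slot_map_ok j c e -> rho rNN = N * N ->
  (forall rho', keep rbase rho rho' -> eval j rho' M = J) ->
  (forall rho', keep rbase rho rho' -> eval c rho' M = C) ->
  0 < C <= N -> J.+2 * (N * N) <= X ->
  (forall rho' p x y, p < C -> x < N -> y < N -> local rho rho' p x y ->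
     eval e rho' M = f p x y /\ f p x y <= X) ->
  (forall rho' M', bounded X rho' M' -> keep rbase rho rho' ->
     (forall j x y, x < N -> y < N -> slot M' j x y =
        if J <= j < J + C then f (j - J) x y else slot M j x y) ->
     Q rho' M') ->
  wp (slot_map j c e) tm Q rho M.
Proof.
move=> bd /and4P[fj fc fe szle] ENN EJ EC /andP[C_gt0 CN] JX Ef HQ.
apply: wp_weaken szle _; last by move=> rho' M' _; apply.
have NN_gt0 : 0 < N * N by nia.
have bupd r v rho1 : bounded X rho1 M -> v <= X -> bounded X (upd rho1 r v) M.
  by move=> [bR bM] vX; split=> // r' r'K; rewrite /upd; case: ifP => // _; apply: bR.
have Ebase : eval (Bin OpMul (Bin OpAdd j (Cst 2)) (Var rNN)) rho M = J.+2 * (N * N).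
  by rewrite /= EJ // ENN addn2.
apply: wp_cat; apply: (wp_set _ X_gt1 fitX) => //; rewrite Ebase //.
set rho1 := upd _ _ _; have bd1 : bounded X rho1 M by apply: bupd.
have k1 : keep rbase rho rho1 by apply: keep_upd.
have Ecnt : eval (Bin OpMul c (Var rNN)) rho1 M = C * (N * N).
  by rewrite /= EC // (k1 rNN) // ENN.
have cntX : C * (N * N) <= B by rewrite leq_mul2r CN orbT.
apply: wp_cat; apply: (wp_set _ X_gt1 fitX); rewrite ?Ecnt //; first exact: leq_trans N3X.
set rho2 := upd _ _ _; have bd2 : bounded X rho2 M.
  by apply: bupd => //; apply: leq_trans N3X.
pose g i := f (i %/ (N * N)) (i %/ N %% N) (i %% N).
have gE p x y : x < N -> y < N -> g (p * (N * N) + x * N + y) = f p x y.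
  move=> xN yN; rewrite /g; congr f.
  - by rewrite -addnA divnMDl // divn_small ?addn0 //; nia.
  - by rewrite mulnA -mulnDl divnMDl // (divn_small yN) addn0 modnMDl modn_small.
  - by rewrite mulnA -mulnDl modnMDl modn_small.
have E15 : rho2 rcnt = C * (N * N) by rewrite /rho2 upd_same.
have E14 : rho2 rbase = J.+2 * (N * N) by rewrite /rho2 upd_other // /rho1 upd_same.
apply: (wp_map X_gt1 fitX (f := g)) => //.
- by rewrite E15 cntX andbT muln_gt0 C_gt0 NN_gt0.
- rewrite E15 => i i_lt; have iC : i %/ (N * N) < C by rewrite ltn_divLR.
  apply: Ef => //; rewrite ?ltn_mod //; split.
    rewrite upd_same {1}(divn_eq i (N * N)) -addnA; congr addn.
    rewrite {1}(divn_eq (i %% (N * N)) N); congr addn; last first.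
      by rewrite modn_dvdm // dvdn_mull.
    congr muln; rewrite [in RHS](divn_eq i (N * N)) mulnA divnMDl // modnMDl.
    by rewrite [RHS]modn_small // ltn_divLR // ltn_mod.
  move=> r /andP[r0 rb]; rewrite upd_other ?/rho2 ?/rho1 ?upd_other //; lia.
apply: HQ; rewrite ?E14 ?E15.
- split; first exact: bd2.1.
  move=> a; rewrite /overwrite; case: ifP => [/andP[h1 h2]|_]; last exact: bd2.2.
  have i_lt : a - J.+2 * (N * N) < C * (N * N) by lia.
  rewrite -[X in g X](subnKC (leq0n _)) subn0.
  move: (a - _) i_lt => i i_lt; have iC : i %/ (N * N) < C by rewrite ltn_divLR.
  apply: (Ef (fun r => if r == 0 then
     i %/ (N * N) * (N * N) + i %/ N %% N * N + i %% N else rho r) _ _ _ iC _ _ _).2;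
  rewrite ?ltn_mod //; split=> //= r /andP[r0 _]; by rewrite eqn0Ngt r0.
- by apply: keep_trans k1 _; apply: keep_upd.
move=> j' x y xN yN; rewrite slot_overwrite //; case: ifP => // _.
by rewrite gE.
Qed.

End Tables.

(** * Butterfly reduction *)

(* For [s] a power of two, [p] with the bit of weight [s] complemented. *)
Definition flip (s p : nat) : nat := p + s - (s + s) * (p %/ s %% 2).

(** After [l] rounds every index holds the reduction over its whole aligned block of size [2 ^ l],
    so stopping early reduces all blocks simultaneously. *)
Fixpoint red (op : nat -> nat -> nat) (l : nat) (f : nat -> nat) (p : nat) : nat :=
  if l is l'.+1 then op (red op l' f p) (red op l' f (flip (2 ^ l') p)) else f p.

Lemma flip_div s p : 0 < s ->
  flip s p %/ s = if odd (p %/ s) then (p %/ s).-1 else (p %/ s).+1.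
Proof.
move=> s_gt0; rewrite /flip modn2; case: (boolP (odd (p %/ s))) => [|_] /=.
  rewrite muln1 subnDr; case def_q: (p %/ s) => [|q] //= _.
  have E := divn_eq p s; rewrite def_q in E.
  have -> : p - s = q * s + p %% s by move: E; rewrite mulSn; lia.
  by rewrite divnMDl // divn_small ?ltn_mod ?addn0.
by rewrite muln0 subn0 divnDr // divnn s_gt0 addn1.
Qed.

Lemma pow2_gt0 l : 0 < 2 ^ l.
Proof. by rewrite expn_gt0. Qed.

Lemma block_split l p p' :
  (p' %/ 2 ^ l.+1 == p %/ 2 ^ l.+1) =
  (p' %/ 2 ^ l == p %/ 2 ^ l) || (p' %/ 2 ^ l == flip (2 ^ l) p %/ 2 ^ l).
Proof.
rewrite expnSr !divnMA flip_div ?pow2_gt0 //.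
move: (p' %/ 2 ^ l) (p %/ 2 ^ l) => a b; rewrite !divn2.
have := odd_double_half a; have := odd_double_half b; case: (odd b); case: (odd a);
  move=> /= Eb Ea; apply/eqP/orP => [h|[/eqP h|/eqP h]]; lia.
Qed.

Lemma flip_block l p : flip (2 ^ l) p %/ 2 ^ l.+1 = p %/ 2 ^ l.+1.
Proof. by apply/eqP; rewrite block_split eqxx orbT. Qed.

Lemma block_sub l L p p' : l <= L -> p' %/ 2 ^ l = p %/ 2 ^ l ->
  p' %/ 2 ^ L = p %/ 2 ^ L.
Proof. by move=> /subnKC<- E; rewrite expnD !divnMA E. Qed.

Lemma block_lt l L p p' : l <= L -> p' %/ 2 ^ l = p %/ 2 ^ l -> p < 2 ^ L -> p' < 2 ^ L.
Proof.
move=> lL /(block_sub lL) E pL; rewrite -[2 ^ L]mul1n -ltn_divLR ?pow2_gt0 //.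
by rewrite E divn_small.
Qed.

Lemma flip_lt l L p : l < L -> p < 2 ^ L -> flip (2 ^ l) p < 2 ^ L.
Proof. by move=> lL; apply: block_lt lL (flip_block l p). Qed.

Section Reduction.

Variable op : nat -> nat -> nat.

Lemma red_ext l f g p :
  (forall p', p' %/ 2 ^ l = p %/ 2 ^ l -> f p' = g p') -> red op l f p = red op l g p.
Proof.
elim: l p => [|l IHl] p E /=; first by apply: E; rewrite !divn1.
congr op; apply: IHl => p' Ep'; apply: E; apply/eqP;
by rewrite block_split Ep' eqxx ?orbT.
Qed.

Lemma red_attained l f p : (forall a b, op a b = a \/ op a b = b) ->
  exists2 p', p' %/ 2 ^ l = p %/ 2 ^ l & red op l f p = f p'.
Proof.
move=> sel; elim: l p => [|l IHl] p /=; first by exists p.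
have [p1 E1 ->] := IHl p; have [p2 E2 ->] := IHl (flip (2 ^ l) p).
case: (sel (f p1) (f p2)) => ->; [exists p1 | exists p2] => //; apply/eqP;
by rewrite block_split ?E1 ?E2 eqxx ?orbT.
Qed.

Lemma red_extremal (R : nat -> nat -> Prop) l f p p' :
  (forall a, R a a) -> (forall a b c, R a b -> R b c -> R a c) ->
  (forall a b, R (op a b) a) -> (forall a b, R (op a b) b) ->
  p' %/ 2 ^ l = p %/ 2 ^ l -> R (red op l f p) (f p').
Proof.
move=> Rr Rt Rl Rr'; elim: l p => [|l IHl] p /=; first by rewrite !divn1 => ->.
move=> /eqP; rewrite block_split => /orP[] /eqP /IHl h; apply: Rt h.
  exact: Rl.
exact: Rr'.
Qed.

End Reduction.

Lemma red_sum l f p :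
  red addn l f p = sumn [seq f i | i <- iota (p %/ 2 ^ l * 2 ^ l) (2 ^ l)].
Proof.
elim: l p => [|l IHl] p; first by rewrite /= divn1 muln1 addn0.
rewrite [LHS]/= !IHl -sumn_cat -map_cat flip_div ?pow2_gt0 //.
have -> : p %/ 2 ^ l.+1 = (p %/ 2 ^ l)./2 by rewrite expnSr divnMA divn2.
have := odd_double_half (p %/ 2 ^ l); move: (p %/ 2 ^ l) => a.
have E : 2 ^ l.+1 = 2 ^ l + 2 ^ l by rewrite expnS mul2n addnn.
rewrite E iotaD; case: (odd a) => /= Ea; rewrite !map_cat !sumn_cat.
  rewrite addnC; congr (sumn (map f (iota _ _)) + sumn (map f (iota _ _))).
    by rewrite -{1}Ea; move: (2 ^ l) => K; rewrite /= -muln2; lia.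
  by rewrite -{1}Ea; move: (2 ^ l) => K; rewrite /= -muln2; lia.
congr (sumn (map f (iota _ _)) + sumn (map f (iota _ _))).
  by rewrite -{1}Ea; move: (2 ^ l) => K; rewrite /= -muln2; lia.
by rewrite -{1}Ea; move: (2 ^ l) => K; rewrite /= -muln2; lia.
Qed.

Definition set_ok (r : nat) (e : expr) : bool :=
  [&& fits e, r < nreg & size (assign r e) <= tm].

Definition eflip (s p : expr) : expr :=
  Bin OpSub (Bin OpAdd p s)
    (Bin OpMul (Bin OpAdd s s) (Bin OpMod (Bin OpDiv p s) (Cst 2))).

Definition eT (p : expr) : expr := eslot (Bin OpAdd (Var rT) p) eX eY.

Definition reduce_step (eop : expr -> expr -> expr) : expr :=
  eop (eT eP) (eT (eflip (Var rs) eP)).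

Definition set_flag : pram_prog := set_reg rc (Bin OpLt (Var rs) (Var rk)).

Definition reduce (eop : expr -> expr -> expr) : pram_prog :=
  set_reg rs (Cst 1) ++ (set_flag ++
  [:: Loop rc (slot_map (Var rT) (Var rN) (reduce_step eop) ++
       (set_reg rs (Bin OpAdd (Var rs) (Var rs)) ++ set_flag))]).

Definition reduce_time (l : nat) : nat :=
  tm + (tm + (l * (tm + (tm + tm)).+1).+1).

Section Reduce.

Variables (w X N L T : nat).
Hypotheses (X_gt1 : 1 < X) (fitX : X ^ maxdeg < 2 ^ w) (NL : N = 2 ^ L).
Hypotheses (N3X : N * (N * N) <= X) (TX : (T + N).+2 * (N * N) <= X).

Local Notation wp := (wp w X (N * (N * N))).
Local Notation slot := (slot N).

Lemma N_gt0 : 0 < N.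
Proof. by rewrite NL pow2_gt0. Qed.

Lemma wp_set_tm r e v (Q : registers -> memory -> Prop) rho M :
  bounded X rho M -> set_ok r e -> eval e rho M = v -> v <= X ->
  (forall rho', bounded X rho' M -> rho' r = v ->
    (forall r', r' != r -> rho' r' = rho r') -> Q rho' M) ->
  wp (set_reg r e) tm Q rho M.
Proof.
move=> bd /and3P[fe rK sz] Ev vX HQ.
apply: (wp_weaken (Q1 := Q) _ sz) => //; apply: (wp_set _ X_gt1 fitX); rewrite ?Ev //.
apply: HQ => [||r' r'r]; last 2 first.
- by rewrite upd_same.
- by rewrite upd_other.
by case: bd => bR bM; split=> // r' r'K; rewrite /upd; case: ifP => // _; apply: bR.
Qed.

Definition ctx (rho : registers) : Prop :=
  [/\ rho rN = N, rho rNN = N * N & rho rT = T].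

Lemma ctx_keep m rho rho' : rT < m -> keep m rho rho' -> ctx rho -> ctx rho'.
Proof. by move=> mT k [h1 h2 h3]; split; rewrite k //; apply: leq_trans mT. Qed.

Lemma ctx_local rho rho' p x y : local N rho rho' p x y -> ctx rho -> ctx rho'.
Proof. by move=> [_ k] [h1 h2 h3]; split; rewrite k. Qed.

Lemma eval_eT rho rho' M p x y e : ctx rho -> x < N -> y < N ->
  local N rho rho' p x y ->
  eval (eT e) rho' M = slot M (T + eval e rho' M) x y.
Proof.
move=> cx xN yN lc; have [EN ENN ET] := ctx_local lc cx.
have [EN0 _ _] := cx.
have Ex : eval eX rho' M = x by exact: (eval_eX N_gt0 _ EN0 xN yN lc).
have Ey : eval eY rho' M = y by exact: (eval_eY _ EN0 xN yN lc).
rewrite /eT (eval_eslot (N := N)) // Ex Ey.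
by rewrite [eval (Bin _ _ _) _ _]/= ET.
Qed.

Lemma eval_eflip rho s p M k q :
  eval s rho M = k -> eval p rho M = q -> eval (eflip s p) rho M = flip k q.
Proof. by move=> /= -> ->. Qed.

Lemma wp_reduce op eop l (Q : registers -> memory -> Prop) rho M :
  let g M x y p := slot M (T + p) x y in
  bounded X rho M -> ctx rho -> rho rk = 2 ^ l -> l <= L ->
  slot_map_ok (Var rT) (Var rN) (reduce_step eop) ->
  (forall a b rho M, eval (eop a b) rho M = op (eval a rho M) (eval b rho M)) ->
  (forall j p x y, j <= l -> p < N -> x < N -> y < N ->
     red op j (g M x y) p <= X) ->
  (forall rho' M', bounded X rho' M' -> keep rs rho rho' ->
     (forall j x y, x < N -> y < N -> slot M' j x y =
        if T <= j < T + N then red op l (g M x y) (j - T) else slot M j x y) ->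
     Q rho' M') ->
  wp (reduce eop) (reduce_time l) Q rho M.
Proof.
move=> g bd cx Ek lL ok Eop redX HQ.
have NX : N <= X by have := N_gt0; nia.
have lX : 2 ^ l <= X by apply: leq_trans NX; rewrite NL leq_exp2l.
have powX j : j <= l -> 2 ^ j <= X by move=> jl; apply: leq_trans lX; rewrite leq_exp2l.
apply: wp_cat; apply: (wp_set_tm (v := 1)) => // [|rho1 bd1 E1 k1]; first exact: ltnW.
have flag rho2 j M2 (Q2 : registers -> memory -> Prop) :
    bounded X rho2 M2 -> rho2 rs = 2 ^ j -> rho2 rk = 2 ^ l ->
    (forall rho', bounded X rho' M2 -> rho' rc = (j < l) ->
      (forall r', r' != rc -> rho' r' = rho2 r') -> Q2 rho' M2) ->
    wp set_flag tm Q2 rho2 M2.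
  move=> bd2 Es2 Ek2 HQ2; apply: (wp_set_tm (v := (j < l))) => //.
    by rewrite /= Es2 Ek2 ltn_exp2l.
  by case: (j < l); apply: leq_trans NX; rewrite // N_gt0.
apply: wp_cat; apply: (flag _ 0) => // [|rho2 bd2 Ec2 k2]; first by rewrite k1.
pose I j rho' M' := [/\ keep rs rho rho', rho' rs = 2 ^ j, rho' rc = (j < l) &
  forall i x y, x < N -> y < N -> slot M' i x y =
    if T <= i < T + N then red op j (g M x y) (i - T) else slot M i x y].
apply: (wp_loop (I := I) (t := tm + (tm + tm)) (m := l)) => //.
- split=> //; first by move=> r r12; rewrite k2 ?k1 //; lia.
    by rewrite k2.
  by move=> i x y _ _; case: ifP => // /andP[Ti _]; rewrite /= /g subnKC.
- move=> j rho3 M3 jl bd3 [k3 Es Ec Hs]; split; first by rewrite Ec jl.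
  have cx3 := ctx_keep (isT : rT < rs) k3 cx; have [EN ENN ET] := cx3.
  (* The update can be in place: all processors have read both operands before the common write. *)
  apply: wp_cat; apply: (wp_slot_map X_gt1 fitX N_gt0 N3X bd3 ok ENN
    (J := T) (C := N) (f := fun p x y => red op j.+1 (g M x y) p)).
  + by move=> rho' k; rewrite /= k.
  + by move=> rho' k; rewrite /= k.
  + by rewrite N_gt0 leqnn.
  + by apply: leq_trans TX; rewrite leq_mul2r; apply/orP; right; lia.
  + move=> rho' p x y pN xN yN lc; split; last by apply: redX.
    have Ep : eval eP rho' M3 = p by apply: (eval_eP N_gt0 _ _ xN yN lc); case: cx3.
    have Es' : eval (Var rs) rho' M3 = 2 ^ j by rewrite -Es; apply: lc.2.
    have fN : flip (2 ^ j) p < N.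
      by rewrite NL; apply: flip_lt; [apply: leq_trans lL | rewrite -NL].
    rewrite /reduce_step Eop !(eval_eT _ _ cx3 xN yN lc) (eval_eflip Es' Ep) Ep.
    by rewrite !Hs // !leq_addr !ltn_add2l pN fN /= !addKn.
  move=> rho4 M4 bd4 k4 Hs4.
  have dX : 2 ^ j.+1 <= X by apply: powX.
  apply: wp_cat; apply: (wp_set_tm (v := 2 ^ j.+1)) => //.
    by rewrite /= k4 // Es expnS mul2n addnn.
  move=> rho5 bd5 Es5 k5; apply: (flag _ j.+1) => //.
    by rewrite k5 // k4 // k3.
  move=> rho6 bd6 Ec6 k6; split=> //; last 2 first.
  + by rewrite k6.
  + move=> i x y xN yN; rewrite Hs4 //; case: ifP => // nT.
    by rewrite Hs // nT.
  by move=> r r12; rewrite k6 ?k5 ?k4 ?k3 //; lia.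
move=> rho3 M3 bd3 [k3 Es Ec Hs]; split; first by rewrite Ec ltnn.
exact: HQ.
Qed.

End Reduce.

(** * Distances avoiding each vertex, by divide and conquer *)

Lemma flipE s p : 0 < s -> flip s p =
  (if odd (p %/ s) then (p %/ s).-1 else (p %/ s).+1) * s + p %% s.
Proof.
move=> s_gt0; rewrite -flip_div // [LHS](divn_eq _ s); congr addn.
rewrite /flip modn2; case: (boolP (odd _)) => [o|_]; last first.
  by rewrite muln0 subn0 modnDr.
have sp : s <= p by rewrite -divn_gt0 //; case: (p %/ s) o.
by rewrite muln1 subnDr -[in RHS](subnK sp) modnDr.
Qed.

Lemma flipK s : 0 < s -> involutive (flip s).
Proof.
move=> s_gt0 p; rewrite (flipE _ s_gt0) flip_div //.
have -> : flip s p %% s = p %% s by rewrite flipE // modnMDl modn_mod.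
rewrite [RHS](divn_eq p s); congr (_ * _ + _).
case o: (odd (p %/ s)); last by rewrite /= o.
by case: (p %/ s) o => //= a /negbTE->.
Qed.

Lemma reduce_time_leq l l' : l <= l' -> reduce_time l <= reduce_time l'.
Proof. by move=> ll'; rewrite /reduce_time !leq_add2l ltnS leq_mul2r ll' orbT. Qed.

(** The minimum of numbers would be wrong, since the code 0 stands for the largest distance. *)
Definition nmin (a b : nat) : nat := encode (omin (decode a) (decode b)).
Definition nmax (a b : nat) : nat := encode (omax (decode a) (decode b)).

Lemma eval_nmin a b rho M :
  eval (eomin a b) rho M = nmin (eval a rho M) (eval b rho M).
Proof. by apply: eval_eomin; rewrite decodeK. Qed.

Lemma eval_nmax a b rho M :
  eval (eomax a b) rho M = nmax (eval a rho M) (eval b rho M).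
Proof. by apply: eval_eomax; rewrite decodeK. Qed.

Lemma nmin_sel a b : nmin a b = a \/ nmin a b = b.
Proof. by rewrite /nmin /omin; case: ifP; rewrite decodeK; [left|right]. Qed.

Lemma nmax_sel a b : nmax a b = a \/ nmax a b = b.
Proof. by rewrite /nmax /omax; case: ifP; rewrite decodeK; [right|left]. Qed.

Lemma red_nmin_le l f p p' : p' %/ 2 ^ l = p %/ 2 ^ l ->
  ole (decode (red nmin l f p)) (decode (f p')).
Proof.
apply: (red_extremal (R := fun a b => ole (decode a) (decode b))).
- by move=> a; apply: ole_refl.
- by move=> a b c; apply: ole_trans.
- by move=> a b; rewrite /nmin encodeK omin_lel.
- by move=> a b; rewrite /nmin encodeK omin_ler.
Qed.

Lemma red_nmax_ge l f p p' : p' %/ 2 ^ l = p %/ 2 ^ l ->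
  ole (decode (f p')) (decode (red nmax l f p)).
Proof.
apply: (red_extremal (R := fun a b => ole (decode b) (decode a))).
- by move=> a; apply: ole_refl.
- by move=> a b c ab bc; apply: ole_trans ab.
- by move=> a b; rewrite /nmax encodeK omax_gel.
- by move=> a b; rewrite /nmax encodeK omax_ger.
Qed.

Lemma red_sel_le op l f p X : (forall a b, op a b = a \/ op a b = b) ->
  (forall p', p' %/ 2 ^ l = p %/ 2 ^ l -> f p' <= X) -> red op l f p <= X.
Proof. by move=> sel fX; have [p' Ep' ->] := red_attained l f p sel; apply: fX. Qed.

Definition eD (p x y : expr) : expr := eslot (Bin OpAdd (Var rQ) p) x y.

(** All [p] of a block have equal tables. So table [p] needs to try only the single intermediate
    vertex [flip k p]: as [p] runs through the block, this vertex runs through the sibling, and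
    reducing over the block yields the minimum. This is how [N ^ 3] processors suffice. *)
Definition relax_step : pram_prog :=
  slot_map (Var rT) (Var rN)
    (eoadd (eD eP eX (eflip (Var rk) eP)) (eD eP (eflip (Var rk) eP) eY)) ++
  (reduce eomin ++ slot_map (Var rQ) (Var rN) (eomin (eD eP eX eY) (eT eP))).

(* For [k = N / 2, ..., 2, 1] in register [rk], the sibling of the block of size [k]
   around [p] is added to the intermediate vertices allowed in table [p] of [D]:
   the [i]-th relaxation step accounts for walks with fewer than [2 ^ i] visits to it. *)
Definition exclude : pram_prog :=
  set_reg rk (Bin OpDiv (Var rN) (Cst 2)) ++
  [:: Loop rk (set_reg rit (Var rLL) ++
       ([:: Loop rit (relax_step ++ set_reg rit (Bin OpSub (Var rit) (Cst 1)))] ++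
        set_reg rk (Bin OpDiv (Var rk) (Cst 2))))].

Lemma cube_le N Q X : (Q + N + N).+2 * (N * N) <= X -> N * (N * N) <= X.
Proof. by apply: leq_trans; rewrite leq_mul2r; apply/orP; right; lia. Qed.

Section Exclude.

Variables (w X N L Q Wm : nat) (W : nat -> nat -> option nat).
Hypotheses (X_gt1 : 1 < X) (fitX : X ^ maxdeg < 2 ^ w) (NL : N = 2 ^ L).
Hypotheses (QX : (Q + N + N).+2 * (N * N) <= X) (WX : (N.+1 * Wm).*2.+1 <= X).
Hypothesis W_le : forall u v e, W u v = Some e -> e <= Wm.

Local Notation T := (Q + N).
Local Notation wp := (wp w X (N * (N * N))).
Local Notation slot := (slot N).

Definition tab (M : memory) (x y p : nat) : option nat := decode (slot M (Q + p) x y).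

Lemma slot_tab M x y p : slot M (Q + p) x y = encode (tab M x y p).
Proof. by rewrite /tab decodeK. Qed.

Definition outside (l p : nat) : pred nat :=
  fun b => (b < N) && (b %/ 2 ^ l != p %/ 2 ^ l).

Definition sibling (l p : nat) : pred nat :=
  fun b => b %/ 2 ^ l == flip (2 ^ l) p %/ 2 ^ l.

Lemma sibling_lt l p b : l < L -> p < N -> sibling l p b -> b < N.
Proof.
move=> lL pN /eqP E; rewrite NL; apply: (block_lt (ltnW lL) E).
by apply: flip_lt; rewrite -?NL.
Qed.

Definition partial (l i : nat) (M : memory) : Prop :=
  forall x y p, x < N -> y < N -> p < N ->
    ismin W (fewB (outside l.+1 p) (sibling l p) i) x y (tab M x y p).

Lemma partial_block l i M x y p p' : l < L -> partial l i M ->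
  x < N -> y < N -> p < N -> p' < N -> p' %/ 2 ^ l = p %/ 2 ^ l ->
  tab M x y p' = tab M x y p.
Proof.
move=> lL PM xN yN pN p'N E; apply: ismin_unique (PM x y p xN yN pN).
apply: ismin_ext (PM x y p' xN yN p'N) => q.
have E1 : p' %/ 2 ^ l.+1 = p %/ 2 ^ l.+1 by apply: block_sub E.
by rewrite /fewB /outside /sibling !flip_div ?pow2_gt0 // E1 E.
Qed.

Lemma partial_le l i M x y p : l < L -> partial l i M ->
  x < N -> y < N -> p < N -> slot M (Q + p) x y <= (N.+1 * Wm).+1.
Proof.
move=> lL PM xN yN pN; rewrite slot_tab; have := PM x y p xN yN pN.
case: (tab M x y p) => [d|] //= H; rewrite ltnS.
apply: (ismin_few_le _ _ W_le H); first by move=> b; apply: sibling_lt.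
by move=> b /andP[].
Qed.

Definition relax_time : nat := tm + (reduce_time L + tm).

Lemma eval_eD rho rho' M p x y e : rho rN = N -> rho rNN = N * N -> rho rQ = Q ->
  local N rho rho' p x y -> forall ex ey,
  eval (eD e ex ey) rho' M =
    slot M (Q + eval e rho' M) (eval ex rho' M) (eval ey rho' M).
Proof.
move=> EN ENN EQ lc ex ey; rewrite /eD (eval_eslot (N := N)).
- by rewrite [eval (Bin _ _ _) _ _]/= [rho' _]lc.2 // EQ.
- by rewrite [rho' _]lc.2.
by rewrite [rho' _]lc.2.
Qed.

Lemma wp_relax_step l i (Q' : registers -> memory -> Prop) rho M :
  bounded X rho M -> ctx N T rho -> rho rQ = Q -> rho rk = 2 ^ l -> l < L ->
  partial l i M ->
  (forall rho' M', bounded X rho' M' -> keep rs rho rho' -> partial l i.+1 M' ->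
     (forall j x y, j < Q -> x < N -> y < N -> slot M' j x y = slot M j x y) ->
     Q' rho' M') ->
  wp relax_step relax_time Q' rho M.
Proof.
move=> bd cx EQ Ek lL PM HQ; have [EN ENN ET] := cx.
have N_gt0 : 0 < N by rewrite NL pow2_gt0.
have fN p : p < N -> flip (2 ^ l) p < N by rewrite NL; apply: flip_lt.
pose f p x y :=
  encode (oadd (tab M x (flip (2 ^ l) p) p) (tab M (flip (2 ^ l) p) y p)).
have fX p x y : p < N -> x < N -> y < N -> f p x y <= X.
  move=> pN xN yN; rewrite /f.
  have := partial_le lL PM xN (fN p pN) pN; have := partial_le lL PM (fN p pN) yN pN.
  rewrite !slot_tab; case: (tab _ _ _ _) => [d1|]; case: (tab _ _ _ _) => [d2|] //=.
  by move: WX; rewrite -addnn; lia.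
have TX J : J <= Q + N -> J.+2 * (N * N) <= X.
  by move=> JT; apply: leq_trans QX; rewrite leq_mul2r; apply/orP; right; lia.
apply: wp_cat; apply: (wp_slot_map X_gt1 fitX N_gt0 (cube_le QX) bd _ ENN
  (J := T) (C := N) (f := f)) => //.
- by move=> rho' k; rewrite /= k.
- by move=> rho' k; rewrite /= k.
- by rewrite N_gt0 leqnn.
- exact: TX.
- move=> rho' p x y pN xN yN lc; split; last exact: fX.
  have Ep : eval eP rho' M = p by apply: (eval_eP N_gt0 _ _ xN yN lc).
  have Ex : eval eX rho' M = x by apply: (eval_eX N_gt0 _ EN xN yN lc).
  have Ey : eval eY rho' M = y by apply: (eval_eY _ EN xN yN lc).
  have Ek' : eval (Var rk) rho' M = 2 ^ l by rewrite /= lc.2.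
  have Eb := eval_eflip Ek' Ep.
  by apply: eval_eoadd; rewrite (eval_eD _ _ EN ENN EQ lc) ?Ep ?Ex ?Ey ?Eb slot_tab.
move=> rho1 M1 bd1 k1 H1.
have cx1 : ctx N T rho1 by apply: ctx_keep k1 cx.
have T1 p x y : p < N -> x < N -> y < N -> slot M1 (T + p) x y = f p x y.
  by move=> pN xN yN; rewrite H1 // leq_addr ltn_add2l pN /= addKn.
pose m p x y := red nmin l (fun p => slot M1 (T + p) x y) p.
have blockN p p' : p < N -> p' %/ 2 ^ l = p %/ 2 ^ l -> p' < N.
  by rewrite NL => pN E; apply: block_lt E pN; apply: ltnW.
apply: wp_cat; apply: (wp_weaken (t1 := reduce_time l) _ _ (fun _ _ _ q => q));
  last by apply: reduce_time_leq; apply: ltnW.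
apply: (wp_reduce X_gt1 fitX NL (cube_le QX) QX bd1 cx1 (op := nmin)) => //.
- by rewrite k1.
- exact: ltnW.
- exact: eval_nmin.
- move=> j p x y jl pN xN yN; apply: red_sel_le nmin_sel _ => p' Ep'.
  have p'N : p' < N by rewrite NL in pN *; apply: block_lt Ep' pN; lia.
  by rewrite T1 //; apply: fX.
move=> rho2 M2 bd2 k2 H2; have cx2 : ctx N T rho2 by apply: ctx_keep k2 cx1.
have k12 : keep rs rho rho2 by apply: keep_trans k2; apply: keep_sub k1.
have [EN2 ENN2 ET2] := cx2.
have T2 p x y : p < N -> x < N -> y < N -> slot M2 (T + p) x y = m p x y.
  by move=> pN xN yN; rewrite H2 // leq_addr ltn_add2l pN /= addKn.
have D2 p x y : p < N -> x < N -> y < N -> slot M2 (Q + p) x y = encode (tab M x y p).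
  move=> pN xN yN; rewrite H2 // H1 // -slot_tab.
  by have -> : (T <= Q + p) = false by lia.
have mX p x y : p < N -> x < N -> y < N -> m p x y <= X.
  move=> pN xN yN; apply: red_sel_le nmin_sel _ => p' /(blockN _ _ pN) p'N.
  by rewrite T1 //; apply: fX.
have DX p x y : p < N -> x < N -> y < N -> encode (tab M x y p) <= X.
  move=> pN xN yN; rewrite -slot_tab; apply: leq_trans (partial_le lL PM _ _ _) _ => //.
  by move: WX; rewrite -addnn; lia.
apply: (wp_slot_map X_gt1 fitX N_gt0 (cube_le QX) bd2 _ ENN2 (J := Q) (C := N)
  (f := fun p x y => encode (omin (tab M x y p) (decode (m p x y))))) => //.
- by move=> rho' k; rewrite /= k // k12.
- by move=> rho' k; rewrite /= k.
- by rewrite N_gt0 leqnn.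
- by apply: TX; lia.
- move=> rho' p x y pN xN yN lc.
  have Ep : eval eP rho' M2 = p by apply: (eval_eP N_gt0 _ _ xN yN lc).
  have Ex : eval eX rho' M2 = x by apply: (eval_eX N_gt0 _ EN2 xN yN lc).
  have Ey : eval eY rho' M2 = y by apply: (eval_eY _ EN2 xN yN lc).
  have EQ2 : rho2 rQ = Q by rewrite k12.
  split; last first.
    by rewrite /omin; case: ifP => _; [apply: DX | rewrite decodeK; apply: mX].
  apply: eval_eomin.
    by rewrite (eval_eD _ _ EN2 ENN2 EQ2 lc) Ep Ex Ey D2.
  by rewrite (eval_eT NL _ _ cx2 xN yN lc) Ep T2 // decodeK.
move=> rho3 M3 bd3 k3 H3; apply: HQ => //.
- by apply: keep_trans k12 _; apply: keep_sub k3.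
- move=> x y p xN yN pN; rewrite /tab H3 // leq_addr ltn_add2l pN /= addKn encodeK.
  have same p' : p' < N -> p' %/ 2 ^ l = p %/ 2 ^ l -> forall x y, x < N -> y < N ->
      tab M x y p' = tab M x y p.
    by move=> p'N E x' y' x'N y'N; apply: partial_block PM _ _ _ _ E.
  have PMp x' y' x'N y'N := PM x' y' p x'N y'N pN.
  have sN b := @sibling_lt l p b lL pN.
  apply: (ismin_double sN PMp) => //.
  (* A vertex [b] of the sibling is tried by [flip (2 ^ l) b], which lies in the block of [p]. *)
  + move=> b /[dup] /(sibling_lt lL pN) bN /eqP Eb.
    have Ep' : flip (2 ^ l) b %/ 2 ^ l = p %/ 2 ^ l.
      by rewrite flip_div ?pow2_gt0 // Eb -flip_div ?pow2_gt0 // flipK ?pow2_gt0.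
    have p'N := blockN _ _ pN Ep'.
    apply: ole_trans (red_nmin_le _ Ep') _.
    rewrite T1 // /f encodeK flipK ?pow2_gt0 // !(same _ p'N Ep') //.
    exact: ole_refl.
  have [p' Ep' E] := red_attained l (fun p => slot M1 (T + p) x y) p nmin_sel.
  have p'N := blockN _ _ pN Ep'; right; exists (flip (2 ^ l) p').
    by rewrite /sibling !flip_div ?pow2_gt0 // Ep'.
  by rewrite /m E T1 // /f encodeK !(same _ p'N Ep') // fN.
move=> j x y jQ xN yN; rewrite H3 // H2 // H1 //.
have -> : (Q <= j) = false by lia.
by have -> : (T <= j) = false by lia.
Qed.

Definition inner_time : nat := tm + (((L.+1 * (relax_time + tm).+1).+1) + tm).
Definition exclude_time : nat := tm + (L * inner_time.+1).+1.

Definition edges_only (M : memory) : Prop := forall x y p,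
  x < N -> y < N -> p < N -> tab M x y p = W x y.

Definition excluded (l : nat) (M : memory) : Prop := forall x y p,
  x < N -> y < N -> p < N -> ismin W (allow (outside l p)) x y (tab M x y p).

Lemma edges_excluded M : edges_only M -> excluded L M.
Proof.
move=> EM x y p xN yN pN; rewrite EM //; split=> [[|b q] /=|l E].
- by move=> _; rewrite oadd0 ole_refl.
- by rewrite /allow /outside /= -NL => /andP[/andP[bN]]; rewrite !divn_small.
by exists [::]; rewrite /= oadd0.
Qed.

Lemma excluded_partial l M : l < L -> excluded l.+1 M -> partial l 0 M.
Proof.
move=> lL EM x y p xN yN pN; apply/ismin_few0; last exact: EM.
move=> b /andP[_]; apply: contra => /eqP E.
by apply/eqP; rewrite -(flip_block l p); apply: block_sub E.
Qed.

Lemma partial_excluded l M : l < L -> partial l L.+1 M -> excluded l M.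
Proof.
move=> lL PM x y p xN yN pN; have N2 : N < 2 ^ L.+1 by rewrite NL ltn_exp2l.
have sN b := @sibling_lt l p b lL pN.
have oN b : outside l.+1 p b -> b < N by case/andP.
have /(ismin_fewN _ sN _ _ _ oN N2) := PM x y p xN yN pN.
apply: ismin_ext => q; rewrite /allow; split=> allq; apply/allP => b bq;
have := allP allq b bq; rewrite /outside /sibling /= block_split negb_or flip_div ?pow2_gt0 //.
- case/orP=> [/and3P[-> ->]//|E].
  have := sibling_lt lL pN (b := b); rewrite /sibling flip_div ?pow2_gt0 // => ->//=.
  rewrite (eqP E) //; apply/eqP; case: (boolP (odd _)) => //= o; last by lia.
  by case: (p %/ 2 ^ l) o => //= a _; lia.
case/andP=> -> -> /=; exact: orNb.
Qed.

Lemma wp_exclude (Q' : registers -> memory -> Prop) rho M :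
  bounded X rho M -> ctx N T rho -> rho rQ = Q -> rho rLL = L.+1 -> edges_only M ->
  (forall rho' M', bounded X rho' M' -> keep rk rho rho' -> excluded 0 M' ->
     (forall j x y, j < Q -> x < N -> y < N -> slot M' j x y = slot M j x y) ->
     Q' rho' M') ->
  wp exclude exclude_time Q' rho M.
Proof.
move=> bd cx EQ ELL EM HQ; have [EN ENN ET] := cx.
have NX : N <= X by have := (cube_le QX); have := N_gt0 NL; nia.
(* The quotient [1 %/ 2 = 0] is what ends the outer loop after the blocks of size 1. *)
have half l : 2 ^ l %/ 2 = if l is l'.+1 then 2 ^ l' else 0.
  by case: l => // l; rewrite expnS mulKn.
have halfX l : l <= L -> (if l is l'.+1 then 2 ^ l' else 0) <= X.
  case: l => // l lL; apply: leq_trans NX; rewrite NL leq_exp2l //; exact: ltnW.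
apply: wp_cat; apply: (wp_set_tm _ X_gt1 fitX (v := if L is l.+1 then 2 ^ l else 0)) => //.
  by rewrite /= EN NL half.
  exact: halfX.
move=> rho1 bd1 E1 k1.
pose I j rho' M' := [/\ keep rk rho rho',
  rho' rk = (if L - j is l.+1 then 2 ^ l else 0), excluded (L - j) M' &
  forall i x y, i < Q -> x < N -> y < N -> slot M' i x y = slot M i x y].
apply: (wp_loop (I := I) (t := inner_time) (m := L)) => //.
- split=> //; first by move=> r r7; rewrite k1 //; lia.
    by rewrite subn0.
  by rewrite subn0; apply: edges_excluded.
- move=> j rho2 M2 jL bd2 [k2 Ek2 X2 S2].
  have [l def_l] : exists l, L - j = l.+1 by exists (L - j).-1; lia.
  have lL : l < L by lia.
  have def_j : L - j.+1 = l by lia.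
  rewrite def_l in Ek2 X2; split; first by rewrite Ek2 -lt0n pow2_gt0.
  have LLX : L.+1 <= X by apply: leq_trans NX; rewrite NL ltn_expl.
  apply: wp_cat; apply: (wp_set_tm _ X_gt1 fitX (v := L.+1)) => //; first by rewrite /= k2.
  move=> rho3 bd3 E3 k3.
  pose I2 i rho' M' := [/\ keep rit rho3 rho', rho' rit = L.+1 - i, partial l i M' &
    forall i x y, i < Q -> x < N -> y < N -> slot M' i x y = slot M i x y].
  apply: wp_cat; apply: (wp_loop (I := I2) (t := relax_time + tm) (m := L.+1)) => //.
  + by split=> //; apply: excluded_partial.
  + move=> i rho4 M4 iL bd4 [k4 E4 P4 S4]; split; first by rewrite E4 -lt0n subn_gt0.
    have k34 r : r < rit -> rho4 r = rho2 r by move=> r8; rewrite k4 // k3 //; lia.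
    apply: wp_cat; apply: (wp_relax_step (l := l) (i := i)) => //.
    * by split; rewrite k34 // k2.
    * by rewrite k34 // k2.
    * by rewrite k34.
    move=> rho5 M5 bd5 k5 P5 S5; apply: (wp_set_tm _ X_gt1 fitX (v := L.+1 - i.+1)) => //.
    * by rewrite /= k5 // E4; lia.
    * by apply: leq_trans LLX; lia.
    move=> rho6 bd6 E6 k6; split=> //; first by move=> r r8; rewrite k6 ?k5 ?k4 //; lia.
    by move=> i' x y i'Q xN yN; rewrite S5 // S4.
  move=> rho4 M4 bd4 [k4 E4 P4 S4]; split; first by rewrite E4 subnn.
  apply: (wp_set_tm _ X_gt1 fitX (v := if l is l'.+1 then 2 ^ l' else 0)) => //.
    by rewrite /= k4 // k3 // Ek2 half.
    by apply: halfX; apply: ltnW.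
  move=> rho5 bd5 E5 k5; split=> //.
  + by move=> r r7; rewrite k5 ?k4 ?k3 ?k2 //; lia.
  + by rewrite def_j.
  by rewrite def_j; apply: partial_excluded.
move=> rho2 M2 bd2 [k2 Ek2 X2 S2]; rewrite subnn in Ek2 X2; split=> //.
exact: HQ.
Qed.

End Exclude.

(** * The tables of the oracle *)

Section EvalBool.

Variables (rho : registers) (M : memory).
Local Notation ev e := (eval e rho M).

Lemma eval_eand e1 e2 (b1 b2 : bool) : ev e1 = b1 -> ev e2 = b2 ->
  ev (eand e1 e2) = b1 && b2.
Proof. by move=> /= -> ->; rewrite mulnb. Qed.

Lemma eval_enot e (b : bool) : ev e = b -> ev (enot e) = ~~ b.
Proof. by move=> /= ->; case: b. Qed.

Lemma eval_eq e1 e2 v1 v2 : ev e1 = v1 -> ev e2 = v2 ->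
  ev (Bin OpEq e1 e2) = (v1 == v2).
Proof. by move=> /= -> ->. Qed.

Lemma eval_lt e1 e2 v1 v2 : ev e1 = v1 -> ev e2 = v2 ->
  ev (Bin OpLt e1 e2) = (v1 < v2).
Proof. by move=> /= -> ->. Qed.

Lemma eval_add e1 e2 v1 v2 : ev e1 = v1 -> ev e2 = v2 ->
  ev (Bin OpAdd e1 e2) = v1 + v2.
Proof. by move=> /= -> ->. Qed.

Lemma eval_mul e1 e2 v1 v2 : ev e1 = v1 -> ev e2 = v2 ->
  ev (Bin OpMul e1 e2) = v1 * v2.
Proof. by move=> /= -> ->. Qed.

End EvalBool.

Definition eadd (a b : expr) : expr := Bin OpAdd a b.

(* Table [dst] receives the reduction over [p] of [e]. *)
Definition fold_table (eop : expr -> expr -> expr) (dst e : expr) : pram_prog :=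
  slot_map (Var rT) (Var rN) e ++
  (reduce eop ++ slot_map dst (Cst 1) (eT (Cst 0))).

Definition table (dst e : expr) : pram_prog := slot_map dst (Cst 1) e.

(* Table numbers.  For each [i <= L], table [4 i + 6] at [(x, y)] is the landmark of
   rank [2 ^ i] before [y], [4 i + 7] the one of rank [2 ^ i] after [x], and [4 i + 9],
   [4 i + 8] are the distances from [x] to [y] avoiding these; table
   [4 (L + 1) + 6 + t] holds the maxima over the classes of index [t].  They are
   followed by the tables of [D] and [T]. *)
Definition dDist : nat := 0.
Definition dNext : nat := 1.
Definition dSecond : nat := 2.
Definition dRank : nat := 3.
Definition dLog : nat := 4.
Definition dEdge : nat := 5.

(** A first edge from [x] to [p], then a walk to [y] that does not return to [x], whence table [x]
    of [D]. *)
Definition eCand : expr := eoadd (eslot (Cst dEdge) eX eP) (eD eX eP eY).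
Definition eDist (x y : expr) : expr := eslot (Cst dDist) x y.
Definition eRank (x y : expr) : expr := eslot (Cst dRank) x y.
Definition eLog (x y : expr) : expr := eslot (Cst dLog) x y.

Definition eCrit : expr := enot (eole (eD eP eX eY) (eDist eX eY)).

Definition eOnpath : expr :=
  eand (epos (eDist eX eY))
    (eand (Bin OpEq (eDist eX eY) (eoadd (eDist eX eP) (eDist eP eY)))
          (Bin OpEq (eRank eX eY) (eadd (eRank eX eP) (eRank eP eY)))).

(** [p.+1] doubles as the code of the finite value [p], so the reduction selects the least first
    neighbour on a shortest walk, and 0 means that there is none. *)
Definition eNext : expr :=
  eif (eand (enot (Bin OpEq eP eX)) (Bin OpEq eCand (eDist eX eY)))
    (eadd eP (Cst 1)) (Cst 0).

Definition eSecond : expr :=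
  eif (eand (enot (Bin OpEq eP eX))
            (enot (Bin OpEq (eadd eP (Cst 1)) (eslot (Cst dNext) eX eY))))
    eCand (Cst 0).

(** [reduce] stops when [rs] reaches [rk]; setting [rk] to [N] makes all later reductions span every
    index. *)
Definition edge_tables : pram_prog :=
  set_reg rk (Var rN) ++
  (table (Cst dDist) (eD eX eX eY) ++
  (fold_table eomin (Cst dNext) eNext ++
   fold_table eomin (Cst dSecond) eSecond)).

Definition rank_table : pram_prog :=
  fold_table eadd (Cst dRank) eCrit ++
  table (Cst dRank) (eif (Bin OpEq eX eY) (Cst 0) (eadd (eRank eX eY) (Cst 1))).

Section Tables.

Variables (w X N L Q : nat).
Hypotheses (X_gt1 : 1 < X) (fitX : X ^ maxdeg < 2 ^ w) (NL : N = 2 ^ L).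
Hypothesis QX : (Q + N + N).+2 * (N * N) <= X.

Local Notation T := (Q + N).
Local Notation wp := (wp w X (N * (N * N))).
Local Notation slot := (slot N).

Definition qctx (rho : registers) : Prop :=
  [/\ ctx N T rho, rho rQ = Q, rho rLL = L.+1 & rho rk = N].

Lemma qctx_keep m rho rho' : rk < m -> keep m rho rho' -> qctx rho -> qctx rho'.
Proof.
move=> mT k [cx h1 h2 h3]; split; first by apply: ctx_keep k cx; apply: ltn_trans mT.
all: by rewrite k //; apply: leq_trans mT.
Qed.

Lemma tables_N_gt0 : 0 < N. Proof. exact: N_gt0 NL. Qed.
Lemma tables_NX : N * N <= X.
Proof. by apply: leq_trans QX; rewrite -{1}[N * N]mul1n leq_mul2r; apply/orP; right. Qed.

Lemma local_eval rho rho' p x y M : ctx N T rho -> rho rQ = Q ->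
  x < N -> y < N -> local N rho rho' p x y ->
  [/\ eval eX rho' M = x, eval eY rho' M = y, eval eP rho' M = p,
      forall j a b, eval (eslot j a b) rho' M =
        slot M (eval j rho' M) (eval a rho' M) (eval b rho' M) &
      forall j a b, eval (eD j a b) rho' M =
        slot M (Q + eval j rho' M) (eval a rho' M) (eval b rho' M)].
Proof.
move=> [EN ENN ET] EQ xN yN lc; have N_gt0 := tables_N_gt0; split.
- exact: (eval_eX N_gt0 _ EN xN yN lc).
- exact: (eval_eY _ EN xN yN lc).
- exact: (eval_eP N_gt0 _ ENN xN yN lc).
- by move=> j a b; rewrite (eval_eslot (N := N)) // lc.2.
by move=> j a b; apply: (eval_eD _ _ EN ENN EQ lc).
Qed.

Lemma wp_table dst e J f (Q' : registers -> memory -> Prop) rho M :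
  bounded X rho M -> qctx rho -> slot_map_ok dst (Cst 1) e -> J < T ->
  (forall rho', keep rbase rho rho' -> eval dst rho' M = J) ->
  (forall rho' x y, x < N -> y < N -> local N rho rho' 0 x y ->
     eval e rho' M = f x y /\ f x y <= X) ->
  (forall rho' M', bounded X rho' M' -> keep rbase rho rho' ->
     (forall j x y, x < N -> y < N ->
        slot M' j x y = if j == J then f x y else slot M j x y) ->
     Q' rho' M') ->
  wp (table dst e) tm Q' rho M.
Proof.
move=> bd [[EN ENN ET] EQ ELL Ek] ok JT Edst Ef HQ; have N_gt0 := tables_N_gt0.
rewrite /table; apply: (wp_slot_map X_gt1 fitX N_gt0 (cube_le QX) bd ok ENN (J := J) (C := 1)
  (f := fun _ => f)) => //.
- by apply: leq_trans QX; rewrite leq_mul2r; apply/orP; right; lia.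
- by move=> rho' [|//] x y _ xN yN lc; apply: Ef.
move=> rho' M' bd' k' H; apply: HQ => // j x y xN yN.
rewrite H //; case: eqVneq => [->|ne]; first by rewrite addn1 ltnSn leqnn.
by case: ifP => //; lia.
Qed.

Lemma wp_fold_table op eop dst e J f (Q' : registers -> memory -> Prop) rho M :
  bounded X rho M -> qctx rho ->
  [&& slot_map_ok (Var rT) (Var rN) e, slot_map_ok (Var rT) (Var rN) (reduce_step eop)
    & slot_map_ok dst (Cst 1) (eT (Cst 0))] ->
  (forall a b rho M, eval (eop a b) rho M = op (eval a rho M) (eval b rho M)) ->
  J < Q -> (forall rho' M', keep rs rho rho' -> eval dst rho' M' = J) ->
  (forall rho' p x y, p < N -> x < N -> y < N -> local N rho rho' p x y ->
     eval e rho' M = f x y p) ->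
  (forall j p x y, j <= L -> p < N -> x < N -> y < N -> red op j (f x y) p <= X) ->
  (forall rho' M', bounded X rho' M' -> keep rs rho rho' ->
     (forall j x y, j < T -> x < N -> y < N ->
        slot M' j x y = if j == J then red op L (f x y) 0 else slot M j x y) ->
     Q' rho' M') ->
  wp (fold_table eop dst e) (relax_time L) Q' rho M.
Proof.
move=> bd qc /and3P[ok1 ok2 ok3] Eop JQ Edst Ef redX HQ; have N_gt0 := tables_N_gt0.
have [cx EQ ELL Ek] := qc; have [EN ENN ET] := cx.
apply: wp_cat; apply: (wp_slot_map X_gt1 fitX N_gt0 (cube_le QX) bd ok1 ENN
  (J := T) (C := N) (f := fun p x y => f x y p)) => //.
- by move=> rho' k; rewrite /= k.
- by move=> rho' k; rewrite /= k.
- by rewrite N_gt0 leqnn.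
- by apply: leq_trans QX; rewrite leq_mul2r; apply/orP; right; lia.
- move=> rho' p x y pN xN yN lc; split; first exact: Ef.
  exact: (redX 0).
move=> rho1 M1 bd1 k1 H1; have qc1 : qctx rho1 by apply: qctx_keep k1 qc.
have T1 x y p : p < N -> x < N -> y < N -> slot M1 (T + p) x y = f x y p.
  by move=> pN xN yN; rewrite H1 // leq_addr ltn_add2l pN /= addKn.
have R1 j p x y : j <= L -> p < N -> x < N -> y < N ->
    red op j (fun p => slot M1 (T + p) x y) p = red op j (f x y) p.
  move=> jL pN xN yN; apply: red_ext => p' Ep'; apply: T1 => //.
  by rewrite NL in pN *; apply: block_lt Ep' pN.
have [cx1 EQ1 ELL1 Ek1] := qc1.
apply: wp_cat; apply: (wp_reduce X_gt1 fitX NL (cube_le QX) QX bd1 cx1 (op := op)) => //.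
- by rewrite Ek1.
- by move=> j p x y jL pN xN yN; rewrite R1 //; apply: redX.
move=> rho2 M2 bd2 k2 H2; have qc2 : qctx rho2 by apply: qctx_keep k2 qc1.
have k12 : keep rs rho rho2 by apply: keep_trans k2; apply: keep_sub k1.
apply: (wp_table (J := J) (f := fun x y => red op L (f x y) 0)) => //.
- by rewrite ltn_addr.
- by move=> rho' k; apply: Edst; apply: keep_trans k12 _; apply: keep_sub k.
- move=> rho' x y xN yN lc; split; last exact: redX.
  have [cx2 _ _ _] := qc2.
  rewrite (eval_eT NL _ _ cx2 xN yN lc) [eval _ _ _]/= H2 // addn0 leqnn subnn.
  by rewrite -[X in X < _]addn0 ltn_add2l N_gt0 /= R1.
move=> rho3 M3 bd3 k3 H3; apply: HQ => //.
  by apply: keep_trans k12 _; apply: keep_sub k3.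
move=> j x y jT xN yN; rewrite H3 //; case: eqP => // _.
by rewrite H2 // H1 //; have -> : (T <= j) = false by lia.
Qed.

End Tables.

Lemma block0 l p : (p %/ 2 ^ l = 0 %/ 2 ^ l) <-> p < 2 ^ l.
Proof.
rewrite div0n; split; last by move=> /divn_small.
by move=> E; rewrite (divn_eq p (2 ^ l)) E ltn_mod pow2_gt0.
Qed.

(** * First edges and the tables for a removed edge *)

Section Spec.

Variables (N L Q Wm : nat) (W : nat -> nat -> option nat)
  (dv : nat -> nat -> nat -> option nat).

Local Notation T := (Q + N).
Local Notation slot := (slot N).
Local Notation d := (dist dv).

Definition stored (M : memory) : Prop :=
  (forall x y v, x < N -> y < N -> v < N -> slot M (Q + v) x y = encode (dv x y v)) /\
  (forall x y, x < N -> y < N -> slot M dEdge x y = encode (W x y)).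

Lemma stored_frame J M M' : dEdge < Q -> J < Q -> J != dEdge ->
  (forall j x y, j < T -> x < N -> y < N -> j != J -> slot M' j x y = slot M j x y) ->
  stored M -> stored M'.
Proof.
move=> EQ JQ J5 fr [h1 h2]; split=> [x y v xN yN vN|x y xN yN].
  by rewrite fr ?h1 ?ltn_add2l //; lia.
rewrite fr ?h2 //; first by rewrite ltn_addr.
by rewrite eq_sym.
Qed.

(** The last clause is for a removed loop [(u, u)], which must not select the second-best table. *)
Definition edge_ok (M : memory) : Prop :=
  [/\ forall x y, x < N -> y < N -> slot M dDist x y = encode (d x y),
      forall u y v, u < N -> y < N -> v < N -> u != y ->
        first_cut N W dv u v y (decode (if v.+1 == slot M dNext u y
          then slot M dSecond u y else slot M dDist u y)) &
      forall u y, u < N -> y < N -> slot M dNext u y != u.+1].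

Hypothesis NL : N = 2 ^ L.
Hypothesis W_le : forall u v e, W u v = Some e -> e <= Wm.
Hypothesis W_self : forall x, W x x = Some 0.
Hypothesis dvP : forall x y v, x < N -> y < N -> v < N ->
  ismin W (allow (avoid N v)) x y (dv x y v).

Lemma dv_le x y v l : x < N -> y < N -> v < N -> dv x y v = Some l -> l <= N.+1 * Wm.
Proof.
move=> xN yN vN E; have := dvP xN yN vN; rewrite E => H.
have PB b : avoid N v b -> ~~ pred0 b by [].
have /(ismin_few0 _ _ _ _ PB) H0 := H.
by apply: (ismin_few_le _ _ W_le H0) => // b /andP[].
Qed.

Definition cand (u y b : nat) : option nat := oadd (W u b) (dv b y u).

Lemma dist_first u y : u < N -> y < N -> u != y ->
  (forall b, b < N -> ole (d u y) (cand u y b)) /\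
  (forall l, d u y = Some l -> exists b, [/\ b < N, b != u & cand u y b = Some l]).
Proof.
move=> uN yN uy; have H1 b : b < N -> ole (d u y) (cand u y b).
  move=> bN; rewrite /cand; case E: (dv b y u) => [l|]; last by case: (W u b).
  have [q [aq Eq]] := (dvP bN yN uN).2 l E.
  have := (distP dvP uN yN).1 (b :: q).
  by rewrite /= -Eq; apply; apply/andP; split=> //; apply: sub_avoid aq.
split=> // l E; have [q [aq Eq]] := (dvP uN yN uN).2 l E.
case: q aq Eq => [|b q] /=.
  rewrite oadd0 => _ E1; exists y; split=> //; first by rewrite eq_sym.
  by rewrite /cand (ad_self (avoid_distP W_self dvP)) // oadd0.
move=> /andP[/andP[bN bu] aq] Eq; exists b; split=> //.
apply: ole_anti; last by rewrite -E; apply: H1.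
by rewrite -Eq; apply: ole_add (ole_refl _) _; apply: (dvP bN yN uN).1.
Qed.

Definition next_val (u y p : nat) : nat :=
  if (p != u) && (encode (cand u y p) == encode (d u y)) then p.+1 else 0.

Definition second_val (nxt u y p : nat) : nat :=
  if (p != u) && (p.+1 != nxt) then encode (cand u y p) else 0.

(** If [v] is not the recorded first neighbour, that neighbour survives the removal and still
    realises [d u y]. Otherwise the minimum over the remaining neighbours is needed. *)
Lemma first_cut_tables u y v : u < N -> y < N -> v < N -> u != y ->
  let nxt := red nmin L (next_val u y) 0 in
  first_cut N W dv u v y (decode (if v.+1 == nxt
    then red nmin L (second_val nxt u y) 0 else encode (d u y))).
Proof.
move=> uN yN vN uy nxt; have [le ex] := dist_first uN yN uy.
have in0 p : p < N -> p %/ 2 ^ L = 0 %/ 2 ^ L by rewrite NL => pN; apply/block0.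
case: eqP => [Ev|nv]; split.
- move=> b bN bu bv; have := red_nmin_le (second_val nxt u y) (in0 b bN).
  by rewrite {2}/second_val bu -Ev eqSS bv encodeK.
- move=> l; have [p /block0 pN ->] := red_attained L (second_val nxt u y) 0 nmin_sel.
  rewrite /second_val; case: ifP => // /andP[pu pv]; rewrite encodeK => E.
  exists p; split=> //; first by rewrite NL.
  by rewrite -Ev eqSS in pv.
- by move=> b bN _ _; rewrite encodeK; apply: le.
move=> l; rewrite encodeK => E; have [b [bN bu Eb]] := ex l E.
have [p /block0 pN Ep] := red_attained L (next_val u y) 0 nmin_sel.
have := red_nmin_le (next_val u y) (in0 b bN); rewrite Ep.
rewrite {2}/next_val bu Eb E eqxx /=.
move: Ep; rewrite /next_val; case: ifP => // /andP[pu /eqP Ecand] Enxt _.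
exists p; split=> //; first by rewrite NL.
  by apply: contra_not_neq nv => <-.
by rewrite -/(cand u y p) -[LHS]encodeK Ecand encodeK.
Qed.

Lemma next_neq u y : red nmin L (next_val u y) 0 != u.+1.
Proof.
have [p _ ->] := red_attained L (next_val u y) 0 nmin_sel.
by rewrite /next_val; case: (eqVneq p u) => //= pu; case: ifP; rewrite ?eqSS.
Qed.

End Spec.

Section Phases.

Variables (w X N L Q Wm : nat) (W : nat -> nat -> option nat)
  (dv : nat -> nat -> nat -> option nat).
Hypotheses (X_gt1 : 1 < X) (fitX : X ^ maxdeg < 2 ^ w) (NL : N = 2 ^ L).
Hypotheses (QX : (Q + N + N).+2 * (N * N) <= X) (WX : (N.+1 * Wm).*2.+2 <= X).
Hypothesis Q_gt5 : 5 < Q.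
Hypothesis W_le : forall u v e, W u v = Some e -> e <= Wm.
Hypothesis W_self : forall x, W x x = Some 0.
Hypothesis dvP : forall x y v, x < N -> y < N -> v < N ->
  ismin W (allow (avoid N v)) x y (dv x y v).

Local Notation T := (Q + N).
Local Notation wp := (wp w X (N * (N * N))).
Local Notation slot := (slot N).
Local Notation d := (dist dv).
Local Notation stored := (stored N Q W dv).
Local Notation edge_ok := (edge_ok N W dv).
Local Notation cand := (cand W dv).
Local Notation next_val := (next_val W dv).
Local Notation second_val := (second_val W dv).

Lemma red_table_le op j f p : (forall a b, op a b = a \/ op a b = b) ->
  (forall p, p < N -> f p <= X) -> j <= L -> p < N -> red op j f p <= X.
Proof.
move=> sel fX jL pN; apply: red_sel_le sel _ => p' Ep'; apply: fX.
by rewrite NL in pN *; apply: block_lt Ep' pN.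
Qed.

Definition edge_time : nat := tm + (tm + (relax_time L + relax_time L)).

Lemma wp_edge_tables (Q' : registers -> memory -> Prop) rho M :
  bounded X rho M -> ctx N T rho -> rho rQ = Q -> rho rLL = L.+1 -> stored M ->
  (forall rho' M', bounded X rho' M' -> keep rk rho rho' -> qctx N L Q rho' ->
     stored M' -> edge_ok M' -> Q' rho' M') ->
  wp edge_tables edge_time Q' rho M.
Proof.
move=> bd cx EQ ELL st HQ; have [EN ENN ET] := cx.
have NNX := tables_NX QX; have N_gt0 := tables_N_gt0 NL.
have NX : N <= X by apply: leq_trans NNX; rewrite leq_pmulr.
apply: wp_cat; apply: (wp_set_tm _ X_gt1 fitX (v := N)) => //.
move=> rho1 bd1 E1 k1.
have k01 : keep rk rho rho1 by move=> r r7; rewrite k1 //; lia.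
have qc1 : qctx N L Q rho1.
  by split=> //; [apply: ctx_keep k01 cx | rewrite k1 | rewrite k1].
have [cx1 EQ1 ELL1 Ek1] := qc1.
apply: wp_cat; apply: (wp_table X_gt1 fitX NL QX bd1 qc1 (J := dDist)
  (f := fun x y => encode (d x y))) => //.
- by rewrite ltn_addr //; apply: leq_trans Q_gt5.
- move=> rho' x y xN yN lc; have [Ex Ey Ep Es ED] := local_eval NL M cx1 EQ1 xN yN lc.
  by rewrite ED Ex Ey st.1 // -st.1 //; split=> //; apply: bd.2.
move=> rho2 M2 bd2 k2 H2; have qc2 : qctx N L Q rho2 by apply: qctx_keep k2 qc1.
have st2 : stored M2.
  apply: (stored_frame (J := dDist)) st => // [|j x y _ xN yN /negPf nj].
    by apply: leq_trans Q_gt5.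
  by rewrite H2 // nj.
have d2 x y : x < N -> y < N -> slot M2 dDist x y = encode (d x y).
  by move=> xN yN; rewrite H2.
have Ecand rho' M' p x y : p < N -> x < N -> y < N -> local N rho2 rho' p x y ->
    stored M' -> eval eCand rho' M' = encode (cand x y p).
  move=> pN xN yN lc st'; have [cx2 EQ2 _ _] := qc2.
  have [Ex Ey Ep Es ED] := local_eval NL M' cx2 EQ2 xN yN lc.
  by apply: eval_eoadd; [rewrite Es Ex Ep st'.2 | rewrite ED Ex Ey Ep st'.1].
have candX p x y : p < N -> x < N -> y < N -> encode (cand x y p) <= X.
  move=> pN xN yN; rewrite /cand; case E1': (W x p) => [e|] //=.
  case E2: (dv p y x) => [l|] //=; have := W_le E1'; have := dv_le W_le dvP pN yN xN E2.
  by move: WX; rewrite -addnn mulSn; lia.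
apply: wp_cat; apply: (wp_fold_table X_gt1 fitX NL QX bd2 qc2 (op := nmin)
  (J := dNext) (f := next_val)) => //.
- exact: eval_nmin.
- by apply: leq_trans Q_gt5.
- move=> rho' p x y pN xN yN lc; have [cx2 EQ2 _ _] := qc2.
  have [Ex Ey Ep Es ED] := local_eval NL M2 cx2 EQ2 xN yN lc.
  have Eb := eval_eand (eval_enot (eval_eq Ep Ex)) (eval_eq
    (Ecand _ _ _ _ _ pN xN yN lc st2) (etrans (Es (Cst dDist) eX eY) _)).
  rewrite /eNext (eval_eif _ _ (Eb (encode (d x y)) _)); last by rewrite Ex Ey d2.
  by rewrite /next_val; case: ifP => // _; rewrite (eval_add Ep (erefl _)) addn1.
- move=> j p x y jL pN xN yN; apply: red_table_le nmin_sel _ jL pN => q qN.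
  by rewrite /next_val; case: ifP => // _; apply: leq_trans NX.
move=> rho3 M3 bd3 k3 H3; have qc3 : qctx N L Q rho3 by apply: qctx_keep k3 qc2.
have [cx3 EQ3 ELL3 Ek3] := qc3.
have st3 : stored M3.
  apply: (stored_frame (J := dNext)) st2 => // [|j x y jT xN yN /negPf nj].
    by apply: leq_trans Q_gt5.
  by rewrite H3 // nj.
have T_gt j : j < 6 -> j < T by move=> j6; apply: leq_trans j6 _; rewrite ltn_addr.
have d3 x y : x < N -> y < N -> slot M3 dDist x y = encode (d x y).
  by move=> xN yN; rewrite H3 ?d2 //; apply: T_gt.
have n3 x y : x < N -> y < N -> slot M3 dNext x y = red nmin L (next_val x y) 0.
  by move=> xN yN; rewrite H3 //; apply: T_gt.
have k23 : keep rs rho2 rho3 by [].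
apply: (wp_fold_table X_gt1 fitX NL QX bd3 qc3 (op := nmin) (J := dSecond)
  (f := fun x y => second_val (slot M3 dNext x y) x y)) => //.
- exact: eval_nmin.
- by apply: leq_trans Q_gt5.
- move=> rho' p x y pN xN yN lc.
  have [Ex Ey Ep Es ED] := local_eval NL M3 cx3 EQ3 xN yN lc.
  have Ecd : eval eCand rho' M3 = encode (cand x y p).
    apply: eval_eoadd; first by rewrite Es Ex Ep st3.2.
    by rewrite ED Ex Ey Ep st3.1.
  have Eb := eval_eand (eval_enot (eval_eq Ep Ex)) (eval_enot (eval_eq
    (eval_add Ep (erefl : eval (Cst 1) rho' M3 = 1)) (Es (Cst dNext) eX eY))).
  rewrite /eSecond (eval_eif _ _ Eb) Ex Ey /second_val addn1.
  by case: ifP.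
- move=> j p x y jL pN xN yN; apply: red_table_le nmin_sel _ jL pN => q qN.
  by rewrite /second_val; case: ifP => // _; apply: candX.
move=> rho4 M4 bd4 k4 H4; apply: HQ => //.
- by move=> r r7; rewrite k4 ?k3 ?k2 ?k01 //; lia.
- exact: qctx_keep k4 qc3.
- apply: (stored_frame (J := dSecond)) st3 => // [|j x y jT xN yN /negPf nj].
    by apply: leq_trans Q_gt5.
  by rewrite H4 // nj.
split=> [x y xN yN|u y v uN yN vN uy|u y uN yN].
- by rewrite H4 ?d3 //; apply: T_gt.
- rewrite !H4 /=; try by [|apply: T_gt].
  rewrite d3 // n3 //.
  exact: first_cut_tables.
by rewrite H4 ?n3 ?next_neq //; apply: T_gt.
Qed.

End Phases.

(** * Tables of ranks, logarithms, landmarks and class maxima *)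

Lemma rank_le N d dv (D : avoid_dist N d dv) x y : x < N -> y < N ->
  rank N d dv x y <= N.
Proof.
move=> xN yN; rewrite /rank; case: eqP => // /eqP xy.
rewrite -size_filter -[in X in _ < X](size_iota 0 N).
suff: size (x :: filter (crit d dv x y) (iota 0 N)) <= size (iota 0 N) by [].
apply: uniq_leq_size.
  rewrite /= filter_uniq ?iota_uniq // andbT mem_filter /crit (ad_src D) //.
  by rewrite ole_refl.
by move=> c; rewrite inE mem_filter => /orP[/eqP->|/andP[]]; rewrite ?mem_iota.
Qed.

Section Landmarks.

Variables (N : nat) (d : nat -> nat -> option nat)
  (dv : nat -> nat -> nat -> option nat).
Hypothesis D : avoid_dist N d dv.
Local Notation rank := (rank N d dv).
Local Notation onpath := (onpath N d dv).
Local Notation crit := (crit d dv).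

Lemma onpath_src x y c : x < N -> y < N -> c < N -> onpath x y c ->
  0 < rank c y -> [/\ x != y, c != y & c = x \/ crit x y c].
Proof.
move=> xN yN cN /(onpathP D xN yN cN)[_ [->|->|C]]; last 2 first.
- by rewrite rank_self.
- by have [cx cy xy] := crit_neq D xN yN cN C; split=> //; right.
by case: (eqVneq x y) => [->|xy]; [rewrite rank_self | split=> //; left].
Qed.

Lemma onpath_dst x y c : x < N -> y < N -> c < N -> onpath x y c ->
  0 < rank x c -> [/\ x != y, c != x & c = y \/ crit x y c].
Proof.
move=> xN yN cN /(onpathP D xN yN cN)[_ [->|->|C]].
- by rewrite rank_self.
- case: (eqVneq x y) => [->|xy]; first by rewrite rank_self.
  by split=> //; left.
by have [cx cy xy] := crit_neq D xN yN cN C; split=> //; right.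
Qed.

Lemma onpath_inj_src x y b c : x < N -> y < N -> b < N -> c < N ->
  onpath x y b -> onpath x y c -> 0 < rank b y -> rank b y = rank c y -> b = c.
Proof.
move=> xN yN bN cN ob oc pos E.
have [xy _ Hb] := onpath_src xN yN bN ob pos.
have [|_ _ Hc] := onpath_src xN yN cN oc; first by rewrite -E.
exact: (rank_inj D xN yN bN cN Hb Hc xy E).
Qed.

Lemma onpath_inj_dst x y b c : x < N -> y < N -> b < N -> c < N ->
  onpath x y b -> onpath x y c -> 0 < rank x b -> rank x b = rank x c -> b = c.
Proof.
move=> xN yN bN cN ob oc pos E.
have [xy _ Hb] := onpath_dst xN yN bN ob pos.
have [|_ _ Hc] := onpath_dst xN yN cN oc; first by rewrite -E.
have yx : y != x by rewrite eq_sym.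
apply: (rank_inj (avoid_dist_rev D) yN xN bN cN Hb Hc yx).
by rewrite -(rank_rev N d dv x b) -(rank_rev N d dv x c).
Qed.

End Landmarks.

Lemma sumn_only (f : nat -> nat) s c : uniq s -> c \in s ->
  (forall p, p \in s -> p != c -> f p = 0) -> sumn [seq f p | p <- s] = f c.
Proof.
elim: s => //= a s IHs /andP[a_s us]; rewrite inE => /orP[/eqP->|cs] f0.
  suff -> : sumn [seq f p | p <- s] = 0 by rewrite addn0.
  elim: s a_s f0 {IHs us} => //= b s IHs; rewrite inE negb_or => /andP[ab a_s] f0.
  rewrite f0 ?IHs //; last by rewrite eq_sym.
    by move=> p; rewrite inE => /orP[->|ps] //; apply: f0; rewrite !inE ps !orbT.
  by rewrite !inE eqxx orbT.
rewrite IHs // => [|p ps]; last by apply: f0; rewrite inE ps orbT.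
by rewrite f0 ?mem_head //; apply: contraNneq a_s => ->.
Qed.

Lemma sumn_leq (f : nat -> nat) s K :
  (forall p, p \in s -> f p <= K) -> sumn [seq f p | p <- s] <= size s * K.
Proof.
elim: s => //= a s IHs fK; rewrite mulSn leq_add ?fK ?mem_head ?IHs // => p ps.
by apply: fK; rewrite inE ps orbT.
Qed.

Lemma red_sum_leq N L f K j p : N = 2 ^ L -> j <= L -> p < N ->
  (forall p, p < N -> f p <= K) -> red addn j f p <= N * K.
Proof.
move=> NL jL pN fK; rewrite red_sum.
apply: (@leq_trans (2 ^ j * K)); last by rewrite leq_mul2r NL leq_exp2l // jL orbT.
rewrite -[in X in _ <= X](size_iota (p %/ 2 ^ j * 2 ^ j) (2 ^ j)).
apply: sumn_leq => q; rewrite mem_iota => /andP[q1 q2]; apply: fK.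
rewrite NL in pN *; apply: block_lt jL _ pN.
apply/eqP; rewrite eqn_leq; apply/andP; split; last by rewrite leq_divRL ?pow2_gt0.
by rewrite -ltnS ltn_divLR ?pow2_gt0 // mulSn addnC.
Qed.

Lemma red_sum0 N L f : N = 2 ^ L -> red addn L f 0 = sumn [seq f p | p <- iota 0 N].
Proof. by move=> ->; rewrite red_sum div0n. Qed.

(** Vertex numbers are summed without a shift, so an absent landmark looks like vertex 0; entries
    are used only where a landmark exists. *)
Definition eUpSel : expr :=
  eand (eand eOnpath (Bin OpEq (eRank eP eY) (Var rpw))) eP.
Definition eDownSel : expr :=
  eand (eand eOnpath (Bin OpEq (eRank eX eP) (Var rpw))) eP.
(** The last [i] with [2 ^ i <= rank x y] survives, which is the binary logarithm; the machine has
    no instruction for it. *)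
Definition eLogStep : expr :=
  eif (enot (Bin OpLt (eRank eX eY) (Var rpw))) (Var ri) (eLog eX eY).
Definition eBlock (k : nat) : expr := eadd (Bin OpMul (Var ri) (Cst 4)) (Cst k).

Definition landmark_step : pram_prog :=
  table (Cst dLog) eLogStep ++
  (fold_table eadd (eBlock 6) eUpSel ++
  (fold_table eadd (eBlock 7) eDownSel ++
  (table (eBlock 8) (eD (eslot (eBlock 7) eX eY) eX eY) ++
  (table (eBlock 9) (eD (eslot (eBlock 6) eX eY) eX eY) ++
  (set_reg ri (Bin OpAdd (Var ri) (Cst 1)) ++
  (set_reg rpw (Bin OpAdd (Var rpw) (Var rpw)) ++
   set_reg rit (Bin OpSub (Var rit) (Cst 1)))))))).

Definition landmark_tables : pram_prog :=
  set_reg ri (Cst 0) ++ (set_reg rpw (Cst 1) ++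
  (set_reg rit (Var rLL) ++ [:: Loop rit landmark_step])).

(** Outside the class the entry 1 encodes the distance 0, neutral for maxima; 0 would encode
    infinity and absorb them. *)
Definition eClass : expr :=
  eif (eand eCrit (Bin OpEq (eadd (Bin OpMul (eLog eX eP) (Var rLL)) (eLog eP eY))
                            (Var rt)))
    (eD eP eX eY) (Cst 1).

Definition class_step : pram_prog :=
  set_reg rt (Bin OpSub (Var rt) (Cst 1)) ++
  fold_table eomax (eadd (eadd (Bin OpMul (Var rLL) (Cst 4)) (Cst 6)) (Var rt)) eClass.

Definition class_tables : pram_prog :=
  set_reg rt (Bin OpMul (Var rLL) (Var rLL)) ++ [:: Loop rt class_step].

Section Phases.

Variables (w X N L Q : nat) (W : nat -> nat -> option nat)
  (dv : nat -> nat -> nat -> option nat).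
Hypotheses (X_gt1 : 1 < X) (fitX : X ^ maxdeg < 2 ^ w) (NL : N = 2 ^ L).
Hypothesis QX : (Q + N + N).+2 * (N * N) <= X.
Hypothesis def_Q : Q = 6 + L.+1 * 4 + L.+1 * L.+1.
Hypothesis W_self : forall x, W x x = Some 0.
Hypothesis dvP : forall x y v, x < N -> y < N -> v < N ->
  ismin W (allow (avoid N v)) x y (dv x y v).

Local Notation T := (Q + N).
Local Notation wp := (wp w X (N * (N * N))).
Local Notation slot := (slot N).
Local Notation d := (dist dv).
Local Notation D := (avoid_distP W_self dvP).
Local Notation rank := (rank N d dv).
Local Notation crit := (crit d dv).
Local Notation onpath := (onpath N d dv).

Definition frame (J : nat) (M M' : memory) : Prop :=
  forall j x y, j < T -> x < N -> y < N -> j != J -> slot M' j x y = slot M j x y.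

Definition base (M : memory) : Prop := stored N Q W dv M /\ edge_ok N W dv M.

Lemma base_frame J M M' : 2 < J < Q -> J != dEdge -> frame J M M' -> base M -> base M'.
Proof.
move=> /andP[J2 JQ] J5 fr [st [e1 e2 e3]]; split.
  by apply: (stored_frame _ JQ J5 fr st); rewrite def_Q.
have T_gt j : j < 3 -> j < T by rewrite def_Q; lia.
split=> [x y xN yN|u y v uN yN vN uy|u y uN yN].
- by rewrite fr ?e1 //; [apply: T_gt | rewrite /dDist; lia].
- have := e2 u y v uN yN vN uy.
  by rewrite !fr //; try by [apply: T_gt]; rewrite /dDist /dNext /dSecond; lia.
by rewrite fr ?e3 //; [apply: T_gt | rewrite /dNext; lia].
Qed.

Definition rank_ok (M : memory) : Prop :=
  forall x y, x < N -> y < N -> slot M dRank x y = rank x y.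

Definition rank_time : nat := relax_time L + tm.

Lemma eval_eCrit rho rho' M p x y : qctx N L Q rho -> base M ->
  p < N -> x < N -> y < N -> local N rho rho' p x y ->
  eval eCrit rho' M = crit x y p.
Proof.
move=> [cx EQ _ _] [st [e1 _ _]] pN xN yN lc.
have [Ex Ey Ep Es ED] := local_eval NL M cx EQ xN yN lc.
apply: eval_enot; apply: eval_eole; first by rewrite ED Ep Ex Ey st.1.
by rewrite /eDist Es Ex Ey e1.
Qed.

Lemma wp_rank_table (Q' : registers -> memory -> Prop) rho M :
  bounded X rho M -> qctx N L Q rho -> base M ->
  (forall rho' M', bounded X rho' M' -> keep rs rho rho' -> qctx N L Q rho' ->
     base M' -> rank_ok M' -> Q' rho' M') ->
  wp rank_table rank_time Q' rho M.
Proof.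
move=> bd qc bs HQ; have NNX := tables_NX QX; have N_gt0 := tables_N_gt0 NL.
have NX : N <= X by apply: leq_trans NNX; rewrite leq_pmulr.
have JQ : dRank < Q by rewrite def_Q.
apply: wp_cat; apply: (wp_fold_table X_gt1 fitX NL QX bd qc (op := addn)
  (J := dRank) (f := fun x y p => crit x y p : nat)) => //.
- by move=> rho' p x y pN xN yN lc; apply: eval_eCrit lc.
- move=> j p x y jL pN xN yN; apply: leq_trans NX; rewrite -[N]muln1.
  by apply: red_sum_leq jL pN _ => // q _; case: (crit _ _ _).
move=> rho1 M1 bd1 k1 H1; have qc1 : qctx N L Q rho1 by apply: qctx_keep k1 qc.
have bs1 : base M1.
  apply: (base_frame (J := dRank)) bs => // j x y jT xN yN /negPf nj.
  by rewrite H1 // nj.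
have [cx1 EQ1 _ _] := qc1; have JT : dRank < T by rewrite ltn_addr.
have E1 x y : x < N -> y < N -> slot M1 dRank x y = count (crit x y) (iota 0 N).
  move=> xN yN; rewrite H1 // (red_sum0 _ NL).
  by elim: (iota 0 N) => //= a s ->.
apply: (wp_table X_gt1 fitX NL QX bd1 qc1 (J := dRank) (f := rank)) => //.
- move=> rho' x y xN yN lc; split; last by apply: leq_trans NX; apply: (rank_le D).
  have [Ex Ey Ep Es ED] := local_eval NL M1 cx1 EQ1 xN yN lc.
  rewrite (eval_eif _ _ (eval_eq Ex Ey)) /rank; case: eqP => // _.
  rewrite (eval_add (Es _ _ _) (erefl : eval (Cst 1) rho' M1 = 1)) Ex Ey E1 //.
  by rewrite addn1.
move=> rho2 M2 bd2 k2 H2.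
have k12 : keep rs rho rho2 by apply: keep_trans k1 _; apply: keep_sub k2.
apply: HQ => //; first by apply: qctx_keep k2 qc1.
  apply: (base_frame (J := dRank)) bs1 => // j x y jT xN yN /negPf nj.
  by rewrite H2 // nj.
by move=> x y xN yN; rewrite H2.
Qed.

(** Before the first round the table is arbitrary, hence [0 < i]; afterwards it holds the logarithm
    capped by the last round. *)
Definition log_ok (i : nat) (M : memory) : Prop :=
  forall x y, x < N -> y < N -> x != y -> 0 < i ->
    slot M dLog x y = minn (flog (rank x y)) i.-1.

Definition landmark_ok (M : memory) (i : nat) : Prop :=
  forall x y c, x < N -> y < N -> c < N -> onpath x y c ->
    (rank c y = 2 ^ i -> slot M (i * 4 + 6) x y = c /\
                         slot M (i * 4 + 9) x y = encode (dv x y c)) /\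
    (rank x c = 2 ^ i -> slot M (i * 4 + 7) x y = c /\
                         slot M (i * 4 + 8) x y = encode (dv x y c)).

Definition landmark_step_time : nat :=
  tm + (relax_time L + (relax_time L + (tm + (tm + (tm + (tm + tm)))))).

Lemma eval_eOnpath rho rho' M p x y : qctx N L Q rho -> base M -> rank_ok M ->
  p < N -> x < N -> y < N -> local N rho rho' p x y ->
  eval eOnpath rho' M = onpath x y p.
Proof.
move=> [cx EQ _ _] [st [e1 _ _]] rk_ok pN xN yN lc.
have [Ex Ey Ep Es ED] := local_eval NL M cx EQ xN yN lc.
have Ed a b va vb : eval a rho' M = va -> eval b rho' M = vb -> va < N -> vb < N ->
    eval (eDist a b) rho' M = encode (d va vb).
  by move=> Ea Eb aN bN; rewrite /eDist Es Ea Eb e1.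
have Er a b va vb : eval a rho' M = va -> eval b rho' M = vb -> va < N -> vb < N ->
    eval (eRank a b) rho' M = rank va vb.
  by move=> Ea Eb aN bN; rewrite /eRank Es Ea Eb rk_ok.
rewrite /onpath; apply: eval_eand.
  rewrite (eval_lt (erefl : eval (Cst 0) rho' M = 0) (Ed _ _ _ _ Ex Ey xN yN)).
  by case: (d x y).
apply: eval_eand.
  rewrite (eval_eq (Ed _ _ _ _ Ex Ey xN yN)
    (eval_eoadd (Ed _ _ _ _ Ex Ep xN pN) (Ed _ _ _ _ Ep Ey pN yN))).
  by rewrite (can_eq encodeK).
by rewrite (eval_eq (Er _ _ _ _ Ex Ey xN yN)
  (eval_add (Er _ _ _ _ Ex Ep xN pN) (Er _ _ _ _ Ep Ey pN yN))).
Qed.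

(* A sum with a single non-zero term extracts the landmark. *)
Lemma red_select (P : nat -> bool) c : c < N -> P c ->
  (forall p, p < N -> P p -> p = c) -> red addn L (fun p => P p * p) 0 = c.
Proof.
move=> cN Pc uniq_c; rewrite (red_sum0 _ NL) (sumn_only (c := c)) ?iota_uniq //.
- by rewrite Pc mul1n.
- by rewrite mem_iota.
move=> p; rewrite mem_iota => /= pN pc; case Pp: (P p) => //.
by rewrite (uniq_c p pN Pp) eqxx in pc.
Qed.

Lemma wp_landmark_step i (Q' : registers -> memory -> Prop) rho M :
  bounded X rho M -> qctx N L Q rho -> rho ri = i -> rho rpw = 2 ^ i ->
  rho rit = L.+1 - i -> i < L.+1 -> base M -> rank_ok M -> log_ok i M ->
  (forall i', i' < i -> landmark_ok M i') ->
  (forall rho' M', bounded X rho' M' -> keep rit rho rho' -> rho' ri = i.+1 ->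
     rho' rpw = 2 ^ i.+1 -> rho' rit = L.+1 - i.+1 -> base M' -> rank_ok M' ->
     log_ok i.+1 M' -> (forall i', i' < i.+1 -> landmark_ok M' i') -> Q' rho' M') ->
  wp landmark_step landmark_step_time Q' rho M.
Proof.
move=> bd qc Ei Epw Eit iL bs rk_ok lg_ok lm_ok HQ.
have NNX := tables_NX QX; have N_gt0 := tables_N_gt0 NL.
have NX : N <= X by apply: leq_trans NNX; rewrite leq_pmulr.
have pw_gt0 := pow2_gt0 i.
have iQ k : k < 10 -> i * 4 + k < Q by move=> k10; rewrite def_Q; lia.
have LX : L.+1 <= X by apply: leq_trans NX; rewrite NL ltn_expl.
have T_lt j : j < Q -> j < T by move=> jQ; rewrite ltn_addr.
have keep_base J M1 M2 : 4 <= J < Q -> J != dEdge -> frame J M1 M2 ->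
    base M1 /\ rank_ok M1 -> base M2 /\ rank_ok M2.
  move=> /andP[J4 JQ] J5 fr [b1 r1]; split.
    by apply: base_frame fr b1 => //; rewrite JQ andbT; apply: ltnW.
  move=> x y xN yN; rewrite fr ?r1 //; first by apply: T_lt; rewrite def_Q.
  by rewrite /dRank; lia.
have Eblock k rho' M' : rho' ri = i -> eval (eBlock k) rho' M' = i * 4 + k.
  by move=> E; rewrite /= E.
have [cx EQ ELL Ek] := qc.
apply: wp_cat; apply: (wp_table X_gt1 fitX NL QX bd qc (J := dLog)
  (f := fun x y => if 2 ^ i <= rank x y then i else slot M dLog x y)) => //.
- by apply: T_lt; rewrite def_Q.
- move=> rho' x y xN yN lc.
  have [Ex Ey Ep Es ED] := local_eval NL M cx EQ xN yN lc.
  have Er : eval (eRank eX eY) rho' M = rank x y by rewrite /eRank Es Ex Ey rk_ok.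
  have Epw' : eval (Var rpw) rho' M = 2 ^ i by rewrite /= lc.2.
  rewrite /eLogStep (eval_eif _ _ (eval_enot (eval_lt Er Epw'))) -leqNgt.
  split; first by case: ifP; rewrite ?/eLog ?Es ?Ex ?Ey //= lc.2.
  by case: ifP => _; [apply: leq_trans LX; apply: ltnW | apply: bd.2].
move=> rho1 M1 bd1 k1 H1; have qc1 : qctx N L Q rho1 by apply: qctx_keep k1 qc.
have fr1 : frame dLog M M1 by move=> j x y jT xN yN /negPf nj; rewrite H1 // nj.
have [bs1 rk1] : base M1 /\ rank_ok M1.
  by apply: keep_base fr1 _ => //; rewrite def_Q.
have lg1 : log_ok i.+1 M1.
  move=> x y xN yN xy _; rewrite H1 //=.
  have /flogP/andP[f1 f2] := rank_gt0 N d dv xy.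
  case: (leqP (2 ^ i) (rank x y)) => h.
    have : i <= flog (rank x y).
      by rewrite -ltnS -(ltn_exp2l (m := 2)) //; apply: leq_ltn_trans f2.
    by lia.
  have h2 : flog (rank x y) < i.
    by rewrite -(ltn_exp2l (m := 2)) //; apply: leq_ltn_trans h.
  by rewrite lg_ok //; lia.
have [cx1 EQ1 _ _] := qc1.
pose selU x y p := onpath x y p && (rank p y == 2 ^ i).
pose selD x y p := onpath x y p && (rank x p == 2 ^ i).
have sumX (P : nat -> nat -> nat -> bool) j p x y : j <= L -> p < N -> x < N -> y < N ->
    red addn j (fun p => P x y p * p) p <= X.
  move=> jL pN xN yN; apply: leq_trans NNX; apply: red_sum_leq jL pN _ => // q qN.
  by case: (P x y q); rewrite ?mul1n ?mul0n // ltnW.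
apply: wp_cat; apply: (wp_fold_table X_gt1 fitX NL QX bd1 qc1 (op := addn)
  (J := i * 4 + 6) (f := fun x y p => selU x y p * p)) => //.
- exact: iQ.
- by move=> rho' M' k; apply: Eblock; rewrite k // k1.
- move=> rho' p x y pN xN yN lc.
  have [Ex Ey Ep Es ED] := local_eval NL M1 cx1 EQ1 xN yN lc.
  have Er : eval (eRank eP eY) rho' M1 = rank p y by rewrite /eRank Es Ep Ey rk1.
  have Epw' : eval (Var rpw) rho' M1 = 2 ^ i by rewrite /= lc.2 // k1.
  have Eo := eval_eOnpath qc1 bs1 rk1 pN xN yN lc.
  exact: (eval_mul (eval_eand Eo (eval_eq Er Epw')) Ep).
- by move=> j p x y; apply: (sumX selU).
move=> rho2 M2 bd2 k2 H2; have qc2 : qctx N L Q rho2 by apply: qctx_keep k2 qc1.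
have fr2 : frame (i * 4 + 6) M1 M2.
  by move=> j x y jT xN yN /negPf nj; rewrite H2 // nj.
have k12 : keep rs rho rho2 by apply: keep_trans k2; apply: keep_sub k1.
have [bs2 rk2] : base M2 /\ rank_ok M2.
  by apply: keep_base fr2 _ => //; rewrite ?iQ ?andbT // /dEdge; lia.
have [cx2 EQ2 _ _] := qc2.
apply: wp_cat; apply: (wp_fold_table X_gt1 fitX NL QX bd2 qc2 (op := addn)
  (J := i * 4 + 7) (f := fun x y p => selD x y p * p)) => //.
- exact: iQ.
- by move=> rho' M' k; apply: Eblock; rewrite k // k12.
- move=> rho' p x y pN xN yN lc.
  have [Ex Ey Ep Es ED] := local_eval NL M2 cx2 EQ2 xN yN lc.
  have Er : eval (eRank eX eP) rho' M2 = rank x p by rewrite /eRank Es Ep Ex rk2.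
  have Epw' : eval (Var rpw) rho' M2 = 2 ^ i by rewrite /= lc.2 // k12.
  have Eo := eval_eOnpath qc2 bs2 rk2 pN xN yN lc.
  exact: (eval_mul (eval_eand Eo (eval_eq Er Epw')) Ep).
- by move=> j p x y; apply: (sumX selD).
move=> rho3 M3 bd3 k3 H3; have qc3 : qctx N L Q rho3 by apply: qctx_keep k3 qc2.
have fr3 : frame (i * 4 + 7) M2 M3.
  by move=> j x y jT xN yN /negPf nj; rewrite H3 // nj.
have k13 : keep rs rho rho3 by apply: keep_trans k3.
have [bs3 rk3] : base M3 /\ rank_ok M3.
  by apply: keep_base fr3 _ => //; rewrite ?iQ ?andbT // /dEdge; lia.
have [cx3 EQ3 _ _] := qc3.
have table_step k1' k2' rho4 M4 (Q2 : registers -> memory -> Prop) :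
    k1' < 10 -> k2' < 10 -> 5 < k1' ->
    slot_map_ok (eBlock k1') (Cst 1) (eD (eslot (eBlock k2') eX eY) eX eY) ->
    bounded X rho4 M4 -> keep rs rho rho4 -> base M4 -> rank_ok M4 ->
    (forall rho' M', bounded X rho' M' -> keep rs rho rho' -> base M' -> rank_ok M' ->
       frame (i * 4 + k1') M4 M' ->
       (forall x y, x < N -> y < N -> slot M' (i * 4 + k1') x y =
          slot M4 (Q + slot M4 (i * 4 + k2') x y) x y) -> Q2 rho' M') ->
    wp (table (eBlock k1') (eD (eslot (eBlock k2') eX eY) eX eY)) tm Q2 rho4 M4.
  move=> k1_lt k2_lt k1_gt ok4 bd4 k4 bs4 rk4 HQ2.
  have qc4 : qctx N L Q rho4 by apply: qctx_keep k4 qc.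
  have [cx4 EQ4 _ _] := qc4.
  apply: (wp_table X_gt1 fitX NL QX bd4 qc4 (J := i * 4 + k1')
    (f := fun x y => slot M4 (Q + slot M4 (i * 4 + k2') x y) x y)) => //.
  - by apply: T_lt; apply: iQ.
  - by move=> rho' k; apply: Eblock; rewrite k // k4.
  (* Where no landmark exists some irrelevant cell is copied; only its bound matters. *)
  - move=> rho' x y xN yN lc; split; last exact: bd4.2.
    have [Ex Ey Ep Es ED] := local_eval NL M4 cx4 EQ4 xN yN lc.
    by rewrite ED Es Ex Ey Eblock // lc.2 // k4.
  move=> rho' M' bd' k' H'.
  have fr' : frame (i * 4 + k1') M4 M'.
    by move=> j x y jT xN yN /negPf nj; rewrite H' // nj.
  have [bs' rk'] : base M' /\ rank_ok M'.
    apply: keep_base fr' _ => //; last by rewrite /dEdge; lia.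
    by rewrite iQ // andbT; lia.
  apply: HQ2 => //; first by apply: keep_trans k4 _; apply: keep_sub k'.
  by move=> x y xN yN; rewrite H' // eqxx.
apply: wp_cat; apply: (table_step 8 7 rho3 M3) => //.
move=> rho4 M4 bd4 k14 bs4 rk4 fr4 E4.
apply: wp_cat; apply: (table_step 9 6 rho4 M4) => //.
move=> rho5 M5 bd5 k15 bs5 rk5 fr5 E5.
have N2X : N + N <= X.
  by apply: leq_trans QX; have := leq_mul (leqnn 2) (leq_pmulr N N_gt0); nia.
apply: wp_cat; apply: (wp_set_tm _ X_gt1 fitX (v := i.+1)) => //.
- by rewrite /= k15 // Ei addn1.
- exact: leq_trans LX.
move=> rho6 bd6 E6 k6.
apply: wp_cat; apply: (wp_set_tm _ X_gt1 fitX (v := 2 ^ i.+1)) => //.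
- by rewrite /= k6 // k15 // Epw expnS mul2n addnn.
- apply: leq_trans N2X; rewrite addnn -mul2n NL -expnS leq_exp2l //.
move=> rho7 bd7 E7 k7.
apply: (wp_set_tm _ X_gt1 fitX (v := L.+1 - i.+1)) => //.
- by rewrite /= k7 // k6 // k15 // Eit; lia.
- by apply: leq_trans LX; lia.
move=> rho8 bd8 E8 k8; apply: HQ => //.
- by move=> r r8; rewrite k8 ?k7 ?k6 ?k15 //; lia.
- by rewrite k8 // k7.
- by rewrite k8.
- move=> x y xN yN xy i_gt0; rewrite -(lg1 x y) //.
  by rewrite fr5 ?fr4 ?fr3 ?fr2 //; try by [apply: T_lt; rewrite def_Q]; rewrite /dLog; lia.
move=> i' i'i; have [lt|ge] := ltnP i' i.
  have same k x y : 6 <= k < 10 -> x < N -> y < N ->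
      slot M5 (i' * 4 + k) x y = slot M (i' * 4 + k) x y.
    move=> k_in xN yN; have jT : i' * 4 + k < T by apply: T_lt; rewrite def_Q; lia.
    by rewrite fr5 ?fr4 ?fr3 ?fr2 ?fr1 // /dLog; lia.
  by move=> x y c xN yN cN oc; rewrite !same //; apply: lm_ok.
have -> : i' = i by lia.
move=> x y c xN yN cN oc; have iT k : k < 10 -> i * 4 + k < T.
  by move=> k10; apply: T_lt; apply: iQ.
split=> rc.
  have S2 : slot M2 (i * 4 + 6) x y = c.
    rewrite H2 ?eqxx ?iT //; apply: red_select => //; first by rewrite /selU oc rc eqxx.
    move=> p pN /andP[op /eqP rp]; apply: (onpath_inj_src D) op oc _ _ => //.
      by rewrite rp.
    by rewrite rp rc.
  have S4 : slot M4 (i * 4 + 6) x y = c.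
    by rewrite fr4 ?fr3 ?S2 ?iT //; lia.
  by rewrite fr5 ?iT ?S4 ?E5 ?S4 ?bs4.1.1 //; lia.
have S3 : slot M3 (i * 4 + 7) x y = c.
  rewrite H3 ?eqxx ?iT //; apply: red_select => //; first by rewrite /selD oc rc eqxx.
  move=> p pN /andP[op /eqP rp]; apply: (onpath_inj_dst D) op oc _ _ => //.
    by rewrite rp.
  by rewrite rp rc.
split; first by rewrite fr5 ?fr4 ?iT ?S3 //; lia.
by rewrite fr5 ?iT ?E4 ?S3 ?bs3.1.1 //; lia.
Qed.

Definition landmark_time : nat :=
  tm + (tm + (tm + (L.+1 * landmark_step_time.+1).+1)).

Definition full_log_ok (M : memory) : Prop := forall x y, x < N -> y < N -> x != y ->
  slot M dLog x y = flog (rank x y).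

Lemma flog_rank_le x y : x < N -> y < N -> flog (rank x y) <= L.
Proof.
move=> xN yN; case: (posnP (rank x y)) => [->//|r_gt0].
have /andP[h _] := flogP r_gt0.
by rewrite -(leq_exp2l (m := 2)) // -NL; apply: leq_trans h (rank_le D xN yN).
Qed.

Lemma wp_landmark_tables (Q' : registers -> memory -> Prop) rho M :
  bounded X rho M -> qctx N L Q rho -> base M -> rank_ok M ->
  (forall rho' M', bounded X rho' M' -> keep rit rho rho' ->
     base M' -> rank_ok M' -> full_log_ok M' ->
     (forall i, i < L.+1 -> landmark_ok M' i) -> Q' rho' M') ->
  wp landmark_tables landmark_time Q' rho M.
Proof.
move=> bd qc bs rk_ok HQ; have [cx EQ ELL Ek] := qc.
have NNX := tables_NX QX; have N_gt0 := tables_N_gt0 NL.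
have NX : N <= X by apply: leq_trans NNX; rewrite leq_pmulr.
have LX : L.+1 <= X by apply: leq_trans NX; rewrite NL ltn_expl.
apply: wp_cat; apply: (wp_set_tm _ X_gt1 fitX (v := 0)) => // rho1 bd1 E1 k1.
apply: wp_cat; apply: (wp_set_tm _ X_gt1 fitX (v := 1)) => // [|rho2 bd2 E2 k2].
  exact: ltnW.
apply: wp_cat; apply: (wp_set_tm _ X_gt1 fitX (v := L.+1)) => // [|rho3 bd3 E3 k3].
  by rewrite /= k2 // k1.
pose I i rho' M' := [/\ keep rit rho rho' /\ rho' ri = i, rho' rpw = 2 ^ i,
  rho' rit = L.+1 - i /\ base M', rank_ok M' /\ log_ok i M' &
  forall i', i' < i -> landmark_ok M' i'].
apply: (wp_loop (I := I) (t := landmark_step_time) (m := L.+1)) => //.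
- split; [split | | split | split |] => //.
  + by move=> r r8; rewrite k3 ?k2 ?k1 //; lia.
  + by rewrite k3 // k2.
  + by rewrite k3.
- move=> i rho4 M4 iL bd4 [[k4 Ei] Epw [Eit bs4] [rk4 lg4] lm4].
  split; first by rewrite Eit -lt0n subn_gt0.
  have qc4 : qctx N L Q rho4 by apply: qctx_keep k4 qc.
  apply: (wp_landmark_step bd4 qc4 Ei Epw Eit iL bs4 rk4 lg4 lm4).
  move=> rho5 M5 bd5 k5 Ei5 Epw5 Eit5 bs5 rk5 lg5 lm5; split=> //.
  by split=> //; apply: keep_trans k4 k5.
move=> rho4 M4 bd4 [[k4 Ei] Epw [Eit bs4] [rk4 lg4] lm4].
split; first by rewrite Eit subnn.
apply: HQ => // x y xN yN xy; rewrite lg4 //=.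
by apply/minn_idPl; apply: flog_rank_le.
Qed.

Definition class_ok (M : memory) (t : nat) : Prop :=
  forall x y i j, x < N -> y < N -> i < L.+1 -> j < L.+1 -> t = i * L.+1 + j ->
    let m := decode (slot M (L.+1 * 4 + 6 + t) x y) in
    (forall b, b < N -> same_class N d dv x y i j b -> ole (dv x y b) m) /\
    ((exists2 b, b < N & same_class N d dv x y i j b) ->
     exists b, [/\ b < N, same_class N d dv x y i j b & m = dv x y b]).

Definition class_time : nat :=
  tm + (L.+1 * L.+1 * (tm + relax_time L).+1).+1.

Definition class_val (t x y p : nat) : nat :=
  if crit x y p && (flog (rank x p) * L.+1 + flog (rank p y) == t)
  then encode (dv x y p) else 1.

Lemma class_val_ok M t :
  (forall x y, x < N -> y < N ->
    slot M (L.+1 * 4 + 6 + t) x y = red nmax L (class_val t x y) 0) ->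
  class_ok M t.
Proof.
move=> E x y i j xN yN iL jL def_t; rewrite E //=.
have in0 p : p < N -> p %/ 2 ^ L = 0 %/ 2 ^ L by rewrite NL => pN; apply/block0.
have ub b : b < N -> same_class N d dv x y i j b ->
    ole (dv x y b) (decode (red nmax L (class_val t x y) 0)).
  move=> bN /and3P[C /eqP ib /eqP jb].
  have := red_nmax_ge (class_val t x y) (in0 b bN).
  by rewrite {1}/class_val C ib jb -def_t eqxx encodeK.
split=> // -[b bN Cb].
have [p /block0 pN Ep] := red_attained L (class_val t x y) 0 nmax_sel.
rewrite -NL in pN; have := ub b bN Cb; rewrite Ep /class_val.
case: ifP => [/andP[C /eqP Et] _|_ le0].
  exists p; rewrite encodeK; split=> //; rewrite /same_class C /=.
  (* Both logarithms are below [L.+1], so remainder and quotient recover them from [t]. *)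
  have fL := flog_rank_le pN yN; rewrite -ltnS in fL.
  have := congr1 (modn^~ L.+1) Et; rewrite def_t !modnMDl !modn_small // => ->.
  have := congr1 (divn^~ L.+1) Et; rewrite def_t !divnMDl // !divn_small // !addn0 => ->.
  by rewrite !eqxx.
(* The maximum is the default distance 0, so [dv x y b] is 0 too and [b] attains it. *)
exists b; split=> //; apply: ole_anti; last exact: le0.
by case: (dv x y b).
Qed.

Lemma wp_class_tables (Q' : registers -> memory -> Prop) rho M :
  bounded X rho M -> qctx N L Q rho -> base M -> rank_ok M -> full_log_ok M ->
  (forall i, i < L.+1 -> landmark_ok M i) ->
  (forall rho' M', bounded X rho' M' -> keep rk rho rho' ->
     base M' -> rank_ok M' -> full_log_ok M' ->
     (forall i, i < L.+1 -> landmark_ok M' i) ->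
     (forall t, t < L.+1 * L.+1 -> class_ok M' t) -> Q' rho' M') ->
  wp class_tables class_time Q' rho M.
Proof.
move=> bd qc bs rk_ok lg_ok lm_ok HQ; have [cx EQ ELL Ek] := qc.
have NNX := tables_NX QX; have N_gt0 := tables_N_gt0 NL.
have LLX : L.+1 * L.+1 <= X.
  by apply: leq_trans NNX; apply: leq_mul; rewrite NL ltn_expl.
apply: wp_cat; apply: (wp_set_tm _ X_gt1 fitX (v := L.+1 * L.+1)) => //.
  by rewrite /= ELL.
move=> rho1 bd1 E1 k1; set K := L.+1 * L.+1 in E1 *.
have lt6 k : k < 6 -> k < L.+1 * 4 + 6 by lia.
have frame_all M' : stored N Q W dv M' ->
   (forall i x y, i < L.+1 * 4 + 6 -> x < N -> y < N -> slot M' i x y = slot M i x y) ->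
   [/\ base M', rank_ok M', full_log_ok M' & forall i, i < L.+1 -> landmark_ok M' i].
  move=> st' fr; split.
  - split=> //; have [_ [e1 e2 e3]] := bs.
    split=> [x y xN yN|u y v uN yN vN uy|u y uN yN]; rewrite !fr ?lt6 //.
    + exact: e1.
    + exact: e2.
    exact: e3.
  - by move=> x y xN yN; rewrite fr ?lt6 // rk_ok.
  - by move=> x y xN yN xy; rewrite fr ?lt6 // lg_ok.
  move=> i iL x y c xN yN cN oc; rewrite !fr //; try lia.
  exact: lm_ok.
have stored_all M' : (forall i x y, i < T -> x < N -> y < N ->
    ~~ (L.+1 * 4 + 6 <= i < Q) -> slot M' i x y = slot M i x y) -> stored N Q W dv M'.
  move=> fr; have [[st1 st2] _] := bs; split=> [x y v xN yN vN|x y xN yN].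
    by rewrite fr ?st1 ?ltn_add2l //; lia.
  by rewrite fr ?st2 // /dEdge def_Q; lia.
pose J j rho' M' := [/\ keep rt rho rho', rho' rt = K - j,
  forall t, K - j <= t < K -> class_ok M' t &
  forall i x y, i < T -> x < N -> y < N ->
    ~~ (L.+1 * 4 + 6 <= i < Q) -> slot M' i x y = slot M i x y].
have low j rho' M' : J j rho' M' -> forall i x y, i < L.+1 * 4 + 6 -> x < N -> y < N ->
    slot M' i x y = slot M i x y.
  by move=> [_ _ _ fr] i x y iL xN yN; apply: fr => //; rewrite ?def_Q; lia.
apply: (wp_loop (I := J) (t := tm + relax_time L) (m := K)) => //.
- by split=> //; [move=> r r11; rewrite k1 //; lia | move=> t; lia].
- move=> j rho2 M2 jK bd2 J2; have lo2 := low _ _ _ J2; case: J2 => k2 E2 C2 fr2.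
  have [bs2 rk2 lg2 _] := frame_all M2 (stored_all M2 fr2) lo2.
  split; first by rewrite E2 -lt0n subn_gt0.
  have [t def_t] : exists t, t = K - j.+1 by exists (K - j.+1).
  have tK : t < K by lia.
  apply: wp_cat; apply: (wp_set_tm _ X_gt1 fitX (v := t)) => //.
  + by rewrite /= E2; lia.
  + by apply: leq_trans LLX; apply: ltnW.
  move=> rho3 bd3 E3 k3.
  have k03 : keep rt rho rho3 by move=> r r11; rewrite k3 ?k2 //; lia.
  have qc3 : qctx N L Q rho3 by apply: qctx_keep k03 qc.
  have [cx3 EQ3 ELL3 _] := qc3.
  apply: (wp_fold_table X_gt1 fitX NL QX bd3 qc3 (op := nmax)
    (J := L.+1 * 4 + 6 + t) (f := class_val t)) => //.
  + exact: eval_nmax.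
  + by rewrite def_Q -/K; lia.
  + by move=> rho' M' k; rewrite /= !k // ELL3 E3.
  + move=> rho' p x y pN xN yN lc.
    have [Ex Ey Ep Es ED] := local_eval NL M2 cx3 EQ3 xN yN lc.
    have Ec := eval_eCrit qc3 bs2 pN xN yN lc.
    have El1 : eval (eLog eX eP) rho' M2 = slot M2 dLog x p by rewrite /eLog Es Ex Ep.
    have El2 : eval (eLog eP eY) rho' M2 = slot M2 dLog p y by rewrite /eLog Es Ep Ey.
    have ELL' : eval (Var rLL) rho' M2 = L.+1 by rewrite /= lc.2.
    have Et : eval (Var rt) rho' M2 = t by rewrite /= lc.2.
    have Eb := eval_eand Ec (eval_eq (eval_add (eval_mul El1 ELL') El2) Et).
    rewrite /eClass (eval_eif _ _ Eb) ED Ex Ey Ep bs2.1.1 // /class_val.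
    case C: (crit x y p) => //=; have [px py _] := crit_neq D xN yN pN C.
    by rewrite !lg2 // eq_sym.
  + move=> i p x y iL pN xN yN; apply: (red_table_le NL) nmax_sel _ iL pN => q qN.
    rewrite /class_val; case: ifP => _; last exact: ltnW.
    by rewrite -bs2.1.1 //; apply: bd2.2.
  move=> rho4 M4 bd4 k4 H4; split.
  + by move=> r r11; rewrite k4 ?k03 //; lia.
  + by rewrite k4 // E3.
  + move=> t' t'_in; case: (eqVneq t' t) => [->|t't].
      apply: class_val_ok => x y xN yN; rewrite H4 ?eqxx //.
      by rewrite ltn_addr // def_Q -/K; lia.
    have C' := C2 t' ltac:(lia).
    move=> x y i i' xN yN iL i'L Et'; rewrite H4 //; last first.
      by rewrite ltn_addr // def_Q -/K; lia.
    have -> : (L.+1 * 4 + 6 + t' == L.+1 * 4 + 6 + t) = false by lia.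
    exact: C' Et'.
  move=> i x y iT xN yN ni; rewrite H4 //.
  have -> : (i == L.+1 * 4 + 6 + t) = false.
    by apply: contraNF ni => /eqP->; rewrite def_Q -/K; lia.
  exact: fr2.
move=> rho2 M2 bd2 J2; have lo2 := low _ _ _ J2; case: J2 => k2 E2 C2 fr2.
split; first by rewrite E2 subnn.
have [bs2 rk2 lg2 lm2] := frame_all M2 (stored_all M2 fr2) lo2.
apply: HQ => //; first by apply: keep_sub k2.
by move=> t tK; apply: C2; rewrite subnn.
Qed.

End Phases.

(** * Queries *)

(** A query has only its four arguments in registers; preprocessing leaves [N] and [L.+1] in cells 0
    and 1. *)
Definition qN : expr := Get (Cst 0).
Definition qLL : expr := Get (Cst 1).

Definition qslot (j a b : expr) : expr :=
  Get (Bin OpAdd (Bin OpAdd (Bin OpMul (Bin OpAdd j (Cst 2)) (Bin OpMul qN qN))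
                            (Bin OpMul a qN)) b).

Definition qx : expr := Var 0.
Definition qy : expr := Var 1.
Definition qu : expr := Var 2.
Definition qv : expr := Var 3.

Definition qdist : expr -> expr -> expr := qslot (Cst dDist).
Definition qrank : expr -> expr -> expr := qslot (Cst dRank).
Definition qblock (i : expr) (k : nat) : expr -> expr -> expr :=
  qslot (eadd (Bin OpMul i (Cst 4)) (Cst k)).
Definition qi : expr := qslot (Cst dLog) qx qu.
Definition qj : expr := qslot (Cst dLog) qu qy.
Definition qx' : expr := qblock qi 6 qx qu.
Definition qy' : expr := qblock qj 7 qu qy.

Definition qavoid : expr :=
  eomin (eoadd (qdist qx qx') (qblock qi 8 qx' qy))
    (eomin (eoadd (qblock qj 9 qx qy') (qdist qy' qy))
      (qslot (eadd (eadd (Bin OpMul qLL (Cst 4)) (Cst 6)) (eadd (Bin OpMul qi qLL) qj))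
        qx qy)).

Definition qonpath : expr :=
  eand (epos (qdist qx qy))
    (eand (Bin OpEq (qdist qx qy) (eoadd (qdist qx qu) (qdist qu qy)))
          (Bin OpEq (qrank qx qy) (eadd (qrank qx qu) (qrank qu qy)))).

Definition qfirst : expr :=
  eif (Bin OpEq (eadd qv (Cst 1)) (qslot (Cst dNext) qu qy))
    (qslot (Cst dSecond) qu qy) (qdist qu qy).

(** All alternatives are evaluated. If [u] is not critical, [qavoid] may read meaningless cells, but
    the bound [X] on all cells keeps its value within a word. *)
Definition equery : expr :=
  eif (Bin OpEq qu qy) (qdist qx qy)
    (eif (Bin OpEq qu qx) qfirst
      (eomin (eif qonpath qavoid (qdist qx qy)) (eoadd (qdist qx qu) qfirst))).

Lemma fits_equery : fits equery.
Proof. by vm_compute. Qed.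

Section Oracle.

Variables (N L Q : nat) (W : nat -> nat -> option nat)
  (dv : nat -> nat -> nat -> option nat).

Local Notation slot := (slot N).
Local Notation d := (dist dv).
Local Notation rank := (rank N d dv).
Local Notation crit := (crit d dv).
Local Notation onpath := (onpath N d dv).

Definition oracle (M : memory) : Prop :=
  [/\ edge_ok N W dv M, rank_ok N dv M, full_log_ok N dv M,
      forall i, i < L.+1 -> landmark_ok N dv M i &
      forall t, t < L.+1 * L.+1 -> class_ok N L dv M t].

Hypothesis def_Q : Q = 6 + L.+1 * 4 + L.+1 * L.+1.

(** Everything a query relies on lies in the tables below [Q], so the cubic tables [D] and [T] can
    be truncated away. *)
Lemma oracle_frame M M' :
  (forall j x y, j < Q -> x < N -> y < N -> slot M' j x y = slot M j x y) ->
  oracle M -> oracle M'.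
Proof.
have lt6 k : k < 6 -> k < Q by rewrite def_Q; lia.
move=> fr [[e1 e2 e3] r l lm cl]; split.
- split=> [x y xN yN|u y v uN yN vN uy|u y uN yN]; rewrite !fr ?lt6 //.
  + exact: e1.
  + exact: e2.
  exact: e3.
- by move=> x y xN yN; rewrite fr ?lt6 // r.
- by move=> x y xN yN xy; rewrite fr ?lt6 // l.
- move=> i iL x y c xN yN cN oc.
  by rewrite !fr //; try (rewrite def_Q; lia); apply: lm.
move=> t tL x y i j xN yN iL jL Et.
by rewrite fr //; [apply: cl | rewrite def_Q; lia].
Qed.

Hypothesis NL : N = 2 ^ L.
Hypothesis W_self : forall x, W x x = Some 0.
Hypothesis dvP : forall x y v, x < N -> y < N -> v < N ->
  ismin W (allow (avoid N v)) x y (dv x y v).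
Local Notation D := (avoid_distP W_self dvP).

Variables (M : memory) (x y u v : nat) (rho : registers).
Hypotheses (orM : oracle M) (MN : M 0 = N) (MLL : M 1 = L.+1).
Hypotheses (xN : x < N) (yN : y < N) (uN : u < N) (vN : v < N).
Hypotheses (Ex : eval qx rho M = x) (Ey : eval qy rho M = y).
Hypotheses (Eu : eval qu rho M = u) (Ev : eval qv rho M = v).

Local Notation ev e := (eval e rho M).

Lemma eval_qslot j a b vj va vb : ev j = vj -> ev a = va -> ev b = vb ->
  ev (qslot j a b) = slot M vj va vb.
Proof. by move=> /= -> -> ->; rewrite MN addn2. Qed.

Lemma eval_qdist a b va vb : ev a = va -> ev b = vb -> va < N -> vb < N ->
  ev (qdist a b) = encode (d va vb).
Proof.
move=> Ea Eb aN bN; rewrite /qdist (eval_qslot (erefl _) Ea Eb).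
by case: orM => [[-> //]].
Qed.

Lemma eval_qrank a b va vb : ev a = va -> ev b = vb -> va < N -> vb < N ->
  ev (qrank a b) = rank va vb.
Proof.
move=> Ea Eb aN bN; rewrite /qrank (eval_qslot (erefl _) Ea Eb).
by case: orM => _ ->.
Qed.

Lemma eval_qblock e i k a b va vb : ev e = i -> ev a = va -> ev b = vb ->
  ev (qblock e k a b) = slot M (i * 4 + k) va vb.
Proof. by move=> Ei Ea Eb; apply: eval_qslot => //=; rewrite Ei. Qed.

Lemma eval_qonpath : ev qonpath = onpath x y u.
Proof.
have Exy := eval_qdist Ex Ey xN yN; have Exu := eval_qdist Ex Eu xN uN.
have Euy := eval_qdist Eu Ey uN yN.
rewrite /onpath; apply: eval_eand.
  by rewrite (eval_lt (erefl : ev (Cst 0) = 0) Exy); case: (d x y).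
apply: eval_eand.
  by rewrite (eval_eq Exy (eval_eoadd Exu Euy)) (can_eq encodeK).
have Rxy := eval_qrank Ex Ey xN yN; have Rxu := eval_qrank Ex Eu xN uN.
have Ruy := eval_qrank Eu Ey uN yN.
by rewrite (eval_eq Rxy (eval_add Rxu Ruy)).
Qed.

Lemma eval_qavoid : crit x y u -> ev qavoid = encode (dv x y u).
Proof.
move=> C; have [_ _ lg_ok lm_ok cl_ok] := orM.
have [ux uy xy] := crit_neq D xN yN uN C.
have xu : x != u by rewrite eq_sym.
pose i := flog (rank x u); pose j := flog (rank u y).
have iL : i < L.+1 by apply: (flog_rank_le NL W_self dvP).
have jL : j < L.+1 by apply: (flog_rank_le NL W_self dvP).
have Ei : ev qi = i by rewrite (eval_qslot (erefl : ev (Cst dLog) = dLog) Ex Eu) lg_ok.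
have Ej : ev qj = j by rewrite (eval_qslot (erefl : ev (Cst dLog) = dLog) Eu Ey) lg_ok.
have [l fin_xy] := crit_fin C.
have Exy := crit_dist D xN yN uN C.
have fin_xu : d x u <> None by move=> E; rewrite E fin_xy in Exy.
have fin_uy : d u y <> None by move=> E; rewrite E fin_xy oaddC in Exy.
have /andP[i_le _] := flogP (rank_gt0 N d dv xu).
have /andP[j_le _] := flogP (rank_gt0 N d dv uy).
have [|x' [x'N Hx' rx']] := rank_exists D xN uN xu (s := 2 ^ i).
  by rewrite pow2_gt0 i_le.
have yu : y != u by rewrite eq_sym.
have [|y' [y'N Hy' ry']] := rank_exists (avoid_dist_rev D) yN uN yu (s := 2 ^ j).
  by rewrite pow2_gt0 -(rank_rev N d dv u y) j_le.
rewrite -(rank_rev N d dv u y') in ry'.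
have Ox' : onpath x u x'.
  apply/(onpathP D) => //; split=> //.
  by case: Hx' => [->|?]; [constructor 1 | constructor 3].
have Oy' : onpath u y y'.
  apply/(onpathP D) => //; split=> //.
  by case: Hy' => [->|?]; [constructor 2 | constructor 3].
have [Cx' _ _] := landmark_crit D xN yN uN x'N C Hx'.
have [Cy' _ _] := landmark_crit (avoid_dist_rev D) yN xN uN y'N C Hy'.
have Oux' : onpath x' y u.
  apply/(onpathP D) => //; split; last by constructor 3.
  by have [l' ->] := crit_fin Cx'.
have Ouy' : onpath x y' u.
  apply/(onpathP D) => //; split; last by constructor 3.
  by have [l' El'] := crit_fin Cy'; rewrite El'.
have Sx' : ev qx' = x'.
  by rewrite (eval_qblock 6 Ei Ex Eu); apply: ((lm_ok i iL _ _ _ xN uN x'N Ox').1 rx').1.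
have Sy' : ev qy' = y'.
  by rewrite (eval_qblock 7 Ej Eu Ey); apply: ((lm_ok j jL _ _ _ uN yN y'N Oy').2 ry').1.
have S1 : ev (qblock qi 8 qx' qy) = encode (dv x' y u).
  rewrite (eval_qblock 8 Ei Sx' Ey).
  exact: ((lm_ok i iL _ _ _ x'N yN uN Oux').2 rx').2.
have S2 : ev (qblock qj 9 qx qy') = encode (dv x y' u).
  rewrite (eval_qblock 9 Ej Ex Sy').
  exact: ((lm_ok j jL _ _ _ xN y'N uN Ouy').1 ry').2.
have tL : i * L.+1 + j < L.+1 * L.+1.
  by have := leq_mul iL (leqnn L.+1); rewrite mulSn; lia.
have [ub ex] := cl_ok _ tL x y i j xN yN iL jL erefl.
have Cu : same_class N d dv x y i j u by rewrite /same_class C !eqxx.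
have [b [bN Cb Em]] := ex (ex_intro2 _ _ u uN Cu).
rewrite (avoid_formula D xN yN uN x'N y'N C Hx' rx' Hy' ry' ub); last by exists b.
apply: eval_eomin; first exact: eval_eoadd (eval_qdist Ex Sx' xN x'N) S1.
apply: eval_eomin; first exact: eval_eoadd S2 (eval_qdist Sy' Ey y'N yN).
rewrite decodeK; apply: eval_qslot => //.
apply: eval_add; first by apply: eval_add => //=; rewrite MLL.
by apply: eval_add => //; apply: eval_mul.
Qed.

Definition first_dist : option nat :=
  decode (if v.+1 == slot M dNext u y then slot M dSecond u y else slot M dDist u y).

Lemma eval_qfirst : ev qfirst = encode first_dist.
Proof.
have Sn := eval_qslot (erefl : ev (Cst dNext) = dNext) Eu Ey.
have Ss := eval_qslot (erefl : ev (Cst dSecond) = dSecond) Eu Ey.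
have Sd := eval_qslot (erefl : ev (Cst dDist) = dDist) Eu Ey.
rewrite /qfirst (eval_eif _ _ (eval_eq (eval_add Ev (erefl : ev (Cst 1) = 1)) Sn)).
by rewrite addn1 /first_dist decodeK Ss -Sd.
Qed.

Lemma eval_equery : ev equery = encode (cut_dist dv x y u first_dist).
Proof.
have Exy := eval_qdist Ex Ey xN yN; have Exu := eval_qdist Ex Eu xN uN.
rewrite /equery (eval_eif _ _ (eval_eq Eu Ey)) /cut_dist; case: (eqVneq u y) => // uy.
rewrite (eval_eif _ _ (eval_eq Eu Ex)); case: (eqVneq u x) => [_|ux].
  exact: eval_qfirst.
apply: eval_eomin; last exact: eval_eoadd Exu eval_qfirst.
rewrite (eval_eif _ _ eval_qonpath); case: ifPn => ou.
  have [_ [E|E|C]] := onpathP D xN yN uN ou;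
    [by rewrite E eqxx in ux | by rewrite E eqxx in uy |].
  exact: eval_qavoid.
rewrite Exy; congr encode; apply: ole_anti; first exact: (ad_le D).
apply: contraR ou => C; apply/(onpathP D) => //; split; last by constructor 3.
by have [l ->] := crit_fin C.
Qed.

End Oracle.

(** * Preprocessing *)

Definition init_regs : pram_prog :=
  set_reg rn (Get (Cst 0)) ++ (set_reg rN (Cst 1) ++ (set_reg rLL (Cst 1) ++
  (set_reg rc (Bin OpLt (Var rN) (Var rn)) ++
  ([:: Loop rc (set_reg rN (Bin OpAdd (Var rN) (Var rN)) ++
        (set_reg rLL (Bin OpAdd (Var rLL) (Cst 1)) ++
         set_reg rc (Bin OpLt (Var rN) (Var rn))))] ++
  (set_reg rNN (Bin OpMul (Var rN) (Var rN)) ++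
  (set_reg rQ (Bin OpAdd (Bin OpAdd (Cst 6) (Bin OpMul (Var rLL) (Cst 4)))
                 (Bin OpMul (Var rLL) (Var rLL))) ++
   set_reg rT (Bin OpAdd (Var rQ) (Var rN)))))))).

(** Padding vertices get no edges except their loops. The entry 1 on the diagonal encodes the weight
    0, and the offset 1 skips the cell containing [n]. *)
Definition eEdge : expr :=
  eif (Bin OpEq eX eY) (Cst 1)
    (eif (eand (Bin OpLt eX (Var rn)) (Bin OpLt eY (Var rn)))
      (Get (Bin OpAdd (Bin OpAdd (Bin OpMul eX (Var rn)) eY) (Cst 1))) (Cst 0)).

Definition load_edges : pram_prog :=
  slot_map (Cst dEdge) (Cst 1) eEdge ++
  slot_map (Var rQ) (Var rN) (eslot (Cst dEdge) eX eY).

(** Memory is written through [par_map] only, so a single cell is written by a team of one. *)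
Definition put (a : nat) (e : expr) : pram_prog :=
  set_reg rbase (Cst a) ++ (set_reg rcnt (Cst 1) ++ par_map rbase rcnt e).

Definition preprocess : pram_prog :=
  init_regs ++ (load_edges ++ (exclude ++ (edge_tables ++ (rank_table ++
  (landmark_tables ++ (class_tables ++ (put 0 (Var rN) ++ put 1 (Var rLL)))))))).

Definition init_time (L : nat) : nat :=
  tm + (tm + (tm + (tm + ((L * (tm + (tm + tm)).+1).+1 + (tm + (tm + tm)))))).

Definition put_time : nat := tm + (tm + tm).

Definition total_time (L : nat) : nat :=
  init_time L + ((tm + tm) + (exclude_time L + (edge_time L + (rank_time L +
  (landmark_time L + (class_time L + (put_time + put_time))))))).

(* The edges of the input graph, with a loop of weight 0 at each vertex. *)
Definition input_edge (n : nat) (M : memory) (x y : nat) : option nat :=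
  if x == y then Some 0
  else if (x < n) && (y < n) then decode (M (x * n + y + 1)) else None.

Section Preprocess.

Variables (w X n N L Q Wm : nat) (M0 : memory).
Hypotheses (X_gt1 : 1 < X) (fitX : X ^ maxdeg < 2 ^ w) (NL : N = 2 ^ L).
Hypotheses (QX : (Q + N + N).+2 * (N * N) <= X) (WX : (N.+1 * Wm).*2.+2 <= X).
Hypothesis def_Q : Q = 6 + L.+1 * 4 + L.+1 * L.+1.
Hypotheses (M0n : M0 0 = n) (M0X : forall a, M0 a <= X) (n_gt0 : 0 < n).
Hypotheses (nL : forall j, (2 ^ j < n) = (j < L)).

Local Notation W := (input_edge n M0).
Hypothesis W_le : forall u v e, W u v = Some e -> e <= Wm.

Local Notation T := (Q + N).
Local Notation wp := (wp w X (N * (N * N))).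
Local Notation slot := (slot N).

Lemma input_edge_self x : W x x = Some 0.
Proof. by rewrite /input_edge eqxx. Qed.

Lemma wp_init_regs (Q' : registers -> memory -> Prop) rho :
  bounded X rho M0 ->
  (forall rho', bounded X rho' M0 -> ctx N T rho' -> rho' rn = n -> rho' rQ = Q ->
     rho' rLL = L.+1 -> Q' rho' M0) ->
  wp init_regs (init_time L) Q' rho M0.
Proof.
move=> bd HQ; have N_gt0 : 0 < N := N_gt0 NL.
have NNX := tables_NX QX.
have NX : N <= X by apply: leq_trans NNX; rewrite leq_pmulr.
have nX : n <= X by rewrite -M0n.
have LX : L.+1 <= X by apply: leq_trans NX; rewrite NL ltn_expl.
have KX k : k <= T -> k <= X.
  move=> kT; apply: leq_trans QX; apply: leq_trans kT _.
  by apply: leq_trans (leq_pmulr _ (_ : 0 < N * N)); [lia | rewrite muln_gt0 N_gt0].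
apply: wp_cat; apply: (wp_set_tm _ X_gt1 fitX (v := n)) => // rho1 bd1 E1 k1.
apply: wp_cat; apply: (wp_set_tm _ X_gt1 fitX (v := 1)) => // [|rho2 bd2 E2 k2].
  exact: ltnW.
apply: wp_cat; apply: (wp_set_tm _ X_gt1 fitX (v := 1)) => // [|rho3 bd3 E3 k3].
  exact: ltnW.
have flag rho4 j (Q2 : registers -> memory -> Prop) :
    bounded X rho4 M0 -> rho4 rN = 2 ^ j -> rho4 rn = n ->
    (forall rho', bounded X rho' M0 -> rho' rc = (j < L) ->
      (forall r', r' != rc -> rho' r' = rho4 r') -> Q2 rho' M0) ->
    wp (set_reg rc (Bin OpLt (Var rN) (Var rn))) tm Q2 rho4 M0.
  move=> bd4 EN4 En4 HQ2; apply: (wp_set_tm _ X_gt1 fitX (v := (j < L))) => //.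
    by rewrite /= EN4 En4 nL.
  by case: (j < L) => //; apply: ltnW.
apply: wp_cat; apply: (flag _ 0) => // [||rho4 bd4 E4 k4].
- by rewrite k3 // E2.
- by rewrite k3 // k2.
pose I j rho' M' := [/\ rho' rn = n, rho' rN = 2 ^ j, rho' rLL = j.+1,
  rho' rc = (j < L) & M' = M0].
apply: wp_cat; apply: (wp_loop (I := I) (t := tm + (tm + tm)) (m := L)) => //.
- by split=> //; rewrite k4 // k3 // ?k2.
- move=> j rho5 M5 jL bd5 [En EN ELL Ec EM]; subst M5; split; first by rewrite Ec jL.
  have jX : 2 ^ j.+1 <= X by apply: leq_trans NX; rewrite NL leq_exp2l.
  apply: wp_cat; apply: (wp_set_tm _ X_gt1 fitX (v := 2 ^ j.+1)) => //.
    by rewrite /= EN expnS mul2n addnn.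
  move=> rho6 bd6 E6 k6.
  apply: wp_cat; apply: (wp_set_tm _ X_gt1 fitX (v := j.+2)) => //.
  + by rewrite /= k6 // ELL addn1.
  + exact: leq_trans LX.
  move=> rho7 bd7 E7 k7; apply: (flag _ j.+1) => //.
  + by rewrite k7.
  + by rewrite k7 // k6.
  by move=> rho8 bd8 E8 k8; split=> //; rewrite k8 // k7 // k6.
move=> rho5 M5 bd5 [En EN ELL Ec EM]; subst M5; rewrite -NL in EN.
split; first by rewrite Ec ltnn.
apply: wp_cat; apply: (wp_set_tm _ X_gt1 fitX (v := N * N)) => //.
  by rewrite /= EN.
move=> rho6 bd6 E6 k6.
apply: wp_cat; apply: (wp_set_tm _ X_gt1 fitX (v := Q)) => //.
- by rewrite /= k6 // ELL def_Q.
- by apply: KX; apply: leq_addr.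
move=> rho7 bd7 E7 k7; apply: (wp_set_tm _ X_gt1 fitX (v := T)) => //.
- by rewrite /= E7 k7 // k6 // EN.
- exact: KX.
move=> rho8 bd8 E8 k8; apply: HQ => //.
- by split=> //; rewrite k8 // k7 // k6.
- by rewrite k8 // k7 // k6.
- by rewrite k8.
by rewrite k8 // k7 // k6.
Qed.

Lemma wp_load_edges (Q' : registers -> memory -> Prop) rho :
  bounded X rho M0 -> ctx N T rho -> rho rn = n -> rho rQ = Q ->
  (forall rho' M', bounded X rho' M' -> keep rk rho rho' ->
     edges_only N Q W M' ->
     (forall x y, x < N -> y < N -> slot M' dEdge x y = encode (W x y)) ->
     Q' rho' M') ->
  wp load_edges (tm + tm) Q' rho M0.
Proof.
move=> bd cx En EQ HQ; have N_gt0 : 0 < N := N_gt0 NL.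
have [EN ENN ET] := cx.
have WXe x y : encode (W x y) <= X.
  case E: (W x y) => [e|] //=; have := W_le E; move: WX; rewrite -addnn mulSn.
  by lia.
apply: wp_cat; apply: (wp_slot_map X_gt1 fitX N_gt0 (cube_le QX) bd _ ENN
  (J := dEdge) (C := 1) (f := fun _ x y => encode (W x y))) => //.
- by apply: leq_trans QX; rewrite leq_mul2r def_Q /dEdge; apply/orP; right; lia.
- move=> rho' p x y _ xN yN lc; split=> //.
  have [Ex Ey Ep Es ED] := local_eval NL M0 cx EQ xN yN lc.
  have En' : eval (Var rn) rho' M0 = n by rewrite /= lc.2.
  rewrite /eEdge (eval_eif _ _ (eval_eq Ex Ey)) /input_edge; case: eqP => // _.
  rewrite (eval_eif _ _ (eval_eand (eval_lt Ex En') (eval_lt Ey En'))).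
  case: ifP => // _; rewrite decodeK.
  have Ea := eval_add (eval_add (eval_mul Ex En') Ey) (erefl : eval (Cst 1) rho' M0 = 1).
  by rewrite -Ea.
move=> rho1 M1 bd1 k1 H1.
have cx1 : ctx N T rho1 by apply: ctx_keep k1 cx.
have [EN1 ENN1 ET1] := cx1; have EQ1 : rho1 rQ = Q by rewrite k1.
have H5 x y : x < N -> y < N -> slot M1 dEdge x y = encode (W x y).
  by move=> xN yN; rewrite H1.
apply: (wp_slot_map X_gt1 fitX N_gt0 (cube_le QX) bd1 _ ENN1
  (J := Q) (C := N) (f := fun _ x y => encode (W x y))) => //.
- by move=> rho' k; rewrite /= k.
- by move=> rho' k; rewrite /= k.
- by rewrite N_gt0 leqnn.
- by apply: leq_trans QX; rewrite leq_mul2r; apply/orP; right; lia.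
- move=> rho' p x y _ xN yN lc; split=> //.
  have [Ex Ey Ep Es ED] := local_eval NL M1 cx1 EQ1 xN yN lc.
  by rewrite Es Ex Ey H5.
move=> rho2 M2 bd2 k2 H2; apply: HQ => //.
- by move=> r r7; rewrite k2 ?k1 //; lia.
- move=> x y p xN yN pN.
  by rewrite /tab H2 // leq_addr ltn_add2l pN /= encodeK.
move=> x y xN yN; rewrite H2 // H5 //.
by have -> : (Q <= dEdge) = false by rewrite def_Q.
Qed.

Lemma wp_put a e v (Q' : registers -> memory -> Prop) rho M :
  bounded X rho M -> a <= X -> v <= X ->
  [&& set_ok rbase (Cst a), fits e & (size (map_code rbase e)).+2 <= tm] ->
  (forall rho', (forall r, 0 < r < rbase -> rho' r = rho r) -> eval e rho' M = v) ->
  (forall rho' M', bounded X rho' M' -> keep rbase rho rho' ->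
     M' a = v -> (forall b, b != a -> M' b = M b) -> Q' rho' M') ->
  wp (put a e) put_time Q' rho M.
Proof.
move=> bd aX vX /and3P[oka fe sz] Ee HQ; have N_gt0 : 0 < N := N_gt0 NL.
apply: wp_cat; apply: (wp_set_tm _ X_gt1 fitX (v := a)) => // rho1 bd1 E1 k1.
apply: wp_cat; apply: (wp_set_tm _ X_gt1 fitX (v := 1)) => // [|rho2 bd2 E2 k2].
  exact: ltnW.
have Eb : rho2 rbase = a by rewrite k2.
apply: (wp_weaken (Q1 := fun rho' M' => rho' = rho2 /\
  M' = overwrite M (rho2 rbase) (rho2 rcnt) (fun=> v)) _ sz).
  apply: (wp_map X_gt1 fitX (f := fun=> v)) => //.
    by rewrite E2 !muln_gt0 N_gt0.
  move=> i _; split=> //; apply: Ee => r /andP[r0 r14].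
  by rewrite upd_other ?k2 ?k1 //; lia.
move=> rho3 M3 bd3 [E3 EM]; subst rho3; apply: HQ => //.
- by move=> r r14; rewrite k2 ?k1 //; lia.
- by rewrite EM /overwrite Eb E2 leqnn addn1 ltnSn.
move=> b ba; rewrite EM /overwrite Eb E2; case: ifP => //.
by lia.
Qed.

Lemma slot_put a M M' j x y : a < 2 -> (forall b, b != a -> M' b = M b) ->
  slot M' j x y = slot M j x y.
Proof.
move=> a2 fr; rewrite /slot fr //; have := N_gt0 NL.
have : 0 < N * N by rewrite muln_gt0 (N_gt0 NL).
by move: (x * N) (N * N) => c K; rewrite !mulSn; lia.
Qed.

Lemma wp_preprocess rho : bounded X rho M0 ->
  wp preprocess (total_time L) (fun _ M' => exists dv : nat -> nat -> nat -> option nat,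
    [/\ forall x y v, x < N -> y < N -> v < N ->
          ismin W (allow (avoid N v)) x y (dv x y v),
        oracle N L W dv M', M' 0 = N & M' 1 = L.+1]) rho M0.
Proof.
move=> bd; have NNX := tables_NX QX; have N_gt0 : 0 < N := N_gt0 NL.
have NX : N <= X by apply: leq_trans NNX; rewrite leq_pmulr.
have LX : L.+1 <= X by apply: leq_trans NX; rewrite NL ltn_expl.
have Q5 : 5 < Q by rewrite def_Q.
have W_self := input_edge_self.
have WX' : (N.+1 * Wm).*2.+1 <= X by apply: ltnW.
apply: wp_cat; apply: wp_init_regs => // rho1 bd1 cx1 En1 EQ1 ELL1.
apply: wp_cat; apply: wp_load_edges => // rho2 M2 bd2 k2 EM2 EW2.
have cx2 : ctx N T rho2 by apply: ctx_keep k2 cx1.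
have EQ2 : rho2 rQ = Q by rewrite k2.
have ELL2 : rho2 rLL = L.+1 by rewrite k2.
apply: wp_cat; apply: (wp_exclude X_gt1 fitX NL QX WX' W_le bd2 cx2 EQ2 ELL2 EM2).
move=> rho3 M3 bd3 k3 ex3 fr3.
have cx3 : ctx N T rho3 by apply: ctx_keep k3 cx2.
have EQ3 : rho3 rQ = Q by rewrite k3.
have ELL3 : rho3 rLL = L.+1 by rewrite k3.
(* At level 0 blocks are single vertices, so table [v] excludes [v] alone. *)
pose dv x y v := tab N Q M3 x y v.
have dvP x y v : x < N -> y < N -> v < N -> ismin W (allow (avoid N v)) x y (dv x y v).
  move=> xN yN vN; apply: ismin_ext (ex3 x y v xN yN vN) => q.
  rewrite /allow (@eq_all _ (outside N 0 v) (avoid N v)) // => b.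
  by rewrite /outside /avoid !divn1.
have st3 : stored N Q W dv M3.
  split=> [x y v xN yN vN|x y xN yN]; first by rewrite slot_tab.
  by rewrite fr3 // EW2.
apply: wp_cat; apply: (wp_edge_tables X_gt1 fitX NL QX WX Q5 W_le W_self dvP
  bd3 cx3 EQ3 ELL3 st3).
move=> rho4 M4 bd4 k4 qc4 st4 e4.
apply: wp_cat; apply: (wp_rank_table X_gt1 fitX NL QX def_Q W_self dvP bd4 qc4) => //.
move=> rho5 M5 bd5 k5 qc5 bs5 rk5.
apply: wp_cat; apply: (wp_landmark_tables X_gt1 fitX NL QX def_Q W_self dvP bd5 qc5) => //.
move=> rho6 M6 bd6 k6 bs6 rk6 lg6 lm6.
have qc6 : qctx N L Q rho6 by apply: qctx_keep k6 qc5.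
apply: wp_cat; apply: (wp_class_tables X_gt1 fitX NL QX def_Q W_self dvP bd6 qc6) => //.
move=> rho7 M7 bd7 k7 [_ e7] rk7 lg7 lm7 cl7.
have or7 : oracle N L W dv M7 by split.
have [[EN6 _ _] _ ELL6 _] := qc6.
apply: wp_cat; apply: (wp_put (v := N)) => //.
  by move=> rho' k; rewrite /= k // k7.
move=> rho8 M8 bd8 k8 E8 fr8; apply: (wp_put (v := L.+1)) => // [|rho' k|rho9 M9 bd9 k9 E9 fr9].
- exact: ltnW.
- by rewrite /= k // k8 // k7.
exists dv; split=> //; last by rewrite fr9.
apply: oracle_frame or7 => // j x y _ _ _.
by rewrite (slot_put _ _ _ _ fr9) // (slot_put _ _ _ _ fr8).
Qed.

End Preprocess.

(** * Input graphs *)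

Lemma nth_allpairs (S T R : Type) (f : S -> T -> R) r s t s0 t0 i j :
  i < size s -> j < size t ->
  nth r [seq f a b | a <- s, b <- t] (i * size t + j) = f (nth s0 s i) (nth t0 t j).
Proof.
move=> + jt; elim: s i => // a s IHs [|i] /= is_; rewrite nth_cat size_map.
  by rewrite jt (nth_map t0).
rewrite mulSn -addnA ltnNge leq_addr /= addKn; exact: IHs.
Qed.

Section Input.

Variables (n : nat) (E : {set 'I_n * 'I_n}) (wt : 'I_n * 'I_n -> nat).

Local Notation M0 := (graph_mem E wt).

Lemma graph_mem_edge (x y : 'I_n) :
  M0 (x * n + y + 1) = encode (if (x, y) \in E then Some (wt (x, y)) else None).
Proof.
rewrite /graph_mem addn1 /= -[X in _ * X](size_enum_ord n).
by rewrite (nth_allpairs _ _ x y) ?size_enum_ord // !nth_ord_enum.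
Qed.

Lemma input_edgeE (x y : 'I_n) : input_edge n M0 x y =
  if x == y then Some 0 else if (x, y) \in E then Some (wt (x, y)) else None.
Proof. by rewrite /input_edge !ltn_ord /= graph_mem_edge encodeK. Qed.

Lemma input_edge_ord a b : input_edge n M0 a b <> None -> a = b \/ a < n /\ b < n.
Proof. by rewrite /input_edge; case: eqP => [->|_]; [left | case: ifP => // /andP; right]. Qed.

Lemma input_edge_le a b e : input_edge n M0 a b = Some e -> e <= \max_(e in E) wt e.
Proof.
move=> Eab; have [ab|[an bn]] := @input_edge_ord a b ltac:(by rewrite Eab).
  by move: Eab; rewrite /input_edge ab eqxx => -[<-].
move: Eab; rewrite (input_edgeE (Ordinal an) (Ordinal bn)); case: eqP => [_ [<-]//|_].
by case: ifP => // inE [<-]; apply: (leq_bigmax_cond (Ordinal an, Ordinal bn)).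
Qed.

Lemma graph_mem_le X : n <= X -> (\max_(e in E) wt e).+1 <= X ->
  forall a, M0 a <= X.
Proof.
move=> nX WX a; have [a_lt|a_ge] := ltnP a (size (n :: [seq
    encode (if (u, v) \in E then Some (wt (u, v)) else None)
    | u <- enum 'I_n, v <- enum 'I_n])); last by rewrite /graph_mem nth_default.
have := mem_nth 0 a_lt; rewrite -/(graph_mem E wt a) inE => /orP[/eqP->//|].
case/allpairsP => [[u v] [_ _ ->]]; case: ifP => //= uvE.
by apply: leq_ltn_trans WX; apply: leq_bigmax_cond.
Qed.

End Input.

Section Distances.

Variables (n N : nat) (E : {set 'I_n * 'I_n}) (wt : 'I_n * 'I_n -> nat)
  (W : nat -> nat -> option nat).
Hypothesis nN : n <= N.
Hypothesis W_in : forall x y : 'I_n, W x y =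
  if x == y then Some 0 else if (x, y) \in E then Some (wt (x, y)) else None.
Hypothesis W_out : forall a b, W a b <> None -> a = b \/ a < n /\ b < n.

Lemma path_wlen x p : path (edge_rel E) x p ->
  ole (wlen W x (map val p)) (Some (walk_weight wt x p)).
Proof.
elim: p x => [|y p IHp] x //= /andP[xy /IHp].
rewrite /walk_weight /= W_in; case: eqP => [->|_]; last rewrite [_ \in E]xy.
  by rewrite add0o => h; apply: ole_trans h _; apply: leq_addl.
by case: (wlen _ _ _) => //= l; rewrite leq_add2l.
Qed.

(** The loops of weight 0 in [W] need not be edges of the graph; they are dropped from the walk. *)
Lemma wlen_path (x : 'I_n) q l : wlen W x q = Some l -> exists p : seq 'I_n,
  [/\ path (edge_rel E) x p, val (last x p) = last (val x) q & walk_weight wt x p = l].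
Proof.
elim: q x l => [|b q IHq] x l /=; first by case=> <-; exists [::].
case Exb: (W x b) => [e|] //; case Eq: (wlen W b q) => [l'|] //= [<-].
have [xb|[_ bn]] := @W_out x b ltac:(by rewrite Exb).
  rewrite -xb in Eq Exb *; have [p [pp pl pw]] := IHq x l' Eq.
  exists p; split=> //; rewrite pw; move: Exb; rewrite W_in eqxx => -[<-].
  by [].
have [p [pp pl pw]] := IHq (Ordinal bn) l' Eq.
move: Exb; rewrite (W_in x (Ordinal bn)); case: eqP => [xb [<-]|_].
  by exists p; rewrite xb add0n.
case: ifP => // xbE [<-]; exists (Ordinal bn :: p); split=> //=.
  by rewrite /edge_rel xbE.
by rewrite /walk_weight /= -/(walk_weight wt (Ordinal bn) p) pw.
Qed.

Lemma ismin_is_dist (x y : 'I_n) d :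
  ismin W (allow (within N)) x y d -> is_dist E wt x y d.
Proof.
move=> [le ex]; have lower p : path (edge_rel E) x p -> last x p = y ->
    ole d (Some (walk_weight wt x p)).
  (* The empty walk is matched by the loop at [x], as [ismin] considers only walks with an edge. *)
  case/lastP: p => [|p z] pp; first move=> /= xy.
    have := le [::] isT; rewrite /= oadd0 W_in -xy eqxx.
    by case: d {le ex} => //= l; rewrite leqn0 => /eqP->.
  rewrite last_rcons => zy; rewrite zy in pp *.
  apply: ole_trans (path_wlen pp); rewrite map_rcons; apply: le.
  apply/allP => b /mapP[c _ ->]; apply: leq_trans nN; exact: ltn_ord.
case: d le ex lower => [l|] _ ex lower; last by move=> p pp lp; have := lower p pp lp.
split; last by move=> p pp lp; apply: lower.
have [q [_ Eq]] := ex l erefl; have [p [pp pl pw]] := wlen_path Eq.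
by exists p; split=> //; apply: val_inj; rewrite pl last_rcons.
Qed.

End Distances.

(** * Complexity *)

(** Two phases are cubic in [L.+1]: [exclude] performs a reduction in every round of every level,
    and there is a reduction for each of the [L.+1 * L.+1] classes. *)
Lemma total_time_le L : total_time L <= 140 * tm * L.+1 ^ 3.
Proof.
have tm_gt0 : 0 < tm by [].
rewrite /total_time /init_time /exclude_time /inner_time /edge_time /rank_time
  /landmark_time /landmark_step_time /class_time /put_time /relax_time /reduce_time.
move: tm tm_gt0 => c c_gt0.
have h1 : L <= c * L by rewrite leq_pmull.
have h2 : L * L <= c * (L * L) by rewrite leq_pmull.
have h3 : L * L * L <= c * (L * L * L) by rewrite leq_pmull.
by rewrite !expnS expn0 muln1; lia.
Qed.

Lemma ltn_up_log n j : 0 < n -> (2 ^ j < n) = (j < up_log 2 n).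
Proof.
move=> n_gt0; apply/idP/idP => [h|h].
  rewrite -(ltn_exp2l (m := 2)) //; apply: leq_trans h _; exact: up_logP.
rewrite ltnNge; apply/negP => /(up_log_min (isT : 1 < 2)).
by rewrite leqNgt h.
Qed.

Lemma up_log_lg n : up_log 2 n <= lg n.
Proof. by apply: up_log_min => //; apply: ltnW; apply: trunc_log_ltn. Qed.

Lemma pow_up_log n : 0 < n -> 2 ^ up_log 2 n <= 2 * n.
Proof.
move=> n_gt0; case def_L: (up_log 2 n) => [|l]; first by lia.
have : l < up_log 2 n by rewrite def_L.
by rewrite -ltn_up_log // expnS => h; lia.
Qed.

Lemma cut_dist_loop N (W : nat -> nat -> option nat) dv x y u :
  avoid_dist N (dist dv) dv -> x < N -> y < N -> u < N ->
  cut_dist dv x y u (dist dv u y) = dist dv x y.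
Proof.
move=> D xN yN uN; rewrite /cut_dist; case: eqP => // _.
case: (eqVneq u x) => [->//|_]; apply: ole_anti.
  case: (ad_split D xN yN uN) => h; apply: ole_trans h; first exact: omin_lel.
  exact: omin_ler.
rewrite /omin; case: ifP => _; first exact: (ad_le D).
exact: (ad_tri D).
Qed.

Lemma dist_edge_removed n N L (E : {set 'I_n * 'I_n}) (wt : 'I_n * 'I_n -> nat) dv M
    (x y : 'I_n) (e : 'I_n * 'I_n) :
  let W := input_edge n (graph_mem E wt) in
  n <= N -> oracle N L W dv M ->
  (forall x y v, x < N -> y < N -> v < N -> ismin W (allow (avoid N v)) x y (dv x y v)) ->
  is_dist (E :\ e) wt x y (cut_dist dv x y e.1 (first_dist N M y e.1 e.2)).
Proof.
move=> W nN orM dvP; case: e => u v /=.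
have inN (z : 'I_n) : z < N by apply: leq_trans nN; apply: ltn_ord.
have W_self := @input_edge_self n (graph_mem E wt).
have D := avoid_distP W_self dvP.
have [[e1 e2 e3] _ _ _ _] := orM.
(* A loop is invisible in [W], whose diagonal is 0 in any case, so its removal changes no
   distance. *)
case: (eqVneq u v) => [<-|uv].
  have -> : first_dist N M y u u = dist dv u y.
    by rewrite /first_dist eq_sym (negPf (e3 u y _ _)) ?inN // e1 ?inN // encodeK.
  rewrite (cut_dist_loop W D) ?inN //.
  apply: (ismin_is_dist (N := N) (W := W)) (distP dvP _ _) => //.
  - move=> a b; rewrite /W input_edgeE !inE xpair_eqE; case: (eqVneq a b) => // ab.
    case: (eqVneq a u) => //= au; case: (eqVneq b u) => // bu.
    by rewrite au bu eqxx in ab.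
  - exact: input_edge_ord.
apply: (ismin_is_dist (N := N) (W := cut W u v)) => //.
- move=> a b; rewrite /cut /W input_edgeE !inE xpair_eqE.
  case: (eqVneq a b) => [<-|ab].
    case: eqP => // /val_inj->; case: eqP => // /val_inj E'.
    by rewrite E' eqxx in uv.
  rewrite -!(inj_eq val_inj) /=; case: (_ && _) => //=.
- by move=> a b; rewrite /cut; case: ifP => // _; apply: input_edge_ord.
apply: cut_distP => //; try exact: inN.
move=> uy; apply: e2 => //; exact: inN.
Qed.

(** For [Y = n + Wm + 2], which is at least 3, one has [N * N <= Y ^ 4]; there are at most
    [15 * (N * N)] tables of [N * N] cells, and [15 <= 3 ^ 4 <= Y ^ 4]. Three factors [Y ^ 4] give
    the exponent 12. *)
Lemma size_bounds n Wm (L := up_log 2 n) (N := 2 ^ L)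
    (Q := 6 + L.+1 * 4 + L.+1 * L.+1) (X := (n + Wm + 2) ^ 12) : 0 < n ->
  [/\ (Q + N + N).+2 * (N * N) <= X, (N.+1 * Wm).*2.+2 <= X, n <= X & Wm.+1 <= X].
Proof.
move=> n_gt0; rewrite /X; set Y := n + Wm + 2.
have Y3 : 3 <= Y by rewrite /Y; lia.
have NY : N <= Y * Y.
  by apply: leq_trans (pow_up_log n_gt0) _; apply: leq_mul; rewrite /Y; lia.
have N_gt0 : 0 < N by apply: pow2_gt0.
have LN : L.+1 <= N by apply: ltn_expl.
have YY k : 0 < k -> Y <= Y ^ k.
  by move=> k0; rewrite -{1}[Y]expn1 leq_exp2l //; apply: ltnW.
have le2 : (Q + N + N).+2 <= 15 * (N * N).
  have := leq_mul LN LN; have := leq_pmulr N N_gt0; rewrite /Q.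
  by move: (L.+1) LN => Z; lia.
have le4 : N * N <= Y ^ 4.
  by have := leq_mul NY NY; rewrite !expnS expn0 muln1 !mulnA.
split.
- apply: leq_trans (leq_mul le2 (leqnn _)) _.
  have -> : 12 = 4 + (4 + 4) by [].
  rewrite !expnD -mulnA; apply: leq_mul; last exact: leq_mul.
  by apply: leq_trans (_ : 3 ^ 4 <= _); rewrite ?leq_exp2r.
- have WY : Wm <= Y by rewrite /Y; lia.
  have NW : N.+1 * Wm <= (Y * Y).+1 * Y by apply: leq_mul.
  have Y9 : 3 * 3 <= Y * Y by apply: leq_mul.
  have YY3 : Y <= Y * Y * Y by rewrite leq_pmull // muln_gt0; lia.
  apply: (@leq_trans (Y ^ 5)); last by rewrite leq_exp2l //; lia.
  have -> : Y ^ 5 = Y * Y * (Y * Y * Y) by rewrite !expnS expn0 muln1 !mulnA.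
  have aux H K Z G : H <= Z + K -> Z <= K -> 3 * 3 * K <= G -> 3 <= Z ->
    (H + H).+2 <= G by clear; lia.
  rewrite -addnn; apply: aux YY3 _ Y3; first by rewrite -mulSn.
  exact: leq_mul.
- by apply: leq_trans (YY 12 isT); rewrite /Y; lia.
by apply: leq_trans (YY 12 isT); rewrite /Y; lia.
Qed.

Lemma double_cube_lt a b : 0 < b -> a <= 2 * b -> a * (a * a) < 9 * b ^ 3.
Proof.
move=> b_gt0 ab; have := leq_mul ab (leq_mul ab ab).
have : 0 < b ^ 3 by rewrite expn_gt0 b_gt0.
by rewrite !expnS expn0 muln1; lia.
Qed.

Lemma Pr_true (Omega : finType) (A : Omega -> Prop) (o : Omega) :
  (forall omega, A omega) -> Pr A = 1%R.
Proof.
move=> AT; rewrite /Pr.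
have -> : [set omega | `[< A omega >]] = [set: Omega].
  by apply/setP => omega; rewrite !inE; apply/asboolP.
rewrite cardsT GRing.divff // Num.Theory.pnatr_eq0 -lt0n; apply/card_gt0P.
by exists o.
Qed.

Lemma table_count_le n (Z := (up_log 2 n).+1) : (6 + Z * 4 + Z * Z).+2 <= 20 * lg n ^ 2.
Proof.
have Zl : Z <= 2 * lg n by rewrite /Z mul2n -addnn -addn1 leq_add // up_log_lg.
have := leq_mul Zl Zl; have := leq_pmulr (lg n) (isT : 0 < lg n).
have : 0 < lg n by [].
by rewrite !expnS expn0 muln1; move: (lg n) Zl; rewrite /Z; lia.
Qed.

Theorem theorem2 (c : nat) :
  exists (preprocess : pram_prog) (query : ram_prog) (C k kappa : nat),
  forall (n m : nat) (E : {set 'I_n * 'I_n}) (wt : 'I_n * 'I_n -> nat) (w : nat),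
    0 < n -> #|E| = m ->
    (n + \max_(e in E) wt e + 2) ^ kappa <= 2 ^ w ->
    let T := C * lg n ^ k in
    let P := C * n ^ 3 * lg n ^ k in
    let S := C * n ^ 2 * lg n ^ k in
    exists M : coin_space T P w -> memory,
      (forall omega : coin_space T P w,
         exists t wk : nat,
           [/\ pram_run w (coins_of omega) preprocess (graph_mem E wt) (M omega) t wk,
               t <= T & wk <= P]) /\
      (1 - 1 / n%:R ^+ c <=
         Pr (fun omega : coin_space T P w =>
               forall (x y : 'I_n) (e : 'I_n * 'I_n), e \in E ->
               exists (d : option nat) (q : nat),
                 [/\ is_dist (E :\ e) wt x y d,
                     ram_run w query (truncate_mem S (M omega))
                       [:: val x; val y; val e.1; val e.2] (encode d) q
                   & (q <= C)%N]))%R.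
Proof.
(* The bound [80 = 20 * 4] is for the size: at most [20 * lg n ^ 2] tables of at most [4 * n ^ 2]
   cells each. *)
have [K [K80 time_le]] : exists K, 80 <= K /\ forall L, total_time L <= K * L.+1 ^ 3.
  exists (80 + 140 * tm); split; first exact: leq_addr.
  move=> L; apply: leq_trans (total_time_le L) _; rewrite leq_mul2r.
  by apply/orP; right; exact: leq_addl.
exists preprocess, [seq Do i | i <- assign 0 equery].
set s := size (assign 0 equery).
(* [72 = 8 * 9], with 8 from [L.+1 <= 2 * lg n] cubed and 9 from [N ^ 3 + 1 <= 9 * n ^ 3]; [s] is
   the length of the query code. The exponent 12 is that of [X], and the extra 1 makes the word
   bound strict. *)
exists (72 * K + s), 3, (12 * maxdeg + 1).
set C := 72 * K + s; have Cs : s <= C by exact: leq_addl.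
have C_K : 72 * K <= C by exact: leq_addr.
have C80 : 80 <= C.
  by apply: leq_trans C_K; apply: leq_trans K80 _; rewrite leq_pmull.
clearbody C; move=> n m E wt w n_gt0 _ word T P S.
set Wm := \max_(e in E) wt e in word *.
pose L := up_log 2 n; pose N := 2 ^ L; pose Q := 6 + L.+1 * 4 + L.+1 * L.+1.
pose X := (n + Wm + 2) ^ 12.
have [QX WX nX WX1] := size_bounds Wm n_gt0; rewrite -/L -/N -/Q -/X in QX WX nX WX1.
have Y_gt1 : 1 < n + Wm + 2 by exact: leq_addl.
have X_gt1 : 1 < X.
  rewrite /X; move: (n + Wm + 2) Y_gt1; clear => Y Y_gt1.
  by apply: (leq_trans Y_gt1); rewrite -{1}[Y]expn1 leq_exp2l.
have fitX : X ^ maxdeg < 2 ^ w.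
  rewrite /X; move: (n + Wm + 2) Y_gt1 word; clear => Y Y_gt1 word.
  by apply: leq_trans word; rewrite -expnM ltn_exp2l // addn1.
have M0X := graph_mem_le nX WX1.
have nL j : (2 ^ j < n) = (j < L) by apply: ltn_up_log.
have bd0 : bounded X (fun=> 0) (graph_mem E wt) by [].
have W_le := @input_edge_le n E wt.
have [rho [M [bd [dv [dvP orM MN MLL]] run]]] := pram_run_wp
  (wp_preprocess X_gt1 fitX (erefl N) QX WX (erefl Q) (erefl n) M0X n_gt0 nL W_le bd0).
have lg_gt0 : 0 < lg n by [].
have lgL : L.+1 <= 2 * lg n.
  by rewrite mul2n -addnn -addn1 leq_add // up_log_lg.
have N_gt0 : 0 < N by apply: pow2_gt0.
have N2n : N <= 2 * n by apply: pow_up_log.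
exists (fun=> M); split.
  move=> omega; have [t [wk [prun t_le wk_le]]] := run (coins_of omega).
  have {}time_le : total_time L <= 8 * K * lg n ^ 3.
    apply: leq_trans (time_le L) _.
    have : L.+1 ^ 3 <= (2 * lg n) ^ 3 by rewrite leq_exp2r.
    by rewrite expnMn [8 * K]mulnC -mulnA leq_mul2l => ->; rewrite orbT.
  exists t, wk; split=> //.
    apply: leq_trans t_le _; apply: leq_trans time_le _; rewrite /T leq_mul2r.
    by apply/orP; right; apply: leq_trans C_K; rewrite leq_mul2r orbT.
  apply: leq_trans wk_le _; apply: leq_trans (leq_mul time_le (leqnn _)) _.
  have B_le : (N * (N * N)).+1 <= 9 * n ^ 3.
    exact: double_cube_lt n_gt0 N2n.
  apply: leq_trans (leq_mul (leqnn _) B_le) _; rewrite /P.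
  have := leq_mul (leq_mul C_K (leqnn (n ^ 3))) (leqnn (lg n ^ 3)).
  by move: (n ^ 3) (lg n ^ 3); clear => n3 l3; lia.
(* [Pr] divides by the number of outcomes, so one must be exhibited before the probability is 1. *)
have o : coin_space T P w by exact: [ffun=> Ordinal (expn_gt0 2 w)].
rewrite (Pr_true o).
  by rewrite Num.Theory.gerBl Num.Theory.divr_ge0 ?Num.Theory.exprn_ge0 ?Num.Theory.ler0n.
move=> omega x y e _.
have nN : n <= N by apply: up_logP.
have inN (z : 'I_n) : z < N by apply: leq_trans nN; apply: ltn_ord.
have NN_le : N * N <= 4 * n ^ 2.
  by rewrite -[4]/(2 * 2) expnS expn1 (mulnACA 2 2 n n); apply: leq_mul.
have slots_S j a b : j < Q -> a < N -> b < N -> j.+2 * (N * N) + a * N + b < S.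
  move=> jQ aN bN; have := cell_lt aN bN.
  have Q_le : Q.+2 <= 20 * lg n ^ 2 by exact: table_count_le.
  have S_ge : Q.+2 * (N * N) <= S.
    apply: leq_trans (leq_mul Q_le NN_le) _; rewrite /S.
    have h := leq_mul C80 (leqnn (n ^ 2 * lg n ^ 3)).
    have h2 : lg n ^ 2 <= lg n ^ 3 by rewrite leq_pexp2l.
    have := leq_mul (leqnn (80 * n ^ 2)) h2.
    by move: (n ^ 2) (lg n ^ 2) (lg n ^ 3) h; clear => n2 l2 l3; lia.
  have := leq_mul (_ : j.+3 <= Q.+2) (leqnn (N * N)); rewrite !ltnS => /(_ jQ).
  by move: (N * N) S_ge => K2; move: (a * N) => c2; clear; rewrite mulSn; lia.
have slot_S j a b : j < Q -> a < N -> b < N -> slot N (truncate_mem S M) j a b = slot N M j a b.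
  by move=> jQ aN bN; rewrite /slot /truncate_mem slots_S.
have or' := oracle_frame (erefl Q) slot_S orM.
have S2 : 1 < S.
  have := slots_S 0 0 0 isT N_gt0 N_gt0; rewrite mul0n !addn0; apply: leq_trans.
  by rewrite ltnS !muln_gt0 N_gt0.
have bd' : bounded X (nth 0 [:: val x; val y; val e.1; val e.2]) (truncate_mem S M).
  split=> [r _|a]; last by rewrite /truncate_mem; case: ifP => // _; apply: bd.2.
  have zX (z : 'I_n) : z <= X by apply: leq_trans nX; apply: ltnW.
  by case: r => [|[|[|[|r]]]] /=; rewrite ?zX // nth_nil.
have run_q := ram_run_assign X_gt1 fitX bd' fits_equery.
exists (cut_dist dv x y e.1 (first_dist N (truncate_mem S M) y e.1 e.2)), s.
split=> //; first exact: dist_edge_removed nN or' dvP.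
rewrite -(eval_equery (erefl Q) (erefl N) (@input_edge_self n (graph_mem E wt)) dvP or'
  _ _ (inN x) (inN y) (inN e.1) (inN e.2)
  (rho := nth 0 [:: val x; val y; val e.1; val e.2])) //.
- by rewrite /truncate_mem (ltn_trans _ S2).
- by rewrite /truncate_mem S2.
Qed.
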